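(* Let $\varphi:\mathcal{A}^{\mathbb{N}}\to\mathbb{R}$ be a (normalized) potential of summable variation with equilibrium state $\mu_\varphi$. Assume that $\varphi$ is not of the form $u-u\circ\theta-\log|\mathcal{A}|$ for some continuous function $u:\mathcal{A}^{\mathbb{N}}\to\mathbb{R}$ (i.e., $\mu_\varphi$ is not the measure of maximal entropy). Then the return-time $L^q$-spectrum $$\mathcal{R}_\varphi(q):=\lim_{n\to\infty}\frac1n\log\int R_n(x)^q\,d\mu_\varphi(x)$$ exists for every $q\in\mathbb{R}$, and $$\mathcal{R}_\varphi(q)=\begin{cases}P((1-q)\varphi) & \text{for } q\ge q_\varphi^*,\\[2pt] \sup_{\eta\in\mathscr{M}_\theta(\mathcal{A}^{\mathbb{N}})}\int\varphi\,d\eta & \text{for } q<q_\varphi^*,\end{cases}$$ where $q_\varphi^*\in[-1,0[$ is the unique real solution $q$ of the equation $P((1-q)\varphi)=\sup_{\eta\in\mathscr{M}_\theta(\mathcal{A}^{\mathbb{N}})}\int\varphi\,d\eta$.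
   Context: $\mathcal{A}$ is a finite alphabet (with at least two elements), $\mathbb{N}=\{0,1,2,\dots\}$, $\mathcal{A}^{\mathbb{N}}$ carries the product topology and its Borel $\sigma$-algebra, and $\theta$ is the left shift, $(\theta x)_i=x_{i+1}$. $\mathscr{M}_\theta(\mathcal{A}^{\mathbb{N}})$ is the set of $\theta$-invariant Borel probability measures. For $x\in\mathcal{A}^{\mathbb{N}}$, $x_i^j=(x_i,\dots,x_j)$. A potential $\varphi:\mathcal{A}^{\mathbb{N}}\to\mathbb{R}$ is of summable variation if $\sum_n \mathrm{var}_n(\varphi)<\infty$, where $\mathrm{var}_n(\varphi)=\sup\{|\varphi(x)-\varphi(y)|: x_0^{n-1}=y_0^{n-1}\}$. For a continuous potential $\psi$, the topological pressure is $P(\psi)=\sup_{\eta\in\mathscr{M}_\theta(\mathcal{A}^{\mathbb{N}})}\{h(\eta)+\int\psi\,d\eta\}$, where $h(\eta)$ is the measure-theoretic entropy of $\theta$ (natural logarithm). For $\varphi$ of summable variation and $\beta\in\mathbb{R}$, $\beta\varphi$ has a unique equilibrium state $\mu_{\beta\varphi}$, i.e. a unique invariant measure attaining the supremum defining $P(\beta\varphi)$. Standing assumption: $\varphi$ is normalized, i.e. $\sum_{a\in\mathcal{A}}e^{\varphi(ax)}=1$ for all $x\in\mathcal{A}^{\mathbb{N}}$; in particular $P(\varphi)=0$ and $\varphi<0$. The return time is $R_n(x)=\inf\{k\ge1: x_k^{k+n-1}=x_0^{n-1}\}$. *)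

(* Defs.v *)
From HB Require Import structures.
From mathcomp Require Import all_boot all_order all_algebra.
From mathcomp Require Import all_classical all_reals all_analysis.

Set Implicit Arguments.
Unset Strict Implicit.
Unset Printing Implicit Defensive.

Import Order.TTheory GRing.Theory Num.Theory.
Import numFieldNormedType.Exports.

Local Open Scope classical_set_scope.
Local Open Scope ring_scope.

(* The one-sided full shift over a finite alphabet A. The proof that A has at
   least two letters is a parameter of the type because measurable types must
   be pointed. *)
Definition full_shift (A : finType) (hA : (1 < #|A|)%N) : Type :=
  prod_topology (fun _ : nat => discrete_topology A).

Section full_shift_structures.
Context (A : finType) (hA : (1 < #|A|)%N).
Local Notation X := (full_shift hA).

HB.instance Definition _ := Choice.on X.
HB.instance Definition _ :=
  isPointed.Build X (fun=> enum_val (Ordinal (ltnW hA))).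
HB.instance Definition _ := Topological.on X.
HB.instance Definition _ :=
  Measurable.copy X (g_sigma_algebraType (@open X)).

End full_shift_structures.

Section symbolic_dynamics.
Context (R : realType) (A : finType) (hA : (1 < #|A|)%N).
Local Notation X := (full_shift hA).

Definition left_shift (x : X) : X := fun i => x i.+1.

(* the concatenation ax *)
Definition prepend (a : A) (x : X) : X := fun i => if i is j.+1 then x j else a.

Definition invariant_measures : set (probability X R) :=
  [set eta | forall B, measurable B -> eta (left_shift @^-1` B) = eta B].

Definition var_n (phi : X -> R) (n : nat) : \bar R :=
  ereal_sup [set e : \bar R | exists x y : X,
    (forall i, (i < n)%N -> x i = y i) /\ e = `|phi x - phi y|%:E].

Definition summable_variation (phi : X -> R) : Prop :=
  (\sum_(0 <= n <oo) var_n phi n < +oo)%E.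

Definition normalized (phi : X -> R) : Prop :=
  forall x : X, \sum_(a : A) expR (phi (prepend a x)) = 1.

(* A finite measurable partition of X is encoded by the map xi sending a point
   to the label of its cell; cells may be empty. *)
Definition measurable_partition (m : nat) (xi : X -> 'I_m) : Prop :=
  forall j, measurable (xi @^-1` [set j]).

(* the cell labelled by w of the join of the theta^-i xi, for 0 <= i < n *)
Definition join_cell (m : nat) (xi : X -> 'I_m) (n : nat)
    (w : {ffun 'I_n -> 'I_m}) : set X :=
  [set x | forall i : 'I_n, xi (iter i left_shift x) = w i].

(* Shannon entropy of that join; the convention 0 log 0 = 0 holds as ln 0 = 0 *)
Definition join_entropy (eta : probability X R) (m : nat) (xi : X -> 'I_m)
    (n : nat) : R :=
  - \sum_(w : {ffun 'I_n -> 'I_m})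
      fine (eta (join_cell xi w)) * ln (fine (eta (join_cell xi w))).

(* Kolmogorov-Sinai entropy *)
Definition entropy (eta : probability X R) : \bar R :=
  ereal_sup [set h : \bar R | exists (m : nat) (xi : X -> 'I_m),
    measurable_partition xi /\
    h = limn (fun n => (n%:R^-1 * join_entropy eta xi n)%:E)].

Definition pressure (psi : X -> R) : \bar R :=
  ereal_sup [set (entropy eta + \int[eta]_x (psi x)%:E)%E
            | eta in invariant_measures].

Definition equilibrium_state (psi : X -> R) (mu : probability X R) : Prop :=
  invariant_measures mu /\
  (entropy mu + \int[mu]_x (psi x)%:E = pressure psi)%E.

Definition max_integral (phi : X -> R) : \bar R :=
  ereal_sup [set (\int[eta]_x (phi x)%:E)%E | eta in invariant_measures].

(* equal to +oo when the initial word of length n never reappears *)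
Definition return_time (n : nat) (x : X) : \bar R :=
  ereal_inf [set k%:R%:E | k in
    [set k : nat | (1 <= k)%N /\ forall i, (i < n)%N -> x (k + i)%N = x i]].

(* The power R_n(x)^q is written exp (q log R_n(x)) because the library's poweR
   sends +oo to +oo also for negative exponents. *)
Definition return_time_moment (mu : probability X R) (q : R) (n : nat) :
    \bar R :=
  (\int[mu]_x expeR (q%:E * lne (return_time n x)))%E.

Definition return_time_rate (mu : probability X R) (q : R) (n : nat) : \bar R :=
  ((n%:R^-1)%:E * lne (return_time_moment mu q n))%E.

Definition return_time_spectrum (mu : probability X R) (q : R) : \bar R :=
  limn (return_time_rate mu q).

End symbolic_dynamics.

Arguments invariant_measures {R A} hA.

(* Main.v *)
(* Write Z_n(t) for the sum of exp (t S_n phi) over the words of length n, M for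
   the maximal integral of phi and V for the sum of its variations. The variational
   principle is quantitative: ln Z_n(t) = n P(t phi) + O(|t| V). The upper bound
   is Gibbs' inequality against the law exp (t S_n phi) / Z_n(t) on words; the
   lower bound averages, over one period, the measure that makes the successive
   N-blocks independent with that law. Hence P(t phi) is Lipschitz and strictly
   decreasing, P(phi) = 0 > M >= P(2 phi), and q* is found in [-1, 0[.

   At t = 1 equality in the variational principle says that the law of mu on
   (n+1)-words is close, by Pinsker, to the law obtained from the n-words by
   weights exp phi. This gives the Gibbs property of mu and makes it
   quasi-Bernoulli. On a cylinder [w] the return time then has an exponential
   tail at scale n / mu[w], so that the typical part of the moment is comparable
   to the sum of mu[w]^(1-q), up to powers of n, i.e. to exp (n P((1-q) phi)).
   For q < 0 the points returning at a fixed time j add a contribution of order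
   exp (n M): they shadow periodic orbits, and those nearly maximizing the
   Birkhoff average of phi attain it. *)
From HB Require Import structures.
Require Import Defs.
From mathcomp Require Import all_boot all_order all_algebra.
From mathcomp Require Import all_classical all_reals all_analysis.
From mathcomp Require Import measurable_realfun ring lra.
Set Implicit Arguments.
Unset Strict Implicit.
Unset Printing Implicit Defensive.
Import Order.TTheory GRing.Theory Num.Theory.
Import numFieldNormedType.Exports.
Local Open Scope classical_set_scope.
Local Open Scope ring_scope.

(** * Sets determined by finitely many coordinates *)

Section finitary_sets.
Context (R : realType) (A : finType) (hA : (1 < #|A|)%N).
Local Notation X := (full_shift hA).

(** The distortion bound V enters every comparison between words, points and measures as a factor
    exp (O(V)), which disappears from the rates after division by n. Entropy is a supremum over all
    measurable partitions: its upper bound needs the approximation of a partition by one that reads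
    finitely many letters, whereas its lower bound uses the partition by the first letter alone.

    The value -1 matters twice. In the pressure, exp (2 S_n phi) is exp (S_n phi) times a factor of
    rate at most M, whence P(2 phi) <= M. In the moment, the event of being in [w] and returning at
    a time j >= n has measure of order at most mu[w]^2, so the times between n and 1 / mu[w]
    contribute mu[w]^2 times the sum of j^q; this is at most mu[w]^(1-q), up to a constant and a
    logarithm, as long as q >= -1. For smaller q the early terms of that sum dominate, but the
    moment is monotone in q and its rate at -1 is already M, which periodic orbits show to be a
    lower bound. *)

Definition agree (n : nat) (x y : X) : Prop :=
  forall i, (i < n)%N -> x i = y i.

Lemma agree_sym n x y : agree n x y -> agree n y x.
Proof. by move=> xy i /xy. Qed.

Lemma agree_trans n y x z : agree n x y -> agree n y z -> agree n x z.
Proof. by move=> xy yz i lin; rewrite xy ?yz. Qed.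

Lemma agree_le m n x y : (m <= n)%N -> agree n x y -> agree m x y.
Proof. by move=> mn xy i im; apply: xy; apply: leq_trans mn. Qed.

Definition finitary (n : nat) (B : set X) : Prop :=
  forall x y, agree n x y -> B x -> B y.

Lemma finitary_le m n B : (m <= n)%N -> finitary m B -> finitary n B.
Proof. by move=> mn fB x y /(agree_le mn); apply: fB. Qed.

Lemma finitaryI n B C : finitary n B -> finitary n C -> finitary n (B `&` C).
Proof.
by move=> fB fC x y xy [Bx Cx]; split; [apply: fB xy Bx|apply: fC xy Cx].
Qed.

Lemma finitaryU n B C : finitary n B -> finitary n C -> finitary n (B `|` C).
Proof.
by move=> fB fC x y xy [Bx|Cx]; [left; apply: fB xy Bx|right; apply: fC xy Cx].
Qed.

Lemma finitaryC n B : finitary n B -> finitary n (~` B).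
Proof. by move=> fB x y /agree_sym xy nBx By; apply: nBx; apply: fB xy By. Qed.

Lemma nbhs_agree n (x : X) : nbhs x [set y | agree n x y].
Proof.
elim: n => [|n IH]; first exact: filterS filterT.
pose p : X -> discrete_topology A := fun y => y n.
have cp : continuous p.
  exact: (@proj_continuous _ (fun _ : nat => discrete_topology A) n).
have nb : nbhs x (p @^-1` [set x n]) := cp x [set x n] (discrete_set1 (x n)).
apply: filterS (filterI IH nb) => y [xy yn] i.
by rewrite ltnS leq_eqVlt => /orP[/eqP ->|/xy//]; exact/esym.
Qed.

(** Otherwise points outside [U] could be chosen that share longer and longer prefixes with [x];
    they converge to [x] coordinatewise, a contradiction. *)
Lemma nbhs_agreeP (x : X) U : nbhs x U -> exists n, [set y | agree n x y] `<=` U.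
Proof.
move=> nU; apply: contrapT => /forallNP nn.
have ex n : exists y : X, agree n x y /\ ~ U y.
  have /existsNP[y /not_implyP[xy nUy]] := nn n; by exists y.
have [g gP] := choice ex.
have gx : g @ \oo --> x.
  apply/cvg_sup => N W [V] [[Q] oQ <-] QxN QW.
  apply: (filterS QW); rewrite nbhs_simpl /=; exists N.+1 => // i /= Ni.
  by rewrite -(proj1 (gP i)).
have [N _ /(_ N (leqnn N)) UN] := gx _ nU.
exact: (proj2 (gP N)).
Qed.

Lemma finitary_open n B : finitary n B -> open B.
Proof.
move=> fB; rewrite openE => x Bx; apply: filterS (nbhs_agree n x) => y xy.
exact: fB xy Bx.
Qed.

Lemma open_measurable_shift (B : set X) : open B -> measurable B.
Proof. exact: sub_sigma_algebra. Qed.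

Lemma finitary_measurable n B : finitary n B -> measurable B.
Proof. by move=> fB; apply: open_measurable_shift; apply: finitary_open fB. Qed.

Definition finitary_sets : set (set X) := [set B | exists n, finitary n B].

Lemma open_bigcup_finitary (U : set X) : open U ->
  exists F : nat -> set X, (forall n, finitary n (F n)) /\ U = \bigcup_n F n.
Proof.
move=> oU; exists (fun n => [set x | [set y | agree n x y] `<=` U]); split.
  by move=> n x y xy xU z yz; apply: xU; apply: agree_trans yz.
apply/seteqP; split => x.
  move=> Ux; have [n nU] := nbhs_agreeP (open_nbhs_nbhs (conj oU Ux)).
  by exists n.
by move=> [n _]; apply.
Qed.

(** Open sets are countable unions of finitary ones. The gain is a generating family, closed under
    intersection, on which measures are finite sums over words. *)
Lemma measurable_finitaryE : (@measurable _ X) = <<s finitary_sets >>.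
Proof.
apply/seteqP; split.
  apply: smallest_sub; first exact: smallest_sigma_algebra.
  move=> U /open_bigcup_finitary[F [fF ->]].
  apply: sigma_algebra_bigcup => n; apply: sub_sigma_algebra.
  by exists n.
apply: smallest_sub; first exact: sigma_algebra_measurable.
by move=> B [n] /finitary_measurable.
Qed.

Lemma finitary_setsI : setI_closed finitary_sets.
Proof.
move=> B C [m fB] [n fC]; exists (maxn m n); apply: finitaryI.
  exact: finitary_le (leq_maxl _ _) fB.
exact: finitary_le (leq_maxr _ _) fC.
Qed.

Lemma eq_probability (m1 m2 : probability X R) :
  (forall B, finitary_sets B -> m1 B = m2 B) ->
  forall B, measurable B -> m1 B = m2 B.
Proof.
move=> m12.
apply: (@measure_unique _ _ _ finitary_sets (fun=> setT)) => //.
- exact: measurable_finitaryE.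
- exact: finitary_setsI.
- by move=> _; exists 0%N.
- exact: bigcup_const.
- by move=> _; rewrite [X in (X < _)%E](_ : _ = 1%E) ?ltry//; exact: probability_setT.
Qed.

End finitary_sets.

(** * Shannon entropy *)

Section finite_random_variables.
Context (R : realType) (d : measure_display) (X : measurableType d).
Implicit Type P : probability X R.

Definition pr P (B : set X) : R := fine (P B).

Lemma prE P B : measurable B -> P B = (pr P B)%:E.
Proof. by move=> mB; rewrite /pr fineK// fin_num_measure. Qed.

Lemma pr_ge0 P B : 0 <= pr P B.
Proof. exact: fine_ge0. Qed.

Lemma pr_setT P : pr P setT = 1.
Proof. by rewrite /pr probability_setT. Qed.

Lemma pr_set0 P : pr P set0 = 0.
Proof. by rewrite /pr measure0. Qed.

Lemma pr_mono P B C : measurable B -> measurable C -> B `<=` C -> pr P B <= pr P C.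
Proof.
move=> mB mC BC; rewrite -lee_fin -!prE//.
by apply: le_measure => //; rewrite inE.
Qed.

Lemma pr_le1 P B : measurable B -> pr P B <= 1.
Proof. by move=> mB; rewrite -(pr_setT P); apply: pr_mono. Qed.

Lemma prU P B C : measurable B -> measurable C -> B `&` C = set0 ->
  pr P (B `|` C) = pr P B + pr P C.
Proof.
move=> mB mC BC; apply/EFin_inj; rewrite EFinD -!prE//; last exact: measurableU.
by rewrite measureU.
Qed.

Lemma prU_le P B C : measurable B -> measurable C ->
  pr P (B `|` C) <= pr P B + pr P C.
Proof.
move=> mB mC;
have mCB : measurable (C `\` B) by exact: measurableD.
rewrite (_ : B `|` C = B `|` (C `\` B)).
  rewrite prU//; first by rewrite lerD2l; apply: pr_mono => // x [].
  by apply/seteqP; split => // x [] Bx [].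
apply/seteqP; split => x.
  by case=> [Bx|Cx]; [left|case: (pselect (B x)) => Bx; [left|right]].
by case=> [Bx|[Cx _]]; [left|right].
Qed.

Lemma pr_bigU_le P (I : Type) (r : seq I) (F : I -> set X) :
  (forall i, measurable (F i)) ->
  pr P (\big[setU/set0]_(i <- r) F i) <= \sum_(i <- r) pr P (F i).
Proof.
move=> mF; elim: r => [|i r IH]; first by rewrite !big_nil pr_set0.
rewrite !big_cons; apply: le_trans (_ : _ <= _ + _) _.
  by apply: prU_le => //; apply: bigsetU_measurable.
by rewrite lerD2l.
Qed.

Definition rv (T : finType) (f : X -> T) : Prop :=
  forall t, measurable (f @^-1` [set t]).

Definition law P (T : finType) (f : X -> T) (t : T) : R :=
  pr P (f @^-1` [set t]).

Lemma pr_partition P (T : finType) (f : X -> T) B : rv f -> measurable B ->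
  pr P B = \sum_t pr P (B `&` f @^-1` [set t]).
Proof.
move=> rf mB; rewrite (reindex (fun i : 'I_#|T| => enum_val i))/=; last first.
  exact: onW_bij (enum_val_bij _).
have mF (i : 'I_#|T|) : measurable (B `&` f @^-1` [set enum_val i]).
  exact: measurableI.
apply/EFin_inj; rewrite -sumEFin -prE//.
rewrite (eq_bigr (fun i : 'I_#|T| => P (B `&` f @^-1` [set enum_val i]))).
  rewrite -(@measure_bigsetU_ord _ _ _ P #|T| predT
    (fun i : 'I_#|T| => B `&` f @^-1` [set enum_val i]))//.
    congr (P _); rewrite -bigcup_seq.
    apply/seteqP; split => x.
      move=> Bx; exists (enum_rank (f x)); first by rewrite /= mem_index_enum.
      by split => //=; rewrite enum_rankK.
    by move=> [i _ []].
  move=> i j _ _ [x [[_ /= fi] [_ /= fj]]].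
  by apply: enum_val_inj; rewrite -fi -fj.
by move=> i _; rewrite -prE.
Qed.

Lemma rv_preimage (T : finType) (f : X -> T) (Q : pred T) : rv f ->
  measurable [set x | Q (f x)].
Proof.
move=> rf; rewrite (_ : [set x | _] =
    \big[setU/set0]_(t <- enum T | Q t) (f @^-1` [set t])).
  by apply: bigsetU_measurable => t _; exact: rf.
rewrite -bigcup_seq_cond; apply/seteqP; split => x.
  by move=> /= Qfx; exists (f x) => //=; rewrite mem_enum.
by move=> [t /= /andP[_ Qt]] ->.
Qed.

Lemma pr_comp P (T : finType) (f : X -> T) (Q : pred T) : rv f ->
  pr P [set x | Q (f x)] = \sum_(t | Q t) law P f t.
Proof.
move=> rf; rewrite (pr_partition _ rf (rv_preimage Q rf)) [RHS]big_mkcond/=.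
apply: eq_bigr => t _; case: ifPn => Qt.
  congr (pr P _); apply/seteqP; split => x /=; first by case.
  by move=> ftx; split => //; rewrite ftx.
rewrite (_ : _ `&` _ = set0) ?pr_set0//; apply/seteqP; split => x //=.
by move=> [Qf ft]; rewrite -ft Qf in Qt.
Qed.

Lemma sum_law P (T : finType) (f : X -> T) : rv f -> \sum_t law P f t = 1.
Proof.
move=> rf; rewrite -(pr_comp _ predT rf) -(pr_setT P); congr (pr P _).
exact/seteqP.
Qed.

Lemma law_ge0 P (T : finType) (f : X -> T) t : 0 <= law P f t.
Proof. exact: pr_ge0. Qed.

Lemma rv_pair (T U : finType) (f : X -> T) (g : X -> U) :
  rv f -> rv g -> rv (fun x => (f x, g x)).
Proof.
move=> rf rg [t u]; rewrite (_ : _ @^-1` _ = f @^-1` [set t] `&` g @^-1` [set u]).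
  exact: measurableI.
by apply/seteqP; split => x /=; [case=> -> ->|case=> -> ->].
Qed.

Lemma law_comp P (T U : finType) (f : X -> T) (g : T -> U) u : rv f ->
  law P (g \o f) u = \sum_(t | g t == u) law P f t.
Proof.
move=> rf; rewrite -(pr_comp _ (fun t => g t == u) rf); congr (pr P _).
by apply/seteqP; split => x /= /eqP.
Qed.

Lemma sum_law_comp P (T U : finType) (f : X -> T) (g : T -> U) (F : U -> R) :
  rv f -> \sum_u law P (g \o f) u * F u = \sum_t law P f t * F (g t).
Proof.
move=> rf; under eq_bigr do rewrite (law_comp _ _ _ rf) big_distrl/=.
rewrite (exchange_big_dep predT)//=; apply: eq_bigr => t _.
by rewrite (big_pred1 (g t))// => u; rewrite eq_sym.
Qed.

(** Termwise from ln s <= s - 1 at s = q t / p t. As [ln 0] is 0, the last hypothesis is what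
    controls the terms with q t = 0. The total masses may differ from 1. *)
Lemma gibbs_inequality (T : finType) (p q : T -> R) :
  (forall t, 0 <= p t) -> (forall t, 0 <= q t) ->
  (forall t, 0 < p t -> 0 < q t) ->
  \sum_t p t * (ln (q t) - ln (p t)) <= \sum_t q t - \sum_t p t.
Proof.
move=> p0 q0 pq; rewrite -sumrB; apply: ler_sum => t _.
have [pt|] := ltP 0 (p t); last first.
  by move=> ple; have -> : p t = 0 by [apply/eqP; rewrite eq_le ple p0]; rewrite mul0r subr0.
have qt := pq _ pt.
rewrite -ln_div ?posrE//.
have -> : q t - p t = p t * (q t / p t - 1) by field; rewrite gt_eqF.
rewrite ler_pM2l//.
have := @le_ln1Dx R (q t / p t - 1).
rewrite [1 + _]addrC subrK; apply.
by rewrite ltrBrDl subrr divr_gt0.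
Qed.

Definition shannon P (T : finType) (f : X -> T) : R :=
  - \sum_t law P f t * ln (law P f t).

Lemma shannonE P (T : finType) (f : X -> T) :
  shannon P f = \sum_t law P f t * - ln (law P f t).
Proof. by rewrite /shannon -sumrN; apply: eq_bigr => t _; rewrite mulrN. Qed.

Lemma law_le1 P (T : finType) (f : X -> T) t : rv f -> law P f t <= 1.
Proof. by move=> rf; apply: pr_le1. Qed.

Lemma shannon_ge0 P (T : finType) (f : X -> T) : rv f -> 0 <= shannon P f.
Proof.
move=> rf; rewrite shannonE; apply: sumr_ge0 => t _.
by rewrite mulr_ge0 ?law_ge0// oppr_ge0 ln_le0// law_le1.
Qed.

Lemma shannon_le_cross P (T : finType) (f : X -> T) (q : T -> R) : rv f ->
  (forall t, 0 < q t) -> \sum_t q t <= 1 ->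
  shannon P f <= \sum_t law P f t * - ln (q t).
Proof.
move=> rf q0 q1.
have := @gibbs_inequality _ (law P f) q (law_ge0 _ _) (fun t => ltW (q0 t)) (fun t _ => q0 t).
rewrite sum_law// => /le_trans/(_ (_ : _ <= 0)); rewrite subr_le0 => /(_ q1).
move=> H; rewrite shannonE -subr_ge0 -sumrB -oppr_le0 -sumrN; apply: le_trans H.
by apply: ler_sum => t _; rewrite le_eqVlt; apply/orP; left; apply/eqP; ring.
Qed.

(** Both entropies are means over the joint law; where that law is positive at (t, u), the event g =
    u is contained in f = t, so its probability is smaller. *)
Lemma shannon_determined P (T U : finType) (f : X -> T) (g : X -> U) :
  rv f -> rv g -> (forall x y, g x = g y -> f x = f y) ->
  shannon P f <= shannon P g.
Proof.
move=> rf rg fg; rewrite !shannonE.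
have rp := rv_pair rf rg.
have -> : \sum_t law P f t * - ln (law P f t) =
    \sum_tu law P (fun x => (f x, g x)) tu * - ln (law P f tu.1).
  exact: (sum_law_comp P fst (fun t => - ln (law P f t)) rp).
have -> : \sum_t law P g t * - ln (law P g t) =
    \sum_tu law P (fun x => (f x, g x)) tu * - ln (law P g tu.2).
  exact: (sum_law_comp P snd (fun t => - ln (law P g t)) rp).
apply: ler_sum => -[t u] _ /=.
have [p0|] := ltP 0 (law P (fun x => (f x, g x)) (t, u)); last first.
  move=> ple; have -> : law P (fun x => (f x, g x)) (t, u) = 0.
    by apply/eqP; rewrite eq_le ple law_ge0.
  by rewrite !mul0r.
rewrite ler_pM2l// lerN2.
have ug : law P g u <= law P f t.
  apply: pr_mono => // x /= gx.
  case: (pselect (exists y, (f y, g y) = (t, u))) => [[y [<- gy]]|N].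
    by apply: fg; rewrite gx gy.
  move: p0; rewrite /law (_ : _ @^-1` _ = set0) ?pr_set0 ?ltxx//.
  by apply/seteqP; split => // y /= fy; case: N; exists y.
have u0 : 0 < law P g u.
  apply: lt_le_trans p0 _; apply: pr_mono => // x /= [_ ->] //.
by rewrite ler_ln ?posrE// (lt_le_trans u0).
Qed.

(** The conditional mutual information of [f] and [h] given [g] is nonnegative: Gibbs' inequality
    against [q], the law that makes [f] and [h] independent given [g]. *)
Lemma shannon_submodular P (T U W : finType)
    (f : X -> T) (g : X -> U) (h : X -> W) : rv f -> rv g -> rv h ->
  shannon P (fun x => (f x, g x, h x)) + shannon P g <=
  shannon P (fun x => (f x, g x)) + shannon P (fun x => (g x, h x)).
Proof.
move=> rf rg rh.
have rfg := rv_pair rf rg; have rgh := rv_pair rg rh; have r3 := rv_pair rfg rh.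
pose tri x := (f x, g x, h x); rewrite -/tri.
pose p3 := law P tri.
pose pfg := law P (fun x => (f x, g x)); pose pgh := law P (fun x => (g x, h x)).
pose pg := law P g.
have Eg : shannon P g = \sum_t p3 t * - ln (pg t.1.2).
  by rewrite shannonE; exact: (sum_law_comp P (fun t => t.1.2) (fun t => - ln (law P g t)) r3).
have Efg : shannon P (fun x => (f x, g x)) = \sum_t p3 t * - ln (pfg t.1).
  by rewrite shannonE; exact: (sum_law_comp P fst (fun t => - ln (pfg t)) r3).
have Egh : shannon P (fun x => (g x, h x)) = \sum_t p3 t * - ln (pgh (t.1.2, t.2)).
  by rewrite shannonE; exact: (sum_law_comp P (fun t : T * U * W => (t.1.2, t.2)) (fun t => - ln (pgh t)) r3).
pose q (t : T * U * W) := pfg t.1 * pgh (t.1.2, t.2) / pg t.1.2.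
have p3fg t : p3 t <= pfg t.1.
  by apply: pr_mono => // x; case: t => -[a b] c /= [-> -> _].
have p3gh t : p3 t <= pgh (t.1.2, t.2).
  by apply: pr_mono => // x; case: t => -[a b] c /= [_ -> ->].
have p3g t : p3 t <= pg t.1.2.
  by apply: pr_mono => // x; case: t => -[a b] c /= [_ -> _].
have q0 t : 0 <= q t by rewrite /q divr_ge0 ?mulr_ge0 ?law_ge0.
have pq t : 0 < p3 t -> 0 < q t.
  move=> p0; rewrite /q divr_gt0 ?mulr_gt0//; apply: lt_le_trans p0 _;
  [exact: p3fg|exact: p3gh|exact: p3g].
have := gibbs_inequality (fun t => law_ge0 P tri t) q0 pq.
rewrite sum_law//.
have sq : \sum_t q t <= 1.
  have gE u : \sum_w pgh (u, w) = pg u.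
    rewrite /pg /law (pr_partition P rh (rg u)); apply: eq_bigr => w _.
    by congr (pr P _); apply/seteqP; split => x /= [-> ->].
  rewrite /q -(pair_bigA _ (fun (tu : T * U) w => pfg tu * pgh (tu.2, w) / pg tu.2))/=.
  rewrite -(sum_law P rfg); apply: ler_sum => -[t u] _ /=.
  under eq_bigr do rewrite mulrAC.
  rewrite -big_distrr/= gE -mulrA.
  have [->|u0] := eqVneq (pg u) 0; first by rewrite mulr0 mulr0 law_ge0.
  by rewrite mulVf// mulr1.
move=> H; have {}H := le_trans H (_ : _ <= 0); rewrite subr_le0 in H; have {}H := H sq.
rewrite Eg Efg Egh shannonE -!big_split/= -subr_ge0 -sumrB -oppr_le0 -sumrN.
apply: le_trans H; apply: ler_sum => t _; rewrite -/(p3 t).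
have [p0|] := ltP 0 (p3 t); last first.
  by move=> ple; have -> : p3 t = 0 by [apply/eqP; rewrite eq_le ple law_ge0]; rewrite !mul0r; lra.
rewrite /q ln_div ?lnM ?posrE ?mulr_gt0//; first last.
- exact: lt_le_trans p0 (p3g t).
- exact: lt_le_trans p0 (p3gh t).
- exact: lt_le_trans p0 (p3fg t).
- exact: lt_le_trans p0 (p3gh t).
- exact: lt_le_trans p0 (p3fg t).
by rewrite le_eqVlt; apply/orP; left; apply/eqP; ring.
Qed.

End finite_random_variables.

(** * Entropy of words under an invariant measure *)

Section shift_entropy.
Context (R : realType) (A : finType) (hA : (1 < #|A|)%N).
Local Notation X := (full_shift hA).
Implicit Types (eta : probability X R) (x y : X) (n m k : nat).

Lemma iter_shiftE k x i : iter k (@left_shift A hA) x i = x (k + i)%N.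
Proof.
by elim: k x i => [|k IH] x i //; rewrite iterS /left_shift IH addnS addSn.
Qed.

Definition word n x : n.-tuple A := [tuple x (i : nat) | i < n].

Lemma tnth_word n x (i : 'I_n) : tnth (word n x) i = x i.
Proof. by rewrite tnth_mktuple. Qed.

Lemma eq_word n x y : word n x = word n y <-> agree n x y.
Proof.
split=> [E i lin|xy].
  by rewrite -(tnth_word x (Ordinal lin)) E tnth_word.
by apply: eq_from_tnth => i; rewrite !tnth_word xy.
Qed.

Definition fin_rv (T : finType) n (f : X -> T) : Prop :=
  forall x y, agree n x y -> f x = f y.

Lemma fin_rv_rv (T : finType) n (f : X -> T) : fin_rv n f -> rv f.
Proof.
move=> ff t; apply: (@finitary_measurable _ _ n) => x y /ff.
by move=> /= ->.
Qed.

Lemma fin_rv_word n : fin_rv n (word n).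
Proof. by move=> x y /eq_word. Qed.

Lemma rv_word n : rv (word n).
Proof. exact: fin_rv_rv (@fin_rv_word n). Qed.

Lemma agree_shift n k x y : agree (k + n) x y ->
  agree n (iter k (@left_shift A hA) x) (iter k (@left_shift A hA) y).
Proof. by move=> xy i ilt; rewrite !iter_shiftE xy// ltn_add2l. Qed.

Lemma measurable_shift : measurable_fun setT (@left_shift A hA).
Proof.
apply: (measurability (@finitary_sets A hA)); first exact: measurable_finitaryE.
move=> _ [B [n fB] <-]; apply: (@finitary_measurable _ _ n.+1) => x y xy [_ Bx].
split => //; apply: fB Bx => i ilt; exact: xy.
Qed.

Lemma measurable_iter_shift k : measurable_fun setT (iter k (@left_shift A hA)).
Proof.
elim: k => [|k IH]; first exact: measurable_id.
exact: (measurableT_comp measurable_shift IH).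
Qed.

Lemma measurable_shift_preimage k (B : set X) : measurable B ->
  measurable (iter k (@left_shift A hA) @^-1` B).
Proof.
by move=> mB; rewrite -[X in measurable X]setTI; apply: measurable_iter_shift.
Qed.

Lemma pr_shift eta k (B : set X) : invariant_measures hA eta -> measurable B ->
  pr eta (iter k (@left_shift A hA) @^-1` B) = pr eta B.
Proof.
move=> inv mB; elim: k => // k IH.
rewrite -{}IH /pr -[in RHS]inv; last exact: measurable_shift_preimage.
by congr (fine (eta _)); apply/seteqP; split => x /=; rewrite -iterSr.
Qed.

Lemma rv_shift (T : finType) k (f : X -> T) :
  rv f -> rv (f \o iter k (@left_shift A hA)).
Proof. by move=> rf t; apply: (measurable_shift_preimage k (rf t)). Qed.

Lemma law_shift eta (T : finType) k (f : X -> T) t :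
  invariant_measures hA eta -> rv f ->
  law eta (f \o iter k (@left_shift A hA)) t = law eta f t.
Proof. by move=> inv rf; apply: (pr_shift k inv (rf t)). Qed.

Lemma shannon_shift eta (T : finType) k (f : X -> T) :
  invariant_measures hA eta -> rv f ->
  shannon eta (f \o iter k (@left_shift A hA)) = shannon eta f.
Proof.
move=> inv rf; rewrite /shannon; congr (- _).
by apply: eq_bigr => t _; rewrite law_shift.
Qed.

Definition block_entropy eta n : R := shannon eta (word n).

Definition block_entropy_inc eta n : R :=
  block_entropy eta n.+1 - block_entropy eta n.

Lemma block_entropy0 eta : block_entropy eta 0 = 0.
Proof.
apply/eqP; rewrite eq_le; apply/andP; split; last exact: shannon_ge0 (@rv_word 0).
have H : \sum_(t : 0.-tuple A) (1 : R) <= 1 by rewrite sumr_const card_tuple expn0.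
have := @shannon_le_cross _ _ _ eta _ _ (fun=> 1) (@rv_word 0) (fun=> ltr01) H.
by rewrite big1 // => t _; rewrite ln1 oppr0 mulr0.
Qed.

(** Submodularity for the first letter, the n letters in the middle and the last letter; invariance
    identifies the entropies of shifted words with those of prefixes. *)
Lemma block_entropy_incS eta n : invariant_measures hA eta ->
  block_entropy_inc eta n.+1 <= block_entropy_inc eta n.
Proof.
move=> inv; rewrite /block_entropy_inc lerBlDr.
pose th := @left_shift A hA.
pose f (x : X) : A := x 0%N; pose h (x : X) : A := x n.+1.
pose g : X -> n.-tuple A := word n \o iter 1 th.
have rf : rv f by apply: (@fin_rv_rv _ 1) => x y; apply.
have rh : rv h by apply: (@fin_rv_rv _ n.+2) => x y; apply.
have rg : rv g by apply: rv_shift; exact: rv_word.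
have := shannon_submodular eta rf rg rh.
have -> : shannon eta g = block_entropy eta n.
  by apply: shannon_shift => //; exact: rv_word.
have gE x y : g x = g y -> forall i, (0 < i < n.+1)%N -> x i = y i.
  move=> /eq_word gxy [//|i] /= ilt; have := gxy i ilt.
  by rewrite !iter_shiftE.
have h1 : block_entropy eta n.+2 <= shannon eta (fun x => (f x, g x, h x)).
  apply: shannon_determined; [exact: rv_word|exact: rv_pair (rv_pair rf rg) rh|].
  move=> x y [fxy gxy hxy]; apply/eq_word => -[_|i ilt]; first exact: fxy.
  have [->|Ni] := eqVneq i n; first exact: hxy.
  apply: gE; last by rewrite /= ltnS ltn_neqAle Ni.
  by apply/val_inj; rewrite /= gxy.
have h2 : shannon eta (fun x => (f x, g x)) <= block_entropy eta n.+1.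
  apply: shannon_determined; [exact: rv_pair rf rg|exact: rv_word|].
  move=> x y /eq_word xy; rewrite /f (xy 0%N)//; congr (_, _).
  by apply/eq_word; apply: (@agree_shift n 1).
have h3 : shannon eta (fun x => (g x, h x)) <= block_entropy eta n.+1.
  rewrite -[leRHS](@shannon_shift eta _ 1 (word n.+1))//; last exact: rv_word.
  apply: shannon_determined; [exact: rv_pair rg rh|apply: rv_shift; exact: rv_word|].
  move=> x y /eq_word xy; congr (_, _).
    by apply/eq_word => i ilt; apply: xy; apply: ltnW.
  by have := xy n (ltnSn n); rewrite !iter_shiftE.
lra.
Qed.

Lemma block_entropy_inc_le eta m n : invariant_measures hA eta -> (m <= n)%N ->
  block_entropy_inc eta n <= block_entropy_inc eta m.
Proof.
move=> inv /subnK <-; elim: (n - m)%N => // k IH.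
by apply: le_trans IH; rewrite addSn; apply: block_entropy_incS.
Qed.

Lemma block_entropy_inc_ge0 eta n : 0 <= block_entropy_inc eta n.
Proof.
rewrite subr_ge0; apply: shannon_determined; [exact: rv_word..|].
by move=> x y /eq_word xy; apply/eq_word; apply: agree_le xy.
Qed.

Lemma block_entropy_add_le eta m n : invariant_measures hA eta ->
  block_entropy eta (m + n) <= block_entropy eta m + n%:R * block_entropy_inc eta m.
Proof.
move=> inv; elim: n => [|n IH]; first by rewrite addn0 mul0r addr0.
have : block_entropy_inc eta (m + n) <= block_entropy_inc eta m.
  by apply: block_entropy_inc_le => //; exact: leq_addr.
rewrite {1}/block_entropy_inc addnS -[n.+1%:R]natr1; lra.
Qed.

Lemma block_entropy_inc_le_mean eta m n : invariant_measures hA eta ->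
  (m <= n)%N -> m%:R * block_entropy_inc eta n <= block_entropy eta m.
Proof.
move=> inv; elim: m => [|m IH] mn; first by rewrite mul0r block_entropy0.
have := IH (ltnW mn).
have : block_entropy_inc eta n <= block_entropy_inc eta m.
  by apply: block_entropy_inc_le => //; exact: ltnW.
rewrite {2}/block_entropy_inc -[m.+1%:R]natr1; lra.
Qed.

Lemma join_entropyE eta m (xi : X -> 'I_m) n : join_entropy eta xi n =
  shannon eta (fun x => [ffun i : 'I_n => xi (iter i (@left_shift A hA) x)]).
Proof.
rewrite /join_entropy /shannon; congr (- _); apply: eq_bigr => w _.
suff -> : @join_cell A hA m xi n w =
  (fun x => [ffun i : 'I_n => xi (iter i (@left_shift A hA) x)]) @^-1` [set w] by [].
apply/seteqP; split => x /=.
  by move=> xw; apply/ffunP => i; rewrite ffunE.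
by move=> <- i; rewrite ffunE.
Qed.

Lemma rv_itinerary m (xi : X -> 'I_m) n : measurable_partition xi ->
  rv (fun x => [ffun i : 'I_n => xi (iter i (@left_shift A hA) x)]).
Proof.
move=> mxi w; rewrite (_ : _ @^-1` _ =
    \bigcap_(i in setT) (iter (i : 'I_n) (@left_shift A hA) @^-1` (xi @^-1` [set w i]))).
  apply: fin_bigcap_measurable => // i _; exact: measurable_shift_preimage.
apply/seteqP; split => x /=.
  by move=> <- i _ /=; rewrite ffunE.
by move=> H; apply/ffunP => i; rewrite ffunE; apply: H.
Qed.

Definition coord_partition (x : X) : 'I_#|A| := enum_rank (x 0%N).

Lemma measurable_coord_partition : measurable_partition coord_partition.
Proof. by apply: (@fin_rv_rv _ 1) => x y xy; rewrite /coord_partition xy. Qed.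

Lemma join_entropy_coord eta n :
  join_entropy eta coord_partition n = block_entropy eta n.
Proof.
have r1 := @rv_itinerary _ coord_partition n measurable_coord_partition.
rewrite join_entropyE; apply/eqP; rewrite eq_le; apply/andP; split.
  apply: shannon_determined => //; first exact: rv_word.
  move=> x y /eq_word xy; apply/ffunP => i; rewrite !ffunE /coord_partition.
  by rewrite !iter_shiftE addn0 xy.
apply: shannon_determined => //; first exact: rv_word.
move=> x y /ffunP xy; apply/eq_word => i ilt.
have := xy (Ordinal ilt); rewrite !ffunE /coord_partition !iter_shiftE/= addn0.
exact: enum_rank_inj.
Qed.

End shift_entropy.

Lemma ln_prod (R : realType) (I : Type) (r : seq I) (F : I -> R) :
  (forall i, 0 < F i) -> ln (\prod_(i <- r) F i) = \sum_(i <- r) ln (F i).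
Proof.
move=> F0; elim: r => [|i r IH]; first by rewrite !big_nil ln1.
by rewrite !big_cons lnM ?posrE ?IH// prodr_gt0.
Qed.

(** * Kolmogorov-Sinai entropy *)

Section kolmogorov_sinai.
Context (R : realType) (A : finType) (hA : (1 < #|A|)%N).
Local Notation X := (full_shift hA).
Implicit Types (eta : probability X R) (x y : X) (n m k : nat).

Definition symdiff (B C : set X) := (B `\` C) `|` (C `\` B).

Definition approximable eta (B : set X) := forall e : R, 0 < e ->
  exists n C, finitary n C /\ pr eta (symdiff B C) < e.

Lemma measurable_symdiff B C : measurable B -> measurable C -> measurable (symdiff B C).
Proof. by move=> mB mC; apply: measurableU; apply: measurableD. Qed.

Lemma approximableU eta B B' : measurable B -> measurable B' ->
  approximable eta B -> approximable eta B' -> approximable eta (B `|` B').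
Proof.
move=> mB mB' aB aB' e e0.
have e2 : 0 < e / 2 by rewrite divr_gt0.
have [n [C [fC BC]]] := aB _ e2; have [n' [C' [fC' BC']]] := aB' _ e2.
exists (maxn n n'), (C `|` C'); split.
  by apply: finitaryU; [apply: finitary_le fC; exact: leq_maxl|apply: finitary_le fC'; exact: leq_maxr].
have mC := finitary_measurable fC; have mC' := finitary_measurable fC'.
apply: le_lt_trans (_ : pr eta (symdiff B C `|` symdiff B' C') < e).
  apply: pr_mono.
  - by apply: measurable_symdiff; apply: measurableU.
  - by apply: measurableU; apply: measurable_symdiff.
  - move=> x [[BB nCC]|[CC nBB]].
      case: BB => b; [left|right]; left; split => // c; apply: nCC; by [left|right].
    case: CC => b; [left|right]; right; split => // c; apply: nBB; by [left|right].
apply: le_lt_trans (prU_le _ _ _) _; [exact: measurable_symdiff..|].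
by rewrite [ltRHS]splitr ltrD.
Qed.

(** The approximable measurable sets form a sigma-algebra containing the finitary sets. For a
    countable union, a finite union [G N] already misses less than e / 2, and finite unions are
    approximable. *)
Lemma measurable_approximable eta B : measurable B -> approximable eta B.
Proof.
move=> mB; suff : [set B | measurable B /\ approximable eta B] B by case.
have fa : @finitary_sets A hA `<=` [set B | measurable B /\ approximable eta B].
  move=> C [n fC]; split; first exact: finitary_measurable fC.
  move=> e e0; exists n, C; split => //.
  by rewrite /symdiff setDv setU0 pr_set0.
have mB' : <<s @finitary_sets A hA >> B by rewrite -measurable_finitaryE.
apply: (smallest_sub _ fa mB'); split.
- by apply: fa; exists 0%N => x y _ [].
- move=> D [mD aD]; rewrite setTD; split; first exact: measurableC.
  move=> e /aD [n [C [fC DC]]]; exists n, (~` C); split; first exact: finitaryC.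
  rewrite (_ : symdiff _ _ = symdiff D C)//; apply/seteqP.
  by split => x [[a b]|[a b]]; [right|left|right|left]; split => //; apply: contrapT.
- move=> F FH.
  have mF i : measurable (F i) by case: (FH i).
  have mU : measurable (\bigcup_i F i) by exact: bigcup_measurable.
  split => // e e0.
  have e2 : 0 < e / 2 by rewrite divr_gt0.
  pose G n := \big[setU/set0]_(i < n) F i.
  have mG n : measurable (G n) by exact: bigsetU_measurable.
  have aG n : approximable eta (G n).
    elim: n => [|n IH].
      by rewrite /G big_ord0; apply: (fa set0 _).2; exists 0%N.
    rewrite /G big_ord_recr; apply: approximableU IH (FH n).2 => //; exact: mG.
  have GU : \bigcup_n G n = \bigcup_i F i.
    apply/seteqP; split => x [i _].
      by rewrite /G -bigcup_mkord => -[j _ Fjx]; exists j.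
    by move=> Fix; exists i.+1 => //; rewrite /G -bigcup_mkord; exists i => /=.
  have cG : (fun n => pr eta (G n)) @ \oo --> pr eta (\bigcup_i F i).
    apply: fine_cvg; rewrite -prE// -GU; apply: nondecreasing_cvg_mu => //.
      by rewrite GU.
    apply/nondecreasing_seqP => n; apply/subsetPset => x Gx.
    by rewrite /G big_ord_recr; left.
  have [N _ /(_ N (leqnn N)) /=] : \forall n \near \oo, `|pr eta (\bigcup_i F i) - pr eta (G n)| < e / 2.
    by move/cvgrPdist_lt : cG; apply.
  have GsubU : G N `<=` \bigcup_i F i by rewrite -GU => x; exists N.
  have -> : \bigcup_i F i = G N `|` (\bigcup_i F i `\` G N) by rewrite setDUK.
  rewrite prU//; [|exact: measurableD|by rewrite setDIK].
  rewrite addrC addKr ger0_norm ?pr_ge0// => UG.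
  have [n [C [fC GC]]] := aG N _ e2.
  have mC := finitary_measurable fC.
  exists n, C; split => //; rewrite setDUK//.
  apply: le_lt_trans (_ : pr eta ((\bigcup_i F i `\` G N) `|` symdiff (G N) C) < e).
    apply: pr_mono.
    - exact: measurable_symdiff.
    - by apply: measurableU; [exact: measurableD|exact: measurable_symdiff].
    - move=> x [[Ux nCx]|[Cx nUx]].
        by case: (pselect (G N x)) => Gx; [right; left|left].
      by right; right; split => // /GsubU.
  apply: le_lt_trans (prU_le _ _ _) _; [exact: measurableD|exact: measurable_symdiff|].
  by rewrite [ltRHS]splitr ltrD.
Qed.

(** The approximations [C j] of the cells may overlap or leave gaps. A point gets some label j with
    [C j x], or a default; a wrong label puts the point in one of the m symmetric differences, each
    of measure below e / m. *)
Lemma finitary_partition_approx eta m (xi : X -> 'I_m) (e : R) :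
  measurable_partition xi -> 0 < e ->
  exists n (xi' : X -> 'I_m), fin_rv n xi' /\
    pr eta [set x | xi' x != xi x] < e.
Proof.
move=> mxi e0.
have m0 : (0 < m)%N := leq_ltn_trans (leq0n _) (ltn_ord (xi point)).
have em : 0 < e / m%:R by rewrite divr_gt0// ltr0n.
have ex (j : 'I_m) := measurable_approximable eta (mxi j) em.
have [N NP] := choice ex; have [C CP] := choice NP.
pose n := \max_(j < m) N j.
have fC j : finitary n (C j).
  by apply: finitary_le (CP j).1; apply: (leq_bigmax (F := N)).
pose xi' x : 'I_m := odflt (Ordinal m0) [pick j | `[< C j x >]].
have fxi' : fin_rv n xi'.
  move=> x y xy; rewrite /xi'; congr (odflt _ _); apply: eq_pick => j.
  by apply/asboolP/asboolP; apply: fC => //; exact: agree_sym.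
exists n, xi'; split => //.
apply: le_lt_trans (_ : pr eta (\big[setU/set0]_(j <- enum 'I_m) symdiff (xi @^-1` [set j]) (C j)) < e).
  apply: pr_mono.
  - apply: (rv_preimage (f := fun x => (xi' x, xi x)) (fun t => t.1 != t.2)).
    by apply: rv_pair => //; exact: fin_rv_rv fxi'.
  - apply: bigsetU_measurable => j _; apply: measurable_symdiff => //.
    exact: finitary_measurable (fC j).
  - move=> x /=; rewrite -bigcup_seq /xi'; case: pickP => [j /asboolP Cjx /= jx|nC /= _].
      exists j; rewrite /= ?mem_enum//; right; split => //= xj.
      by rewrite xj eqxx in jx.
    exists (xi x); rewrite /= ?mem_enum//; left; split => // Cx.
    by have /asboolP := nC (xi x).
apply: le_lt_trans (pr_bigU_le _ _ _) _.
  move=> j; apply: measurable_symdiff => //; exact: finitary_measurable (fC j).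
rewrite big_enum/=; apply: lt_le_trans (_ : \sum_(j < m) e / m%:R <= e).
  apply: ltr_sum => //; last by move=> j _; exact: (CP j).2.
  by apply/hasP; exists (Ordinal m0) => //; rewrite mem_index_enum.
by rewrite sumr_const card_ord -[leLHS]mulr_natr divfK// gt_eqF// ltr0n.
Qed.

(** A point of the cylinder of [s], used to evaluate observables on words; the letter that pads it
    is arbitrary. *)
Definition ext (s : seq A) : X := fun i => nth (enum_val (Ordinal (ltnW hA))) s i.

Lemma agree_ext n x : agree n x (ext (word n x)).
Proof.
move=> i ilt; rewrite /ext -[i]/(val (Ordinal ilt)) -tnth_nth.
by rewrite tnth_word.
Qed.

(* The partition xi is replaced by a finitary xi' agreeing with it up to small
   measure; the cross entropy is taken against the law of the word followed by
   independent noise K, which costs at most e for each letter. *)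
Lemma join_entropy_le eta m (xi : X -> 'I_m) (e : R) :
  invariant_measures hA eta -> measurable_partition xi -> 0 < e ->
  exists k, forall n, join_entropy eta xi n <= block_entropy eta (n + k) + n%:R * e.
Proof.
move=> inv mxi e0.
(* The noise [K] keeps a label with probability 1 - dl, at cost at most e / 2, and gives any other
   label mass [dm], at cost - ln dm. Then [xi'] is taken so close to [xi] that wrong labels cost at
   most e / 2 on average. *)
have [dl [dl0 dl1 dle]] : exists dl : R, [/\ 0 < dl, dl < 1 & - ln (1 - dl) <= e / 2].
  exists (1 - expR (- (e / 2))); split.
  - by rewrite subr_gt0 -expR0 ltr_expR oppr_lt0 divr_gt0.
  - by rewrite ltrBlDr ltrDl expR_gt0.
  - by rewrite opprB addrC subrK expRK opprK.
pose dm := dl / m.+1%:R.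
have dm0 : 0 < dm by rewrite divr_gt0.
have dm1 : dm < 1 by rewrite ltr_pdivrMr// mul1r (lt_le_trans dl1)// ler1n.
have Ldm : 0 < - ln dm by rewrite oppr_gt0 ln_lt0// dm0.
have [k [xi' [fxi' xixi']]] :=
  finitary_partition_approx eta mxi (divr_gt0 (divr_gt0 e0 (ltr0Sn _ 1)) Ldm).
exists k => n.
have rxi' := fin_rv_rv fxi'.
pose K (j l : 'I_m) : R := if j == l then 1 - dl else dm.
have K0 j l : 0 < K j l by rewrite /K; case: ifP => // _; rewrite subr_gt0.
have K1 j : \sum_l K j l <= 1.
  rewrite (bigD1 j)//= {1}/K eqxx.
  apply: le_trans (_ : 1 - dl + \sum_(l < m | l != j) dm <= 1).
    rewrite lerD2l; apply: ler_sum => l lj; rewrite /K; case: ifP => // /eqP jl.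
    by rewrite jl eqxx in lj.
  apply: le_trans (_ : 1 - dl + \sum_(l < m) dm <= 1).
    by rewrite lerD2l [leRHS](bigD1 j)//= lerDr ltW.
  rewrite sumr_const card_ord -mulr_natr /dm mulrAC -addrA -lerBrDl subrr.
  rewrite addrC subr_le0 ler_pdivrMr// ler_pM2l// ler_nat //.
pose kap := \sum_(jl : 'I_m * 'I_m) law eta (fun x => (xi' x, xi x)) jl * - ln (K jl.1 jl.2).
have rp : rv (fun x => (xi' x, xi x)) by exact: rv_pair.
have kape : kap <= e.
  apply: le_trans (_ : \sum_(jl : 'I_m * 'I_m) law eta (fun x => (xi' x, xi x)) jl * (e / 2)
    + \sum_(jl : 'I_m * 'I_m | jl.1 != jl.2) law eta (fun x => (xi' x, xi x)) jl * - ln dm <= e).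
    rewrite [X in _ + X]big_mkcond -big_split /=; apply: ler_sum => -[j l] _ /=.
    rewrite /K; case: eqVneq => _ /=; first by rewrite addr0 ler_wpM2l ?law_ge0.
    by rewrite lerDr mulr_ge0 ?law_ge0// divr_ge0// ltW.
  rewrite -!big_distrl/= sum_law// mul1r.
  rewrite -(pr_comp _ (fun jl => jl.1 != jl.2) rp)/=.
  rewrite [leRHS]splitr lerD2l -ler_pdivlMr//; exact: ltW.
pose W x := [ffun i : 'I_n => xi (iter i (@left_shift A hA) x)].
pose V := word (n + k) : X -> _.
have rW : rv W by exact: rv_itinerary.
have rV : rv V by exact: rv_word.
have rWV := rv_pair rW rV.
pose p := law eta (fun x => (W x, V x)).
(* As [xi'] reads k letters, its first n labels can be read off the word of length n + k. *)
pose sl (v : (n + k).-tuple A) (i : 'I_n) := xi' (iter i (@left_shift A hA) (ext v)).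
have slE x i : sl (V x) i = xi' (iter i (@left_shift A hA) x).
  apply: fxi'; apply: agree_shift; apply: agree_sym.
  move=> j jlt; apply: (@agree_ext (n + k) x j).
  by apply: leq_trans jlt _; rewrite leq_add2r ltnW.
pose q (wv : {ffun 'I_n -> 'I_m} * (n + k).-tuple A) :=
  law eta V wv.2 * \prod_(i < n) K (sl wv.2 i) (wv.1 i).
have Pi0 w v : 0 < \prod_(i < n) K (sl v i) (w i) by apply: prodr_gt0.
have q0 t : 0 <= q t by rewrite mulr_ge0 ?law_ge0// ltW.
have pV t : p t <= law eta V t.2.
  by apply: pr_mono; [exact: rWV|exact: rV|move=> x /= <-].
have pq t : 0 < p t -> 0 < q t.
  by move=> p0; rewrite mulr_gt0// (lt_le_trans p0).
have q1 : \sum_t q t <= 1.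
  rewrite -(pair_bigA _ (fun w v => q (w, v)))/= exchange_big/=.
  rewrite -(sum_law eta rV); apply: ler_sum => v _; rewrite /q/= -big_distrr/=.
  rewrite -[leRHS]mulr1 ler_wpM2l ?law_ge0//.
  rewrite -(bigA_distr_bigA (fun i l => K (sl v i) l))/=.
  apply: numdomain.Num.Theory.prodr_ile1 => i _; apply/andP; split; last exact: K1.
  by apply: sumr_ge0 => l _; apply: ltW.
have := gibbs_inequality (fun t => law_ge0 eta _ t) q0 pq; rewrite -/p.
rewrite sum_law// => G; have {}G := le_trans G (_ : _ <= 0); rewrite subr_le0 in G.
have {}G := G q1.
rewrite join_entropyE; apply: le_trans (_ : shannon eta (fun x => (W x, V x)) <= _).
  by apply: shannon_determined => // x y [].
have -> : block_entropy eta (n + k) = \sum_t p t * - ln (law eta V t.2).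
  by rewrite /block_entropy shannonE; exact: (sum_law_comp eta snd (fun t => - ln (law eta V t)) rWV).
apply: le_trans (_ : \sum_t p t * - ln (law eta V t.2) + \sum_(i < n) kap <= _); last first.
  by rewrite lerD2l sumr_const card_ord -[leLHS]mulr_natl ler_wpM2l.
have -> : \sum_(i < n) kap = \sum_t p t * \sum_(i < n) - ln (K (sl t.2 i) (t.1 i)).
  under [RHS]eq_bigr do rewrite big_distrr/=.
  rewrite [RHS]exchange_big/=; apply: eq_bigr => i _.
  rewrite -(sum_law_comp eta (fun t : {ffun 'I_n -> 'I_m} * (n + k).-tuple A => (sl t.2 i, t.1 i)) (fun jl => - ln (K jl.1 jl.2)) rWV).
  rewrite /kap; apply: eq_bigr => jl _; congr (_ * _).
  rewrite -(law_shift i jl inv rp).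
  by congr (law eta _ _); apply/funext => x /=; rewrite slE ffunE.
rewrite -big_split/= shannonE -/p -subr_ge0 -sumrB -oppr_le0 -sumrN.
apply: le_trans G; apply: ler_sum => t _.
have [p0|] := ltP 0 (p t); last first.
  by move=> ple; have -> : p t = 0 by [apply/eqP; rewrite eq_le ple law_ge0]; rewrite !mul0r; lra.
rewrite /q lnM ?posrE//; last by rewrite (lt_le_trans p0).
rewrite ln_prod//; rewrite sumrN le_eqVlt; apply/orP; left; apply/eqP; ring.
Qed.

(** Up to e per letter, the entropy of any join is that of words, and beyond length m the latter
    grows by at most [block_entropy_inc eta m] per letter. *)
Lemma entropy_le_inc eta m : invariant_measures hA eta ->
  (entropy eta <= (block_entropy_inc eta m)%:E)%E.
Proof.
move=> inv; apply: ub_ereal_sup => _ [r [xi [mxi ->]]].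
set u := (fun n => _).
(* Without convergence [limn u] is the default value 0, and increments are nonnegative. *)
have [cu|ncu] := pselect (cvgn u); last first.
  rewrite (_ : limn u = 0%E) ?lee_fin ?block_entropy_inc_ge0//.
  rewrite /lim /lim_in xgetPN// => y /= uy; apply: ncu.
  by apply/cvg_ex; exists y.
apply/lee_addgt0Pr => e e0; have e2 : 0 < e / 2 by rewrite divr_gt0.
have [k kP] := join_entropy_le inv mxi e2.
rewrite -EFinD; apply: lime_le => //.
pose c := block_entropy eta m + k%:R * block_entropy_inc eta m.
have [N HN] : exists N : nat, c / (e / 2) <= N%:R.
  exists (Num.trunc (c / (e / 2))).+1; apply: ltW; exact: truncnS_gt.
exists (maxn 1 (maxn N m)) => // n /=; rewrite !geq_max => /and3P[n1 Nn mn].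
have n0 : (0 : R) < n%:R by rewrite ltr0n.
rewrite lee_fin mulrC ler_pdivrMr//; apply: le_trans (kP n) _.
have := block_entropy_add_le m (n + k - m) inv.
rewrite subnKC; last by rewrite (leq_trans mn)// leq_addr.
have inc0 := block_entropy_inc_ge0 eta m.
have : (n + k - m)%:R * block_entropy_inc eta m <= (n + k)%:R * block_entropy_inc eta m.
  by rewrite ler_wpM2r// ler_nat leq_subr.
have : c <= n%:R * (e / 2).
  rewrite -ler_pdivrMr//; apply: le_trans HN _; by rewrite ler_nat.
rewrite /c natrD; nra.
Qed.

End kolmogorov_sinai.

(** * Means of uniformly continuous observables *)

Section uniformly_continuous_observables.
Context (R : realType) (A : finType) (hA : (1 < #|A|)%N).
Local Notation X := (full_shift hA).
Implicit Types (eta nu : probability X R) (x y : X) (n m k : nat) (f g : X -> R).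

Definition osc_le n f (e : R) : Prop :=
  forall x y, agree n x y -> `|f x - f y| <= e.

Definition unif_cont f : Prop := forall e : R, 0 < e -> exists n, osc_le n f e.

Lemma unif_contD f g : unif_cont f -> unif_cont g -> unif_cont (fun x => f x + g x).
Proof.
move=> uf ug e e0; have e2 : 0 < e / 2 by rewrite divr_gt0.
have [m fm] := uf _ e2; have [n gn] := ug _ e2.
exists (maxn m n) => x y xy; rewrite opprD addrACA [e]splitr.
apply: le_trans (ler_normD _ _) _; apply: lerD.
  by apply: fm; apply: agree_le xy; exact: leq_maxl.
by apply: gn; apply: agree_le xy; exact: leq_maxr.
Qed.

Lemma unif_contZ c f : unif_cont f -> unif_cont (fun x => c * f x).
Proof.
move=> uf e e0; have c0 : 0 < `|c| + 1 by rewrite ltr_wpDl.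
have [m fm] := uf _ (divr_gt0 e0 c0).
exists m => x y xy; rewrite -mulrBr normrM.
have := fm _ _ xy; rewrite ler_pdivlMr// => H; apply: le_trans H.
by rewrite mulrC ler_wpM2l// lerDl.
Qed.

Lemma unif_cont_cst c : unif_cont (fun _ : X => c).
Proof. by move=> e e0; exists 0%N => x y _; rewrite subrr normr0 ltW. Qed.

Lemma unif_cont_sum (I : Type) (r : seq I) (F : I -> X -> R) :
  (forall i, unif_cont (F i)) -> unif_cont (fun x => \sum_(i <- r) F i x).
Proof.
move=> uF; elim: r => [|i r IH].
  rewrite (_ : (fun x => _) = fun=> 0); first exact: unif_cont_cst.
  by apply/funext => x; rewrite big_nil.
rewrite (_ : (fun x => _) = fun x => F i x + \sum_(i <- r) F i x).
  exact: unif_contD.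
by apply/funext => x; rewrite big_cons.
Qed.

Lemma unif_cont_shift k f : unif_cont f ->
  unif_cont (fun x => f (iter k (@left_shift A hA) x)).
Proof.
by move=> uf e /uf[n fn]; exists (k + n)%N => x y xy; apply: fn; apply: agree_shift.
Qed.

Lemma unif_cont_fin_rv (T : finType) n (g : X -> T) (c : T -> R) :
  fin_rv n g -> unif_cont (c \o g).
Proof.
by move=> gn e e0; exists n => x y /gn /= ->; rewrite subrr normr0 ltW.
Qed.

Lemma open_agree (B : set X) :
  (forall x, B x -> exists n, forall y, agree n x y -> B y) -> open B.
Proof.
move=> oB; rewrite openE => x /oB [n nB].
by apply: filterS (nbhs_agree n x) => y; apply: nB.
Qed.

Lemma unif_cont_measurable f : unif_cont f -> measurable_fun setT f.
Proof.
move=> uf.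
apply: (measurability _ (measurable_realfun.RGenInftyO.measurableE R)).
move=> _ [B [r ->] <-]; rewrite setTI; apply: open_measurable_shift.
apply: open_agree => x /=; rewrite in_itv/= => fxr.
have d0 : 0 < (r - f x) / 2 by rewrite divr_gt0// subr_gt0.
have [n fn] := uf _ d0.
exists n => y xy /=; rewrite in_itv/=.
by have := fn _ _ xy; rewrite ler_norml => /andP[+ _]; lra.
Qed.

Lemma unif_cont_bounded f : unif_cont f -> exists B : R, forall x, `|f x| <= B.
Proof.
move=> uf; have [n fn] := uf 1 ltr01.
exists (\sum_(w : n.-tuple A) `|f (ext hA w)| + 1) => x.
have := fn _ _ (@agree_ext _ _ n x) => H.
rewrite (bigD1 (word n x))//=.
have : 0 <= \sum_(i | i != word n x) `|f (ext hA i)| by apply: sumr_ge0.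
have := ler_normB (f x) (f (ext hA (word n x))).
have : `|f x| <= `|f x - f (ext hA (word n x))| + `|f (ext hA (word n x))|.
  by rewrite -{1}[f x](subrK (f (ext hA (word n x)))) ler_normD.
lra.
Qed.

Lemma unif_cont_integrable eta f : unif_cont f -> eta.-integrable setT (EFin \o f).
Proof.
move=> uf; apply: measurable_bounded_integrable => //.
- by rewrite [X in (X < _)%E](_ : _ = 1%E) ?ltry//; exact: probability_setT.
- exact: unif_cont_measurable.
- have [B fB] := unif_cont_bounded uf.
  exists B; split; first exact: num_real.
  by move=> M BM x _ /=; apply: le_trans (fB x) (ltW BM).
Qed.

Definition mean eta f : R := \int[eta]_x f x.

Lemma integral_mean eta f : unif_cont f -> (\int[eta]_x (f x)%:E)%E = (mean eta f)%:E.
Proof.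
move=> uf; rewrite /mean /Rintegral fineK//.
exact: (integrable_fin_num measurableT (unif_cont_integrable eta uf)).
Qed.

Lemma mean_le eta f g : unif_cont f -> unif_cont g -> (forall x, f x <= g x) ->
  mean eta f <= mean eta g.
Proof.
by move=> uf ug fg; apply: le_Rintegral => //; exact: unif_cont_integrable.
Qed.

Lemma meanD eta f g : unif_cont f -> unif_cont g ->
  mean eta (fun x => f x + g x) = mean eta f + mean eta g.
Proof. by move=> uf ug; apply: RintegralD => //; exact: unif_cont_integrable. Qed.

Lemma meanZ eta c f : unif_cont f -> mean eta (fun x => c * f x) = c * mean eta f.
Proof. by move=> uf; apply: RintegralZl => //; exact: unif_cont_integrable. Qed.

Lemma mean_cst eta c : mean eta (fun=> c) = c.
Proof. by rewrite /mean Rintegral_cst// -/(pr eta setT) pr_setT mulr1. Qed.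

Lemma mean_sum eta (I : Type) (r : seq I) (F : I -> X -> R) :
  (forall i, unif_cont (F i)) ->
  mean eta (fun x => \sum_(i <- r) F i x) = \sum_(i <- r) mean eta (F i).
Proof.
move=> uF; elim: r => [|i r IH].
  rewrite big_nil -[RHS](mean_cst eta); congr mean.
  by apply/funext => x; rewrite big_nil.
rewrite big_cons -IH -meanD//; last exact: unif_cont_sum.
by congr mean; apply/funext => x; rewrite big_cons.
Qed.

Lemma mean_fin_rv eta (T : finType) n (g : X -> T) (c : T -> R) :
  fin_rv n g -> mean eta (c \o g) = \sum_t law eta g t * c t.
Proof.
move=> fg; have rg := fin_rv_rv fg.
have ui t : unif_cont (fun x => (\1_(g @^-1` [set t]) x : R)).
  move=> e e0; exists n => x y xy; rewrite !indicE.
  suff -> : (x \in g @^-1` [set t]) = (y \in g @^-1` [set t]) by rewrite subrr normr0 ltW.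
  by apply/idP/idP; rewrite !inE /= => <-; [apply/esym|]; apply: fg.
transitivity (mean eta (fun x => \sum_t c t * \1_(g @^-1` [set t]) x)).
  congr mean; apply/funext => x /=.
  rewrite (bigD1 (g x))//= big1 => [|t tg]; last first.
    by rewrite indicE memNset ?mulr0// => /= gt; rewrite gt eqxx in tg.
  by rewrite indicE mem_set//= mulr1 addr0.
rewrite mean_sum => [|t]; last exact: unif_contZ.
apply: eq_bigr => t _; rewrite meanZ// mulrC; congr (_ * _).
by rewrite /mean /Rintegral integral_indic// setIT.
Qed.

Lemma mean_approx eta f (T : finType) n (g : X -> T) (c : T -> R) (e : R) :
  unif_cont f -> fin_rv n g -> (forall x, `|f x - c (g x)| <= e) ->
  `|mean eta f - \sum_t law eta g t * c t| <= e.
Proof.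
move=> uf fg fc; rewrite -(mean_fin_rv eta c fg).
have uc := unif_cont_fin_rv c fg.
have ue := @unif_cont_cst e.
have := mean_le eta uf (unif_contD uc ue) (fun x => _ : f x <= (c \o g) x + e).
rewrite meanD// mean_cst => H1.
have := mean_le eta uc (unif_contD uf ue) (fun x => _ : (c \o g) x <= f x + e).
rewrite meanD// mean_cst => H2.
suff [/H1 + /H2] : (forall x, f x <= (c \o g) x + e) /\ (forall x, (c \o g) x <= f x + e).
  by rewrite ler_norml => ? ?; apply/andP; split; lra.
by split=> x; have := fc x; rewrite ler_norml /= => /andP[]; lra.
Qed.

(** The mixture is only assumed on finitary sets; the identity passes to [f] by replacing it, up to
    e / 2 on either side, with a function of the first n letters. *)
Lemma mean_mixture (I : finType) (p : I -> R) (nu : I -> probability X R) (h : I -> X -> X) eta f :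
  (forall i, 0 <= p i) -> \sum_i p i = 1 ->
  (forall i n, exists m : nat, forall x y, agree m x y -> agree n (h i x) (h i y)) ->
  (forall B, finitary_sets B -> pr eta B = \sum_i p i * pr (nu i) (h i @^-1` B)) ->
  unif_cont f -> mean eta f = \sum_i p i * mean (nu i) (f \o h i).
Proof.
move=> p0 p1 hc pE uf; apply/eqP; rewrite -subr_eq0 -normr_le0.
apply/ler_addgt0Pr => e e0; rewrite add0r.
have e2 : 0 < e / 2 by rewrite divr_gt0.
have [n fn] := uf _ e2.
have [m hm] := choice (fun i => hc i n).
have hn i : fin_rv (m i) (word n \o h i).
  by move=> x y xy; apply/eq_word; apply: hm.
have ufh i : unif_cont (f \o h i).
  by move=> d /uf[k fk]; have [l hl] := hc i k; exists l => x y /hl; apply: fk.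
pose c (w : n.-tuple A) := f (ext hA w).
have fc x : `|f x - c (word n x)| <= e / 2 by apply: fn; exact: agree_ext.
have H1 := mean_approx eta uf (@fin_rv_word _ _ n) fc.
have H2 i := mean_approx (nu i) (ufh i) (hn i) (fun x => fc (h i x)).
have E : \sum_t law eta (word n) t * c t = \sum_i p i * \sum_t law (nu i) (word n \o h i) t * c t.
  under [RHS]eq_bigr do rewrite big_distrr/=.
  rewrite exchange_big/=; apply: eq_bigr => w _.
  rewrite /law pE; last first.
    by exists n => x y /eq_word + /= => ->.
  by rewrite big_distrl/=; apply: eq_bigr => i _; rewrite mulrA.
rewrite E in H1; rewrite [e]splitr.
rewrite -(subrK (\sum_i p i * \sum_t law (nu i) (word n \o h i) t * c t) (mean eta f)) -addrA.
apply: le_trans (ler_normD _ _) _; apply: lerD => //.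
rewrite -sumrB; apply: le_trans (ler_norm_sum _ _ _) _.
rewrite -[leRHS]mul1r -[X in X * _]p1 big_distrl/=; apply: ler_sum => i _.
by rewrite -mulrBr normrM ger0_norm// ler_wpM2l// distrC.
Qed.

Lemma mean_shift eta k f : invariant_measures hA eta -> unif_cont f ->
  mean eta (f \o iter k (@left_shift A hA)) = mean eta f.
Proof.
move=> inv uf.
rewrite (@mean_mixture 'I_1 (fun=> 1) (fun=> eta) (fun=> iter k (@left_shift A hA)) eta f)//.
- by rewrite big_ord_recl big_ord0 mul1r addr0.
- by rewrite sumr_const card_ord.
- by move=> _ n; exists (k + n)%N => x y; exact: agree_shift.
- move=> B [n fB]; rewrite big_ord_recl big_ord0 mul1r addr0 pr_shift//.
  exact: finitary_measurable fB.
Qed.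

End uniformly_continuous_observables.

(** * Invariant measures obtained by averaging over a period *)

Lemma pushforward_probability (R : realType) d d' (T : measurableType d)
    (T' : measurableType d') (P : probability T R) (f : T -> T') :
  measurable_fun setT f ->
  exists Q : probability T' R, forall B, Q B = P (f @^-1` B).
Proof.
move=> mf.
pose F : {mfun T >-> T'} := HB.pack f (isMeasurableFun.Build _ _ _ _ f mf).
by exists (distribution P F).
Qed.

Section averaging.
Context (R : realType) (A : finType) (hA : (1 < #|A|)%N).
Local Notation X := (full_shift hA).
Local Notation th := (@left_shift A hA).
Implicit Types (eta nu : probability X R) (x y : X) (n m k : nat) (f g : X -> R).

Lemma invariant_finitary eta :
  (forall B, finitary_sets B -> pr eta (iter 1 th @^-1` B) = pr eta B) ->
  invariant_measures hA eta.
Proof.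
move=> H B mB.
have [Q QE] := pushforward_probability eta (@measurable_shift A hA).
rewrite -QE; apply: eq_probability mB => C fC.
rewrite QE; have [n nC] := fC; have mC := finitary_measurable nC.
by rewrite !prE//; [rewrite H|exact: (measurable_shift_preimage 1 mC)].
Qed.

(** Shifting the average replaces its term of index 0 by the one of index N, and these agree by
    hypothesis. *)
Lemma average_measure nu N : (0 < N)%N ->
  (forall B, finitary_sets B -> pr nu (iter N th @^-1` B) = pr nu B) ->
  exists eta : probability X R, invariant_measures hA eta /\
    forall B, measurable B ->
      pr eta B = \sum_(i < N) N%:R^-1 * pr nu (iter i th @^-1` B).
Proof.
move=> N0 nuN.
have [q qE] := choice (fun i => pushforward_probability nu (@measurable_iter_shift A hA i)).
pose ms : {measure set X -> \bar R} := msum (fun i => q i) N.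
have msE B : measurable B -> ms B = (\sum_(i < N) pr nu (iter i th @^-1` B))%:E.
  move=> mB; rewrite /ms /msum -sumEFin; apply: eq_bigr => i _.
  transitivity (nu (iter i th @^-1` B)); first exact: qE.
  by rewrite prE//; exact: measurable_shift_preimage.
have msT : ms setT = N%:R%:E.
  rewrite msE//; congr EFin; under eq_bigr do rewrite preimage_setT pr_setT.
  by rewrite sumr_const card_ord.
(* The total mass is N, positive and finite, so the fallback [nu] of [mnormalize] is never
   reached. *)
pose eta : probability X R := mnormalize ms nu.
have ee B : eta B = if (ms setT == 0%E) || (ms setT == +oo%E) then nu B
    else (ms B * ((fine (ms setT))^-1)%:E)%E.
  by rewrite [LHS]/= /mnormalize; case: ifP.
have etaE B : measurable B ->
    pr eta B = \sum_(i < N) N%:R^-1 * pr nu (iter i th @^-1` B).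
  move=> mB; rewrite /pr ee msT.
  rewrite ifF; last by rewrite orbF eqe pnatr_eq0; apply/negbTE; rewrite -lt0n.
  by rewrite msE//= -big_distrr/= mulrC.
exists eta; split => //; apply: invariant_finitary => B [n fB].
have mB := finitary_measurable fB.
rewrite !etaE//; last exact: (measurable_shift_preimage 1 mB).
case: N N0 nuN {q qE ms msE msT eta ee etaE} => // N _ nuN.
rewrite big_ord_recr [RHS]big_ord_recl /= addrC; congr (_ * _ + _).
  rewrite -[RHS]nuN; last by exists n.
  by congr (pr nu _); apply/seteqP; split => x /=; rewrite -?iterS.
Qed.

Lemma mean_average nu N eta f : (0 < N)%N ->
  (forall B, measurable B ->
      pr eta B = \sum_(i < N) N%:R^-1 * pr nu (iter i th @^-1` B)) ->
  unif_cont f ->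
  mean eta f = \sum_(i < N) N%:R^-1 * mean nu (f \o iter i th).
Proof.
move=> N0 etaE uf.
apply: (@mean_mixture _ _ _ 'I_N (fun=> N%:R^-1) (fun=> nu) (fun i => iter i th)) => //.
- by rewrite sumr_const card_ord -[LHS]mulr_natr mulVf// pnatr_eq0 -lt0n.
- by move=> i n; exists (i + n)%N => x y; exact: agree_shift.
- by move=> B [n /finitary_measurable mB]; exact: etaE.
Qed.

Definition birkhoff f n x : R := \sum_(i < n) f (iter i th x).

Lemma unif_cont_birkhoff f n : unif_cont f -> unif_cont (birkhoff f n).
Proof. by move=> uf; apply: unif_cont_sum => i; exact: unif_cont_shift. Qed.

Lemma birkhoffD f m n x :
  birkhoff f (m + n) x = birkhoff f m x + birkhoff f n (iter m th x).
Proof.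
rewrite /birkhoff big_split_ord/=; congr (_ + _); apply: eq_bigr => i _.
by congr f; rewrite addnC iterD.
Qed.

Lemma birkhoffS f n x : birkhoff f n.+1 x = f x + birkhoff f n (th x).
Proof. by rewrite -addn1 addnC birkhoffD /birkhoff big_ord_recl big_ord0 addr0. Qed.

Lemma mean_birkhoff eta f n : invariant_measures hA eta -> unif_cont f ->
  mean eta (birkhoff f n) = n%:R * mean eta f.
Proof.
move=> inv uf; rewrite /birkhoff mean_sum; last by move=> i; exact: unif_cont_shift.
rewrite (eq_bigr (fun=> mean eta f)).
  by rewrite sumr_const card_ord mulr_natl.
by move=> i _; exact: (mean_shift i inv uf).
Qed.

Definition periodic_point (s : seq A) : X :=
  fun i => nth (enum_val (Ordinal (ltnW hA))) s (i %% size s).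

Lemma shift_periodic_point s k : iter (k * size s) th (periodic_point s) = periodic_point s.
Proof.
by apply/funext => i; rewrite iter_shiftE /periodic_point modnMDl.
Qed.

(** The average of the Dirac masses along the orbit; the length of [s] need not be its minimal
    period. *)
Lemma periodic_measure (s : seq A) : (0 < size s)%N ->
  exists eta : probability X R, invariant_measures hA eta /\
    forall f, unif_cont f ->
      mean eta f = (size s)%:R^-1 * birkhoff f (size s) (periodic_point s).
Proof.
move=> s0.
pose nu : probability X R := \d_(periodic_point s).
have [||eta [inv etaE]] := @average_measure nu (size s) => //.
  move=> B _.
  have nuE C : nu C = (\1_C (periodic_point s))%:E by [].
  rewrite /pr !nuE !indicE; congr (fine (nat_of_bool _)%:R%:E).
  have := shift_periodic_point s 1; rewrite mul1n => E.
  by apply/idP/idP; rewrite !inE /= E.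
exists eta; split => // f uf.
rewrite (mean_average s0 etaE uf) -big_distrr/=; congr (_ * _).
apply: eq_bigr => i _; rewrite /mean /Rintegral /nu integral_dirac//.
  have nuT : nu setT = 1%E by exact: probability_setT.
  by rewrite -[X in (X * _)%E]/(nu setT) nuT mul1e.
exact: (measurable_int eta (unif_cont_integrable eta (unif_cont_shift i uf))).
Qed.

End averaging.

(** * Independent blocks *)

(** Lebesgue measure on [0, 1[, the source of randomness for independent blocks. Only sets with an
    interval as trace on [0, 1[ are needed, since cylinders of digits are of this kind. *)
Lemma unit_interval_probability (R : realType) :
  exists P : probability (measurableTypeR R) R,
    forall (B : set R) (a b : R), a <= b -> B `&` `[0, 1[ = `[a, b[%classic ->
      P B = (b - a)%:E.
Proof.
have mD : measurable (`[0, 1[%classic : set (measurableTypeR R)) by exact: measurable_itv.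
pose m0 : {measure set (measurableTypeR R) -> \bar R} := lebesgue_measure.
pose m : {measure set (measurableTypeR R) -> \bar R} := mrestr m0 mD.
have LE (a b : R) : a <= b -> lebesgue_measure (`[a, b[%classic : set R) = (b - a)%:E.
  move=> ab; rewrite lebesgue_measure_itv/= lte_fin; case: ltP => // ba.
  by have -> : a = b by [apply/le_anti; rewrite ab]; rewrite subrr.
have mE (B : set R) (a b : R) : a <= b -> B `&` `[0, 1[ = `[a, b[%classic -> m B = (b - a)%:E.
  by move=> ab BE; rewrite -LE// -BE.
have mT : m setT = 1%E by rewrite (mE _ 0 1)// ?subr0// setTI.
pose P : probability (measurableTypeR R) R := mnormalize m (@dirac _ (measurableTypeR R) (0 : R) R).
exists P => B a b ab BE; rewrite -(mE B a b ab BE).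
have -> : P B = if (m setT == 0%E) || (m setT == +oo%E) then @dirac _ (measurableTypeR R) (0 : R) R B
    else (m B * ((fine (m setT))^-1)%:E)%E.
  by rewrite [LHS]/= /mnormalize; case: ifP.
by rewrite mT /= orbF onee_eq0 invr1 mule1.
Qed.

Section digit_expansion.
Context (R : realType) (B : finType) (b0 : B) (p : B -> R).
Hypotheses (p_gt0 : forall b, 0 < p b) (p_sum : \sum_b p b = 1).

(* The unit interval is cut into consecutive intervals of lengths p b; the
   itinerary of a uniform point under the expanding map is i.i.d. with law p. *)
Definition digit_left (b : B) : R :=
  \sum_(c | (enum_rank c < enum_rank b)%N) p c.

Definition digit (u : R) : B :=
  odflt b0 [pick b | digit_left b <= u < digit_left b + p b].

Definition digit_map (u : R) : R := (u - digit_left (digit u)) / p (digit u).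

Lemma digit_left_ge0 b : 0 <= digit_left b.
Proof. by apply: sumr_ge0 => c _; apply: ltW. Qed.

Lemma digit_left_lt b c : (enum_rank b < enum_rank c)%N ->
  digit_left b + p b <= digit_left c.
Proof.
move=> bc; rewrite /digit_left [X in _ <= X](bigD1 b)//=.
rewrite [leRHS]addrC lerD2r.
rewrite big_mkcond [leRHS]big_mkcond/=; apply: ler_sum => d _.
case: ifPn => db; last by case: ifP => // _; apply: ltW.
rewrite (ltn_trans db bc) ifT//=; apply/eqP => E.
by rewrite E ltnn in db.
Qed.

Lemma digit_right_le1 b : digit_left b + p b <= 1.
Proof.
rewrite -p_sum [leRHS](bigD1 b)//=.
rewrite [leRHS]addrC lerD2r.
rewrite /digit_left big_mkcond [leRHS]big_mkcond/=; apply: ler_sum => d _.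
case: ifPn => db; last by case: ifP => // _; apply: ltW.
by rewrite ifT//=; apply/eqP => E; rewrite E ltnn in db.
Qed.

Lemma digit_uniq u b : digit_left b <= u < digit_left b + p b -> digit u = b.
Proof.
move=> /andP[bu ub]; rewrite /digit; case: pickP => [c /andP[cu uc]|/(_ b)]; last by rewrite bu ub.
apply: enum_rank_inj; apply/val_inj; case: (ltngtP (enum_rank c) (enum_rank b)) => //.
  by move/digit_left_lt => H; have := lt_le_trans uc (le_trans H bu); rewrite ltxx.
by move/digit_left_lt => H; have := lt_le_trans ub (le_trans H cu); rewrite ltxx.
Qed.

Lemma digitP u : 0 <= u < 1 ->
  digit_left (digit u) <= u < digit_left (digit u) + p (digit u).
Proof.
move=> /andP[u0 u1]; rewrite /digit; case: pickP => //= np; exfalso.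
(* If no interval contains [u], then [u] passes the right end of each interval in turn, and finally
   the total length 1. *)
have Hk (k : nat) : \sum_(c | (enum_rank c < k)%N) p c <= u.
  elim: k => [|k IH]; first by rewrite big_pred0.
  case: (ltnP k #|B|) => [kB|Bk].
    pose b := enum_val (Ordinal kB).
    have rb : enum_rank b = k :> nat by rewrite /b enum_valK.
    have := np b; rewrite /digit_left rb IH/= => /negbT; rewrite -leNgt.
    apply: le_trans; rewrite (bigD1 b)//= ?rb// addrC lerD2r.
    rewrite le_eqVlt; apply/orP; left; apply/eqP; apply: eq_bigl => c.
    rewrite ltnS leq_eqVlt; case: (eqVneq c b) => [->|cb].
      by rewrite rb eqxx /= ltnn.
    rewrite andbT; case: eqP => //= E; case/eqP: cb.
    by apply: enum_rank_inj; apply/val_inj; rewrite /= E rb.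
  apply: le_trans IH; rewrite le_eqVlt; apply/orP; left; apply/eqP.
  by apply: eq_bigl => c; rewrite !(leq_trans (ltn_ord _))// ltnW.
have := Hk #|B|; rewrite (eq_bigl predT) ?p_sum => [|c]; last by rewrite ltn_ord.
by move=> /(lt_le_trans u1); rewrite ltxx.
Qed.

(** Left end of the interval of those points whose expansion starts with [w]; its length is
    [cyl_length w], see [digitsP]. *)
Fixpoint cyl_left (w : seq B) : R :=
  if w is b :: w' then digit_left b + p b * cyl_left w' else 0.

Definition cyl_length (w : seq B) : R := \prod_(b <- w) p b.

Lemma cyl_length_gt0 w : 0 < cyl_length w.
Proof. by apply: prodr_gt0. Qed.

Lemma cyl_left_bounds w : 0 <= cyl_left w /\ cyl_left w + cyl_length w <= 1.
Proof.
rewrite /cyl_length; elim: w => [|b w [IH0 IH1]] /=.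
  by rewrite big_nil add0r.
split; first by rewrite addr_ge0 ?digit_left_ge0// mulr_ge0// ltW.
rewrite big_cons -addrA -mulrDr; apply: le_trans (digit_right_le1 b).
by rewrite lerD2l ler_piMr// ltW.
Qed.

Definition digits (u : R) (i : nat) : B := digit (iter i digit_map u).

Lemma digitsP (w : seq B) u : 0 <= u < 1 ->
  (mkseq (digits u) (size w) == w) =
  (cyl_left w <= u < cyl_left w + cyl_length w).
Proof.
elim: w u => [|b w IH] u u01; first by rewrite /= /cyl_length big_nil add0r.
have du := digitP u01.
have g01 : 0 <= digit_map u < 1.
  rewrite /digit_map; apply/andP; split.
    apply: divr_ge0; last exact: ltW.
    by rewrite subr_ge0; case/andP: du.
  by rewrite ltr_pdivrMr// mul1r ltrBlDl; case/andP: du.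
have -> : mkseq (digits u) (size (b :: w)) =
    digit u :: mkseq (digits (digit_map u)) (size w).
  rewrite /mkseq /= -[1%N]addn0 iotaDl -map_comp; congr (_ :: _).
  by apply: eq_map => i /=; rewrite /digits iterSr.
rewrite eqseq_cons IH//= /cyl_length big_cons -/(cyl_length w).
have [L0 L1] := cyl_left_bounds w; have Lp := cyl_length_gt0 w.
have [<-|db] /= := eqVneq (digit u) b.
  rewrite /digit_map ler_pdivlMr// ltr_pdivrMr// lerBrDl ltrBlDl.
  by rewrite mulrC [X in _ && (_ < _ + X)]mulrC mulrDr addrA.
apply/esym/negbTE; apply: contra_neqN db => /andP[h1 h2]; apply: digit_uniq.
apply/andP; split.
  by apply: le_trans h1; rewrite lerDl mulr_ge0// ltW.
apply: lt_le_trans h2 _; rewrite -addrA -mulrDr lerD2l ler_piMr// ltW//.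
Qed.

End digit_expansion.

Section block_bernoulli.
Context (R : realType) (A : finType) (hA : (1 < #|A|)%N).
Local Notation X := (full_shift hA).
Local Notation th := (@left_shift A hA).
Implicit Types (x y : X) (n m k : nat).
Context (N : nat) (N_gt0 : (0 < N)%N) (p : N.-tuple A -> R).
Hypotheses (p_gt0 : forall b, 0 < p b) (p_sum : \sum_b p b = 1).

Definition block_word k x : k.-tuple (N.-tuple A) :=
  [tuple word N (iter (j * N) th x) | j < k].

Lemma block_wordP k x y : block_word k x = block_word k y <-> agree (k * N) x y.
Proof.
split=> [E i ilt|xy].
  have jk : (i %/ N < k)%N by rewrite ltn_divLR.
  have := congr1 (fun t => tnth t (Ordinal jk)) E; rewrite !tnth_mktuple.
  move/eq_word => /(_ (i %% N)%N (ltn_pmod _ N_gt0)).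
  by rewrite !iter_shiftE/= -divn_eq.
apply: eq_from_tnth => j; rewrite !tnth_mktuple; apply/eq_word.
apply: agree_shift; apply: agree_le xy.
by rewrite addnC -mulSn leq_mul2r ltn_ord orbT.
Qed.

Lemma fin_rv_block_word k : fin_rv (k * N) (block_word k).
Proof. by move=> x y /block_wordP. Qed.

(** The image of the uniform law on [0, 1[ under the map [Y] whose successive N-blocks are the
    digits of a point. *)
Lemma block_measure : exists nu : probability X R,
  (forall k (s : k.-tuple (N.-tuple A)), law nu (block_word k) s = \prod_(b <- s) p b) /\
  (forall B, finitary_sets B -> pr nu (iter N th @^-1` B) = pr nu B).
Proof.
have [P PE] := unit_interval_probability R.
pose b0 := word N (point : X).
pose D u := digits b0 p u.
pose a0 := (point : X) 0%N.
(* Outside [0, 1[, a null set, the value is a constant sequence: this makes [Y] total and keeps it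
   measurable. *)
pose Y (u : R) : X := fun i => if 0 <= u < 1 then nth a0 (D u (i %/ N)%N) (i %% N) else a0.
have Y0 u : ~ (u \in `[0, 1[) -> Y u = (fun=> a0).
  by rewrite in_itv/= => /negP/negbTE E; apply/funext => i; rewrite /Y E.
have YD u k : 0 <= u < 1 -> block_word k (Y u) = mkseq (D u) k :> seq _.
  move=> u01; apply: (@eq_from_nth _ b0); rewrite ?size_tuple ?size_mkseq// => j jk.
  rewrite nth_mkseq// -[j]/(val (Ordinal jk)) -tnth_nth tnth_mktuple.
  apply: eq_from_tnth => i; rewrite tnth_word iter_shiftE /Y u01 /=.
  rewrite modnMDl modn_small// divnMDl// divn_small// addn0.
  by rewrite (tnth_nth a0).
have YC (k : nat) (s : k.-tuple (N.-tuple A)) :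
    (Y @^-1` (block_word k @^-1` [set s])) `&` `[0, 1[ =
    `[cyl_left p s, cyl_left p s + cyl_length p s[%classic.
  apply/seteqP; split => u /=; rewrite !in_itv/=.
    move=> [bs u01]; rewrite -(digitsP b0 p_gt0 p_sum s u01) size_tuple.
    by rewrite -/(D u) -YD// bs.
  move=> us; have [L0 L1] := cyl_left_bounds p_gt0 p_sum s.
  have u01 : 0 <= u < 1.
    by case/andP: us => h1 h2; rewrite (le_trans L0 h1) (lt_le_trans h2 L1).
  split => //; apply/val_inj; rewrite /= YD//; apply/eqP.
  by rewrite -[X in mkseq _ X](size_tuple s) (digitsP b0 p_gt0 p_sum s u01).
have mY : measurable_fun setT (Y : measurableTypeR R -> X).
  apply: (measurability _ (@measurable_finitaryE A hA)) => _ [C [n fC] <-].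
  rewrite setTI.
  (* Inside [0, 1[ the preimage of a finitary set is a finite union of cylinder intervals; outside
     it is everything or nothing, as [Y] is constant there. *)
  have -> : Y @^-1` C =
      ([set u | C (Y u)] `&` ~` `[0, 1[) `|`
      \big[setU/set0]_(s <- enum {: n.-tuple (N.-tuple A)} | `[< exists x, block_word n x = s /\ C x >])
        `[cyl_left p s, cyl_left p s + cyl_length p s[%classic.
    rewrite -bigcup_seq_cond; apply/seteqP; split => u.
      move=> CYu; have [u01|u01] := boolP (0 <= u < 1).
        right; exists (block_word n (Y u)).
          by rewrite /= mem_enum /=; apply/asboolP; exists (Y u).
        by rewrite -YC; split => //=; rewrite in_itv.
      by left; split => //=; rewrite in_itv/=; exact/negP.
    move=> [[]//|[s /= /andP[_ /asboolP[x [<- Cx]]]]].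
    move=> Hu; have : (Y @^-1` (block_word n @^-1` [set block_word n x]) `&` `[0, 1[) u by rewrite YC.
    move=> [/= /block_wordP E _].
    apply: fC Cx; apply: agree_le (agree_sym E); exact: leq_pmulr.
  apply: measurableU; last by apply: bigsetU_measurable => s _; exact: measurable_itv.
  have [Ca|nCa] := pselect (C (fun=> a0)).
    rewrite (_ : _ `&` _ = ~` `[0, 1[%classic).
      by apply: measurableC; exact: measurable_itv.
    apply/seteqP; split => u; first by case.
    by move=> /= nu01; split => //; rewrite Y0.
  rewrite (_ : _ `&` _ = set0)//; apply/seteqP; split => u //= [CY nu01].
  by move: CY; rewrite Y0.
have [nu nuE] := pushforward_probability P mY.
have lawE k (s : k.-tuple (N.-tuple A)) : law nu (block_word k) s = \prod_(b <- s) p b.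
  rewrite /law /pr nuE (PE _ _ _ _ (YC k s)); first by rewrite addrC addKr.
  by rewrite lerDl ltW// cyl_length_gt0.
exists nu; split => // C [n fC].
have rb k : rv (block_word k) := fin_rv_rv (@fin_rv_block_word k).
pose Q (s : n.-tuple (N.-tuple A)) := `[< exists x, block_word n x = s /\ C x >].
have CQ : C = [set x | Q (block_word n x)].
  apply/seteqP; split => x /=; first by move=> Cx; apply/asboolP; exists x.
  move/asboolP => [y [/block_wordP E Cy]]; apply: fC Cy; apply: agree_le E.
  exact: leq_pmulr.
have -> : iter N th @^-1` C = [set x | Q ((block_word n \o iter N th) x)] by rewrite {1}CQ.
rewrite [in RHS]CQ !pr_comp//; last exact: rv_shift.
apply: eq_bigr => s _; rewrite lawE.
(* A shift by N drops the first of n + 1 blocks, and summing the product law over that block gives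
   back the product law of n blocks. *)
have E : block_word n \o iter N th = (fun t : n.+1.-tuple _ => [tuple of behead t]) \o block_word n.+1.
  apply/funext => x; apply: eq_from_tnth => j; rewrite /= tnth_behead !tnth_mktuple.
  apply: eq_from_tnth => i; rewrite !tnth_word !iter_shiftE.
  by rewrite inordK ?ltnS// mulSn addnA.
rewrite E law_comp//.
rewrite (reindex_onto (fun b => [tuple of b :: s]) (fun t : n.+1.-tuple _ => thead t))/=; last first.
  move=> t /eqP <-; rewrite [RHS]tuple_eta; exact/val_inj.
rewrite (eq_bigr (fun b => p b * \prod_(b <- s) p b)) => [|b _]; last first.
  by rewrite lawE big_cons.
rewrite (eq_bigl predT) => [|b]; first by rewrite -big_distrl/= p_sum mul1r.
rewrite theadE eqxx andbT; apply/eqP/val_inj => /=.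
by [].
Qed.

End block_bernoulli.

Section entropy_lower_bound.
Context (R : realType) (A : finType) (hA : (1 < #|A|)%N).
Local Notation X := (full_shift hA).
Implicit Types (eta nu : probability X R).

Lemma block_entropy_ge_mul eta (a : R) n :
  (forall m, a <= block_entropy_inc eta m) -> n%:R * a <= block_entropy eta n.
Proof.
move=> ha; elim: n => [|n IH]; first by rewrite mul0r block_entropy0.
by have := ha n; rewrite /block_entropy_inc -natr1; lra.
Qed.

(** The partition by the first letter suffices: its joins are the words, and the mean entropy per
    letter decreases, so that its limit exists and inherits the bound. *)
Lemma entropy_ge eta (a : R) : invariant_measures hA eta ->
  (forall m, a <= block_entropy_inc eta m) -> (a%:E <= entropy eta)%E.
Proof.
move=> inv ha.
pose u (n : nat) : \bar R := (n%:R^-1 * join_entropy eta (@coord_partition A hA) n)%:E.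
apply: (@le_trans _ _ (limn u)); last first.
  apply: ereal_sup_ubound; exists #|A|, (@coord_partition A hA); split => //.
  exact: measurable_coord_partition.
have cu : cvgn u.
  (* The term of index 0 is 0, because 0^-1 is 0, so the sequence decreases only from index 1 on. *)
  apply/cvg_ex; have : cvgn (fun n => u n.+1).
    apply: ereal_nonincreasing_is_cvgn; apply/nonincreasing_seqP => n.
    rewrite /u !join_entropy_coord lee_fin.
    have a0 : (0 : R) < n.+1%:R by rewrite ltr0n.
    have b0 : (0 : R) < n.+2%:R by rewrite ltr0n.
    rewrite -(ler_pM2l (mulr_gt0 a0 b0)).
    have key (b c h : R) : 0 < b -> c * b * (b^-1 * h) = c * h.
      by move=> b_gt0; field; rewrite gt_eqF.
    rewrite key// [n.+1%:R * n.+2%:R]mulrC key//.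
    have := block_entropy_inc_le_mean inv (leqnn n.+1).
    by rewrite /block_entropy_inc -[n.+2%:R]natr1; lra.
  by move=> /cvg_ex[l ul]; exists l; move: ul; rewrite (cvg_shiftS u).
apply: lime_ge => //; exists 1%N => // n /= n0.
rewrite /u join_entropy_coord lee_fin ler_pdivlMl ?ltr0n//.
exact: block_entropy_ge_mul.
Qed.

End entropy_lower_bound.

(** * Pressure *)

Section pressure_estimates.
Context (R : realType) (A : finType) (hA : (1 < #|A|)%N).
Local Notation X := (full_shift hA).
Local Notation th := (@left_shift A hA).
Implicit Types (eta nu : probability X R) (x y : X) (n m k : nat).
Context (phi : X -> R) (v : nat -> R) (V : R).
Hypotheses (osc_phi : forall n, osc_le n phi (v n))
  (v_ge0 : forall n, 0 <= v n) (v_sum : forall n, \sum_(i < n) v i <= V).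

Lemma variation_small (e : R) m : 0 < e -> exists2 n, (m <= n)%N & v n < e.
Proof.
move=> e0; apply: contrapT => N.
have H n : (m <= n)%N -> e <= v n.
  by move=> mn; rewrite leNgt; apply/negP => vn; apply: N; exists n.
pose k := (Num.trunc (V / e)).+1.
have := v_sum (m + k); rewrite leNgt => /negP; apply.
rewrite big_split_ord/=; apply: lt_le_trans (_ : \sum_(i < k) e <= _).
  by rewrite sumr_const card_ord -mulr_natr mulrC -ltr_pdivrMr// truncnS_gt.
rewrite -[leLHS]add0r; apply: lerD; first by apply: sumr_ge0.
by apply: ler_sum => i _; apply: H; exact: leq_addr.
Qed.

Lemma unif_cont_phi : unif_cont phi.
Proof.
move=> e /(variation_small 0)[n _ vn]; exists n => x y xy.
by apply: le_trans (osc_phi xy) (ltW vn).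
Qed.

(** Bounded distortion: after i shifts n - i common letters remain, so the errors are distinct terms
    of the series of variations. *)
Lemma birkhoff_osc n : osc_le n (birkhoff phi n) V.
Proof.
move=> x y xy; apply: le_trans (v_sum n.+1).
elim: n x y xy => [|n IH] x y xy.
  by rewrite /birkhoff !big_ord0 subrr normr0 sumr_ge0.
rewrite !birkhoffS opprD addrACA big_ord_recr/=.
apply: le_trans (ler_normD _ _) _; rewrite [leRHS]addrC; apply: lerD.
  exact: osc_phi.
by apply: IH; exact: (@agree_shift _ _ n 1).
Qed.

Lemma birkhoff_oscZ n (t : R) : osc_le n (fun x => t * birkhoff phi n x) (`|t| * V).
Proof. by move=> x y xy; rewrite -mulrBr normrM ler_wpM2l// birkhoff_osc. Qed.

Definition partition_function (t : R) n : R :=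
  \sum_(w : n.-tuple A) expR (t * birkhoff phi n (ext hA w)).

Lemma partition_function_gt0 t n : 0 < partition_function t n.
Proof.
rewrite /partition_function (bigD1 (word n (point : X)))//=.
by rewrite ltr_wpDr ?expR_gt0// sumr_ge0// => w _; exact: expR_ge0.
Qed.

Lemma mean_phiZ eta t : (\int[eta]_x (t * phi x)%:E)%E = (t * mean eta phi)%:E.
Proof.
rewrite integral_mean ?meanZ//; first exact: unif_cont_phi.
exact: unif_contZ unif_cont_phi.
Qed.

(** After multiplication by n the increment is at most the entropy of n-words, to which Gibbs'
    inequality applies. The error |t| V is the price for evaluating S_n phi on words through
    [ext]. *)
Lemma free_energy_le eta t n : invariant_measures hA eta -> (0 < n)%N ->
  (entropy eta + \int[eta]_x (t * phi x)%:E <=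
    ((ln (partition_function t n) + `|t| * V) / n%:R)%:E)%E.
Proof.
move=> inv n0; rewrite mean_phiZ.
apply: le_trans (leeD2r _ (entropy_le_inc n inv)) _.
rewrite -EFinD lee_fin ler_pdivlMr ?ltr0n//.
have Hn := block_entropy_inc_le_mean inv (leqnn n).
have uS := unif_cont_birkhoff n unif_cont_phi.
have := mean_approx eta (unif_contZ t uS) (@fin_rv_word _ _ n)
  (c := fun w : n.-tuple A => t * birkhoff phi n (ext hA w))
  (fun x => birkhoff_oscZ t (@agree_ext _ _ n x)) => /=.
rewrite meanZ// mean_birkhoff//; last exact: unif_cont_phi.
have Z0 := partition_function_gt0 t n.
pose q (w : n.-tuple A) := expR (t * birkhoff phi n (ext hA w)) / partition_function t n.
have q0 w : 0 < q w by rewrite divr_gt0// expR_gt0.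
have q1 : \sum_w q w <= 1 by rewrite -big_distrl/= divff// gt_eqF.
have := shannon_le_cross eta (@rv_word _ _ n) q0 q1.
rewrite -/(block_entropy eta n).
rewrite (eq_bigr (fun w => law eta (word n) w * ln (partition_function t n)
    - law eta (word n) w * (t * birkhoff phi n (ext hA w)))); last first.
  by move=> w _; rewrite /q ln_div ?posrE ?expR_gt0// expRK; ring.
rewrite sumrB -big_distrl/= sum_law ?mul1r; last exact: rv_word.
move=> H1; rewrite ler_norml => /andP[_ H2].
move: Hn H1 H2; set a := block_entropy_inc _ _; set S := \sum_t0 _; set z := ln _.
rewrite mulrDl [a * _]mulrC [t * mean eta phi * _]mulrC [n%:R * (t * _)]mulrCA.
lra.
Qed.

Lemma pressure_le t n : (0 < n)%N -> (pressure (fun x => (t * phi x)%R) <=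
    ((ln (partition_function t n) + `|t| * V) / n%:R)%:E)%E.
Proof.
move=> n0; apply: ub_ereal_sup => _ [eta inv <-]; exact: free_energy_le.
Qed.

(** Averaging over the phase destroys the alignment of the blocks, hence k + 1 blocks on the side of
    the entropy against k on the other sides. *)
Lemma gibbs_block_measure t N : (0 < N)%N ->
  exists eta : probability X R, invariant_measures hA eta /\
    forall k, k%:R * (ln (partition_function t N) - `|t| * V) <=
      block_entropy eta (k.+1 * N) + k%:R * (t * (N%:R * mean eta phi)).
Proof.
move=> N0; have Z0 := partition_function_gt0 t N.
set Z := partition_function t N in Z0 *.
pose p (w : N.-tuple A) := expR (t * birkhoff phi N (ext hA w)) / Z.
have p0 w : 0 < p w by rewrite divr_gt0// expR_gt0.
have p1 : \sum_w p w = 1 by rewrite -big_distrl/= divff// gt_eqF.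
have [nu [lawE nuN]] := block_measure hA N0 p0 p1.
have [eta [inv etaE]] := average_measure N0 nuN.
exists eta; split => // k.
have uphi := unif_cont_phi.
have uS n := unif_cont_birkhoff n uphi.
have fbw n := @fin_rv_block_word A hA N N0 n.
have rbw n := fin_rv_rv (fbw n).
have mE : N%:R * mean eta phi = mean nu (birkhoff phi N).
  rewrite (mean_average N0 etaE uphi) -big_distrr/= mulrA mulfV ?mul1r ?pnatr_eq0 -?lt0n//.
  by rewrite /birkhoff mean_sum// => i; exact: unif_cont_shift.
have meanN f : unif_cont f -> mean nu (f \o iter N th) = mean nu f.
  move=> uf; rewrite [RHS](@mean_mixture _ _ _ 'I_1 (fun=> 1) (fun=> nu) (fun=> iter N th))//.
  - by rewrite big_ord_recl big_ord0 mul1r addr0.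
  - by rewrite sumr_const card_ord.
  - by move=> _ n; exists (N + n)%N => x y; exact: agree_shift.
  - by move=> B fB; rewrite big_ord_recl big_ord0 mul1r addr0 nuN.
have meanS n : mean nu (birkhoff phi (n * N)) = n%:R * mean nu (birkhoff phi N).
  elim: n => [|n IH].
    rewrite mul0r -[RHS](mean_cst nu); congr mean; apply/funext => x.
    by rewrite /birkhoff big_ord0.
  rewrite -natr1 mulrDl mul1r -IH -(meanN (birkhoff phi (n * N)))// addrC -meanD//; last first.
    exact: unif_cont_shift.
  by congr mean; apply/funext => x; rewrite mulSn birkhoffD.
have HE : block_entropy eta (k.+1 * N) >= shannon nu (block_word N k).
  (* Whatever the phase i < N, a window of (k + 1) N letters starting at i contains the k blocks
     that start at N; those have the same law as the first k. *)
  have H1 (i : 'I_N) : shannon nu (block_word N k) <= shannon nu (word (k.+1 * N) \o iter i th).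
    have <- : shannon nu (block_word N k \o iter N th) = shannon nu (block_word N k : X -> _).
      rewrite /shannon; congr (- _); apply: eq_bigr => s _.
      have -> // : law nu (block_word N k \o iter N th) s = law nu (block_word N k : X -> _) s.
      apply: (nuN (block_word N k @^-1` [set s])); exists (k * N)%N => x y /fbw /=.
      by move=> ->.
    apply: shannon_determined; [exact: rv_shift|apply: rv_shift; exact: rv_word|].
    move=> x y /eq_word xy; apply/(block_wordP N0) => j jk; rewrite !iter_shiftE.
    have := xy (N + j - i)%N; rewrite !iter_shiftE subnKC; last first.
      by rewrite (leq_trans (ltnW (ltn_ord i)))// leq_addr.
    apply; rewrite mulSn; apply: leq_ltn_trans (leq_subr _ _) _.
    by rewrite ltn_add2l.
  (* With the averaging below this is concavity of entropy: the cross entropy against the averaged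
     law dominates each entropy. The averaged law is at least 1 / N times each shifted law, which
     gives absolute continuity. *)
  have H2 (i : 'I_N) : shannon nu (word (k.+1 * N) \o iter i th) <=
     \sum_w law nu (word (k.+1 * N) \o iter i th) w * - ln (law eta (word (k.+1 * N)) w).
    have rw : rv (word (k.+1 * N) \o iter i th) by apply: rv_shift; exact: rv_word.
    have le_law w : N%:R^-1 * law nu (word (k.+1 * N) \o iter i th) w <= law eta (word (k.+1 * N)) w.
      rewrite {2}/law etaE; last exact: rv_word.
      rewrite (bigD1 i)//= lerDl sumr_ge0// => j _.
      by rewrite mulr_ge0 ?invr_ge0// pr_ge0.
    have N1 : 0 < (N%:R : R)^-1 by rewrite invr_gt0 ltr0n.
    have := @gibbs_inequality R _ (law nu (word (k.+1 * N) \o iter i th))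
      (law eta (word (k.+1 * N))) (fun w => law_ge0 _ _ _) (fun w => law_ge0 _ _ _)
      (fun w pw => lt_le_trans (mulr_gt0 N1 pw) (le_law w)).
    rewrite !sum_law//; last exact: rv_word.
    rewrite subrr shannonE => H; rewrite -subr_ge0 -sumrB -oppr_le0 -sumrN.
    apply: le_trans H; apply: ler_sum => w _.
    by rewrite le_eqVlt; apply/orP; left; apply/eqP; ring.
  apply: le_trans (_ : \sum_(i < N) N%:R^-1 * shannon nu (word (k.+1 * N) \o iter i th) <= _).
    rewrite -[leLHS]mul1r -[X in X * _](_ : \sum_(i < N) N%:R^-1 = 1 :> R); last first.
      by rewrite sumr_const card_ord -[LHS]mulr_natr mulVf// pnatr_eq0 -lt0n.
    by rewrite big_distrl/=; apply: ler_sum => i _; rewrite ler_wpM2l// invr_ge0.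
  apply: le_trans (ler_sum _ (fun i _ => ler_wpM2l _ (H2 i))) _; first by rewrite invr_ge0.
  rewrite /block_entropy shannonE.
  under eq_bigr do rewrite big_distrr/=.
  rewrite exchange_big/= le_eqVlt; apply/orP; left; apply/eqP; apply: eq_bigr => w _.
  rewrite [X in _ = X * _]/law etaE; last exact: rv_word.
  by rewrite big_distrl/=; apply: eq_bigr => i _; rewrite mulrA.
(* Minus the logarithm of the product law, so that its mean is the entropy of k blocks. *)
pose c (s : k.-tuple (N.-tuple A)) : R := \sum_(b <- s) (ln Z - t * birkhoff phi N (ext hA b)).
have shE : shannon nu (block_word N k) = mean nu (c \o block_word N k).
  rewrite shannonE (mean_fin_rv nu c (fbw k)); apply: eq_bigr => s _.
  rewrite lawE ln_prod// -sumrN; congr (_ * _); apply: eq_bigr => b _.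
  by rewrite /p ln_div ?posrE ?expR_gt0// expRK opprB.
have ceq x : c (block_word N k x) >= k%:R * (ln Z - `|t| * V) + - t * birkhoff phi (k * N) x.
  have -> : birkhoff phi (k * N) x = \sum_(j < k) birkhoff phi N (iter (j * N) th x).
    elim: (k) => [|n IH]; first by rewrite /birkhoff !big_ord0.
    by rewrite big_ord_recr/= -IH mulSn addnC birkhoffD.
  rewrite /c big_tuple mulr_natl -[X in _ *+ X]card_ord -sumr_const big_distrr -big_split/=.
  apply: ler_sum => j _; rewrite tnth_mktuple.
  have := birkhoff_oscZ t (@agree_ext _ _ N (iter (j * N) th x)).
  by rewrite /= ler_norml => /andP[]; lra.
rewrite mE mulrCA -meanS; apply: le_trans (lerD HE (lexx _)); rewrite shE.
rewrite -lerBlDr -[- (t * mean _ _)]mulNr -(meanZ nu (- t) (uS _)) -[X in X + _](mean_cst nu) -meanD//; first last.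
- exact: unif_contZ.
- exact: unif_cont_cst.
apply: mean_le => //.
- by apply: unif_contD; [exact: unif_cont_cst|exact: unif_contZ].
- exact: unif_cont_fin_rv (fbw k).
Qed.

(** By [entropy_ge] it is enough to bound every increment from below. An increment that is too small
    would, by concavity, make word entropies grow too slowly for [gibbs_block_measure]: the deficit
    [g] per block exceeds the bounded term [C] in the end. *)
Lemma pressure_ge t n : (0 < n)%N ->
  (((ln (partition_function t n) - `|t| * V) / n%:R)%:E <=
   pressure (fun x => (t * phi x)%R))%E.
Proof.
move=> n0; have [eta [inv etaP]] := gibbs_block_measure t n0.
apply: (@le_trans _ _ (entropy eta + \int[eta]_x (t * phi x)%:E)%E); last first.
  by apply: ereal_sup_ubound; exists eta.
rewrite mean_phiZ -leeBlDr// -EFinB; apply: entropy_ge => // m.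
set c := ln _ - _ in etaP *.
have n0R : (0 : R) < n%:R by rewrite ltr0n.
rewrite lerBlDr ler_pdivrMr// leNgt; apply/negP => H.
set d := block_entropy_inc eta m in H.
pose g := c - (d + t * mean eta phi) * n%:R.
have g0 : 0 < g by rewrite subr_gt0.
pose C := block_entropy eta m + n%:R * d.
have [k kC] : exists k : nat, C / g < k%:R.
  by exists (Num.trunc (C / g)).+1; exact: truncnS_gt.
(* Using k + m keeps the length of the words above m, where all increments are at most [d]. *)
have := etaP (k + m)%N; rewrite leNgt => /negP; apply.
have d0 : 0 <= d := block_entropy_inc_ge0 eta m.
have := block_entropy_add_le m ((k + m).+1 * n - m) inv.
rewrite subnKC; last first.
  by rewrite mulSn (leq_trans _ (leq_addl _ _))// (leq_trans (leq_addl k m))// leq_pmulr.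
have : ((k + m).+1 * n - m)%:R * d <= ((k + m).+1 * n)%:R * d.
  by rewrite ler_wpM2r// ler_nat leq_subr.
rewrite -/d natrM -[(k + m).+1%:R]natr1.
have : C < (k + m)%:R * g.
  rewrite -ltr_pdivrMr//; apply: lt_le_trans kC _; by rewrite ler_nat leq_addr.
rewrite /C /g; set K := (k + m)%:R.
move: (block_entropy eta _) => E1; move: (block_entropy eta _) => E2.
move: (mean eta phi) => me h1 h2 h3.
have -> : K * (t * (n%:R * me)) = K * (t * me * n%:R) by ring.
have -> : K * c = K * (c - (d + t * me) * n%:R) + K * (d * n%:R) + K * (t * me * n%:R) by ring.
have h2' : ((K + 1) * n%:R) * d = K * (d * n%:R) + n%:R * d by ring.
lra.
Qed.

End pressure_estimates.

Lemma le_of_linear_growth (R : realType) (a b K : R) :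
  (forall n, (0 < n)%N -> n%:R * a <= n%:R * b + K) -> a <= b.
Proof.
move=> H; rewrite leNgt; apply/negP => ba.
have d0 : 0 < a - b by rewrite subr_gt0.
pose n := (Num.trunc (`|K| / (a - b))).+1.
have := truncnS_gt (`|K| / (a - b)); rewrite -/n ltr_pdivrMr// => Kn.
have := H n isT; have := ler_norm K; move: Kn; lra.
Qed.

Lemma ln_leD (R : realType) (a b d : R) : 0 < a -> 0 < b -> a <= b * expR d ->
  ln a <= ln b + d.
Proof.
move=> a0 b0 ab; rewrite -[d]expRK -lnM ?posrE ?expR_gt0//.
by rewrite ler_ln ?posrE// mulr_gt0// expR_gt0.
Qed.

(** * The pressure function of a normalized potential *)

Section normalized_potential.
Context (R : realType) (A : finType) (hA : (1 < #|A|)%N).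
Local Notation X := (full_shift hA).
Local Notation th := (@left_shift A hA).
Implicit Types (eta nu : probability X R) (x y : X) (n m k : nat).
Context (phi : X -> R) (v : nat -> R) (V : R).
Hypotheses (osc_phi : forall n, osc_le n phi (v n))
  (v_ge0 : forall n, 0 <= v n) (v_sum : forall n, \sum_(i < n) v i <= V)
  (phi_norm : normalized phi).

Lemma prepend_shift x : prepend (x 0%N) (th x) = x.
Proof. by apply/funext => -[]. Qed.

Lemma phi_lower_bound : exists2 B : R, 0 < B & forall x, - B <= phi x.
Proof.
exists (`|phi point| + v 0 + 1) => [|x].
  by rewrite ltr_wpDl// addr_ge0.
have : `|phi x - phi point| <= v 0 by exact: osc_phi.
by rewrite ler_norml => /andP[+ _]; have := ler_norm (- phi point); rewrite normrN; lra.
Qed.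

(** There are at least two letters: in the normalization at [th x] a letter other than [x 0] takes a
    weight of at least exp (- B). *)
Lemma phi_upper_bound : exists2 c : R, 0 < c & forall x, phi x <= - c.
Proof.
have [B B0 phiB] := phi_lower_bound.
have H x : expR (phi x) <= 1 - expR (- B).
  rewrite lerBrDr -(phi_norm (th x)) (bigD1 (x 0%N))//= prepend_shift lerD2l.
  have /card_gt1P[a [b [_ _ ab]]] := hA.
  have [c cx] : exists c, c != x 0%N.
    by have [<-|] := eqVneq a (x 0%N); [exists b; rewrite eq_sym|exists a].
  rewrite (bigD1 c)//=; apply: le_trans (_ : expR (phi (prepend c (th x))) <= _).
    by rewrite ler_expR.
  by rewrite lerDl sumr_ge0// => d _; exact: expR_ge0.
have e1 : 0 < 1 - expR (- B) by apply: lt_le_trans (H point); exact: expR_gt0.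
exists (- ln (1 - expR (- B))) => [|x].
  by rewrite oppr_gt0 ln_lt0// e1/= ltrBlDr ltrDl expR_gt0.
by rewrite opprK -ler_expR lnK ?posrE.
Qed.

Definition pressure_fun (t : R) : R := fine (pressure (fun x => t * phi x)).

Lemma pressure_funE t : pressure (fun x => t * phi x) = (pressure_fun t)%:E.
Proof.
rewrite /pressure_fun fineK// fin_real//.
rewrite (lt_le_trans (ltNyr _) (pressure_ge osc_phi v_ge0 v_sum t (ltn0Sn 0)))/=.
exact: (le_lt_trans (pressure_le osc_phi v_ge0 v_sum t (ltn0Sn 0)) (ltry _)).
Qed.

Lemma pressure_asymptotics t n : (0 < n)%N ->
  `|ln (partition_function phi t n) - n%:R * pressure_fun t| <= `|t| * V.
Proof.
move=> n0; have n0R : (0 : R) < n%:R by rewrite ltr0n.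
have := pressure_le osc_phi v_ge0 v_sum t n0.
have := pressure_ge osc_phi v_ge0 v_sum t n0.
rewrite pressure_funE !lee_fin ler_pdivrMr// ler_pdivlMr// mulrC => H1 H2.
by rewrite ler_norml; apply/andP; split; lra.
Qed.

Lemma birkhoff_le_const (c : R) n x : (forall x, phi x <= c) ->
  birkhoff phi n x <= n%:R * c.
Proof.
move=> H; rewrite /birkhoff mulr_natl -[X in _ *+ X]card_ord -sumr_const.
by apply: ler_sum => i _.
Qed.

Lemma birkhoff_ge_const (c : R) n x : (forall x, c <= phi x) ->
  n%:R * c <= birkhoff phi n x.
Proof.
move=> H; rewrite /birkhoff mulr_natl -[X in _ *+ X]card_ord -sumr_const.
by apply: ler_sum => i _.
Qed.

Lemma pressure_fun_le (c t s : R) : (forall x, phi x <= c) -> 0 <= s ->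
  pressure_fun (t + s) <= pressure_fun t + s * c.
Proof.
move=> phic s0; apply: (@le_of_linear_growth _ _ _ (`|t| * V + `|t + s| * V)) => n n0.
have := pressure_asymptotics t n0; have := pressure_asymptotics (t + s) n0.
have : ln (partition_function phi (t + s) n) <= ln (partition_function phi t n) + n%:R * (s * c).
  have Z0 := partition_function_gt0 phi t n.
  have Z1 := partition_function_gt0 phi (t + s) n.
  apply: ln_leD => //.
  rewrite /partition_function big_distrl/=; apply: ler_sum => w _.
  rewrite -expRD ler_expR mulrDl lerD2l mulrCA ler_wpM2l//.
  exact: birkhoff_le_const.
rewrite !ler_norml => h1 /andP[h2 h3] /andP[h4 h5].
rewrite mulrDr; lra.
Qed.

Lemma pressure_fun_ge (c t s : R) : (forall x, c <= phi x) -> 0 <= s ->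
  pressure_fun t + s * c <= pressure_fun (t + s).
Proof.
move=> phic s0; apply: (@le_of_linear_growth _ _ _ (`|t| * V + `|t + s| * V)) => n n0.
have := pressure_asymptotics t n0; have := pressure_asymptotics (t + s) n0.
have : ln (partition_function phi t n) <= ln (partition_function phi (t + s) n) + - (n%:R * (s * c)).
  have Z0 := partition_function_gt0 phi t n.
  have Z1 := partition_function_gt0 phi (t + s) n.
  apply: ln_leD => //; rewrite expRN ler_pdivlMr ?expR_gt0//.
  rewrite /partition_function big_distrl/=; apply: ler_sum => w _.
  rewrite -expRD ler_expR mulrDl lerD2l mulrCA ler_wpM2l//.
  exact: birkhoff_ge_const.
rewrite !ler_norml => h1 /andP[h2 h3] /andP[h4 h5].
rewrite mulrDr; lra.
Qed.

Definition cat_word (w : seq A) x : X := foldr (@prepend A hA) x w.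

Lemma shift_cat_word w x : iter (size w) th (cat_word w x) = x.
Proof. by elim: w => // a w IH; rewrite /= -iterS iterSr. Qed.

Lemma cat_wordE w x i : cat_word w x i =
  if (i < size w)%N then nth (enum_val (Ordinal (ltnW hA))) w i else x (i - size w)%N.
Proof.
by elim: w i => [|a w IH] [|i] //=.
Qed.

Lemma agree_cat_word n (w : n.-tuple A) x : agree n (cat_word w x) (ext hA w).
Proof. by move=> i ilt; rewrite cat_wordE size_tuple ilt. Qed.

(** The n-th iterate of the transfer operator of [phi] fixes the constant 1. *)
Lemma sum_cat_word n x : \sum_(w : n.-tuple A) expR (birkhoff phi n (cat_word w x)) = 1.
Proof.
elim: n => [|n IH].
  rewrite (big_pred1 [tuple]) => [|w]; last by apply/esym/eqP; exact: tuple0.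
  by rewrite /birkhoff big_ord0 expR0.
rewrite (reindex (fun aw : A * n.-tuple A => [tuple of aw.1 :: aw.2]))/=; last first.
  exists (fun t : n.+1.-tuple A => (thead t, [tuple of behead t])).
    by move=> [a w] _; congr (_, _); apply/val_inj.
  by move=> t _; rewrite [RHS]tuple_eta; apply/val_inj.
rewrite -(pair_bigA _ (fun a (w : n.-tuple A) => expR (birkhoff phi n.+1 (cat_word [tuple of a :: w] x))))/=.
rewrite exchange_big/= -[RHS]IH; apply: eq_bigr => w _.
under eq_bigr do rewrite birkhoffS expRD.
rewrite (eq_bigr (fun a => expR (phi (prepend a (cat_word w x))) * expR (birkhoff phi n (cat_word w x)))).
  by rewrite -big_distrl/= phi_norm mul1r.
by move=> a _; congr (_ * expR (birkhoff phi n _)); apply/funext => -[].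
Qed.

(** By bounded distortion Z_n(1) differs from the sum in [sum_cat_word], which is 1, by a factor at
    most exp V either way. *)
Lemma pressure_fun1 : pressure_fun 1 = 0.
Proof.
have H n : `|ln (partition_function phi 1 n)| <= V.
  have Z0 := partition_function_gt0 phi 1 n.
  have S1 := sum_cat_word n point.
  have D (w : n.-tuple A) := birkhoff_osc osc_phi v_ge0 v_sum (@agree_cat_word n w point).
  rewrite ler_norml; apply/andP; split.
    rewrite -ler_expR lnK ?posrE// -[leLHS]mul1r -[X in X * _]S1 big_distrl/=.
    apply: ler_sum => w _; rewrite -expRD ler_expR mul1r.
    by have := D w; rewrite ler_norml => /andP[]; lra.
  rewrite -ler_expR lnK ?posrE// -[leRHS]mul1r -[X in X * _]S1 big_distrl/=.
  apply: ler_sum => w _; rewrite -expRD ler_expR mul1r.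
  by have := D w; rewrite ler_norml => /andP[]; lra.
apply/eqP; rewrite eq_le; apply/andP; split;
  apply: (@le_of_linear_growth _ _ _ (V + `|1| * V)) => n n0;
  have := pressure_asymptotics 1 n0; have := H n; rewrite !ler_norml;
  move=> /andP[h2 h3] /andP[h4 h5]; lra.
Qed.

Definition max_mean : R := fine (max_integral phi).

Let uphi : unif_cont phi := unif_cont_phi osc_phi v_ge0 v_sum.

Lemma max_meanE : max_integral phi = max_mean%:E.
Proof.
rewrite /max_mean fineK//.
have [B B0 phiB] := phi_lower_bound; have [c c0 phic] := phi_upper_bound.
have [eta [inv _]] := @periodic_measure R A hA [:: (point : X) 0%N] isT.
rewrite fin_real//; apply/andP; split.
  apply: lt_le_trans (ltNyr (mean eta phi)) _.
  by apply: ereal_sup_ubound; exists eta; rewrite ?integral_mean.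
apply: le_lt_trans (ltry (- c)); apply: ub_ereal_sup => _ [nu invnu <-].
rewrite integral_mean// lee_fin -(mean_cst nu (- c)).
by apply: mean_le => //; exact: unif_cont_cst.
Qed.

Lemma mean_le_max eta : invariant_measures hA eta -> mean eta phi <= max_mean.
Proof.
move=> inv; rewrite -lee_fin -max_meanE -integral_mean//.
by apply: ereal_sup_ubound; exists eta.
Qed.

Lemma max_mean_le (c : R) : (forall x, phi x <= c) -> max_mean <= c.
Proof.
move=> phic; rewrite -lee_fin -max_meanE; apply: ub_ereal_sup => _ [nu invnu <-].
rewrite integral_mean// lee_fin -(mean_cst nu c).
by apply: mean_le => //; exact: unif_cont_cst.
Qed.

Lemma birkhoff_periodic_le (s : seq A) :
  birkhoff phi (size s) (periodic_point hA s) <= (size s)%:R * max_mean.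
Proof.
have [s0|s0] := posnP (size s); first by rewrite s0 /birkhoff big_ord0 mul0r.
have [eta [inv etaE]] := @periodic_measure R A hA s s0.
have := mean_le_max inv; rewrite etaE// ler_pdivrMl// ltr0n//.
Qed.

(** The periodic point that repeats the first n letters of [x] shadows [x] up to V, and its orbit
    carries an invariant measure. *)
Lemma birkhoff_le_max n x : birkhoff phi n x <= n%:R * max_mean + V.
Proof.
have := birkhoff_periodic_le (word n x); rewrite size_tuple.
have /(birkhoff_osc osc_phi v_ge0 v_sum) : agree n x (periodic_point hA (word n x)).
  move=> i ilt; rewrite /periodic_point size_tuple modn_small//.
  by rewrite -[i]/(val (Ordinal ilt)) -tnth_nth tnth_word.
by rewrite ler_norml => /andP[]; lra.
Qed.

(** Some point has a Birkhoff average at least the maximal integral minus e / 2. Repeating its first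
    n letters costs at most V, and n is chosen with V < n e / 2. *)
Lemma periodic_near_max (e : R) : 0 < e -> exists2 s : seq A, (0 < size s)%N &
  (size s)%:R * (max_mean - e) <= birkhoff phi (size s) (periodic_point hA s).
Proof.
move=> e0; have e2 : 0 < e / 2 by rewrite divr_gt0.
have [eta inv etaM] : exists2 eta, invariant_measures hA eta & max_mean - e / 2 < mean eta phi.
  have : ((max_mean - e / 2)%:E < max_integral phi)%E.
    by rewrite max_meanE lte_fin ltrBlDr ltrDl.
  move=> /ereal_sup_gt[_ [eta inv <-]]; rewrite integral_mean// lte_fin => H.
  by exists eta.
pose n := (Num.trunc (V / (e / 2))).+1.
have n0 : (0 : R) < n%:R by rewrite ltr0n.
have nV : V < n%:R * (e / 2) by rewrite -ltr_pdivrMr// truncnS_gt.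
have [x xP] : exists x, n%:R * (max_mean - e / 2) <= birkhoff phi n x.
  apply: contrapT => N.
  have : mean eta (birkhoff phi n) <= n%:R * (max_mean - e / 2).
    rewrite -[leRHS](mean_cst eta); apply: mean_le.
    - exact: unif_cont_birkhoff.
    - exact: unif_cont_cst.
    - by move=> x; rewrite leNgt; apply/negP => H; apply: N; exists x; exact: ltW.
  by rewrite mean_birkhoff// ler_pM2l// leNgt etaM.
exists (word n x); rewrite size_tuple//.
have /(birkhoff_osc osc_phi v_ge0 v_sum) : agree n x (periodic_point hA (word n x)).
  move=> i ilt; rewrite /periodic_point size_tuple modn_small//.
  by rewrite -[i]/(val (Ordinal ilt)) -tnth_nth tnth_word.
by rewrite ler_norml => /andP[]; lra.
Qed.

(** In exp (2 S_n phi) one factor is at most exp (n M + V) and the other sums to a quantity of rate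
    P(phi) = 0. This inequality is the origin of q* >= -1. *)
Lemma pressure_fun2 : pressure_fun 2 <= max_mean.
Proof.
apply: (@le_of_linear_growth _ _ _ (`|2| * V + V + `|1| * V)) => n n0.
have := pressure_asymptotics 1 n0; have := pressure_asymptotics 2 n0.
have : ln (partition_function phi 2 n) <= ln (partition_function phi 1 n) + (n%:R * max_mean + V).
  have Z0 := partition_function_gt0 phi 1 n.
  have Z1 := partition_function_gt0 phi 2 n.
  apply: ln_leD => //.
  rewrite /partition_function big_distrl/=; apply: ler_sum => w _.
  rewrite -expRD ler_expR; have := birkhoff_le_max n (ext hA w); lra.
rewrite pressure_fun1 !ler_norml => h1 /andP[h2 h3] /andP[h4 h5]; lra.
Qed.

Lemma pressure_fun_decr (s t : R) : s < t -> pressure_fun t < pressure_fun s.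
Proof.
move=> st; have [c c0 phic] := phi_upper_bound.
have ts : 0 < t - s by rewrite subr_gt0.
have := pressure_fun_le s phic (ltW ts); rewrite addrC subrK mulrN.
by have := mulr_gt0 ts c0; lra.
Qed.

Lemma pressure_fun_cont : continuous pressure_fun.
Proof.
have [B B0 phiB] := phi_lower_bound.
have lip (s t : R) : s <= t -> `|pressure_fun s - pressure_fun t| <= B * `|s - t|.
  rewrite le_eqVlt => /predU1P[->|st]; first by rewrite !subrr !normr0 mulr0.
  have ts : 0 < t - s by rewrite subr_gt0.
  have := pressure_fun_ge s phiB (ltW ts); rewrite addrC [s + _]addrC subrK mulrN.
  have := pressure_fun_decr st => h1 h2.
  by rewrite gtr0_norm ?subr_gt0// ltr0_norm ?subr_lt0// opprB mulrC; lra.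
have lip' (s t : R) : `|pressure_fun s - pressure_fun t| <= B * `|s - t|.
  have [/lip//|/ltW/lip] := leP s t; by rewrite distrC [`|t - s|]distrC.
move=> t; apply/cvgrPdist_le => e e0; near=> s.
apply: le_trans (lip' t s) _; rewrite mulrC -ler_pdivlMr//.
near: s; apply: cvgr_dist_le; [exact: cvg_id|exact: divr_gt0].
Unshelve. all: by end_near. Qed.

(** Here t = 1 - q, so that [ts] is 1 - q* and ]1, 2] corresponds to [-1, 0[. The intermediate value
    theorem gives existence, strict monotonicity the two sides. *)
Lemma critical_exponent : exists ts : R, [/\ 1 < ts <= 2, pressure_fun ts = max_mean,
  forall t, t <= ts -> max_mean <= pressure_fun t &
  forall t, ts < t -> pressure_fun t < max_mean].
Proof.
have [c c0 phic] := phi_upper_bound.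
have M0 : max_mean < 0 by apply: le_lt_trans (max_mean_le phic) _; rewrite oppr_lt0.
have M12 : Num.min (pressure_fun 1) (pressure_fun 2) <= max_mean <=
    Num.max (pressure_fun 1) (pressure_fun 2).
  by rewrite pressure_fun1 ge_min pressure_fun2 orbT/= le_max ltW.
have h12 : (1 : R) <= 2 by rewrite ler1n.
have [ts] := IVT h12 (continuous_subspaceT pressure_fun_cont) M12.
rewrite in_itv/= => /andP[t1 t2] tsM; exists ts; split => //.
- rewrite t2 andbT lt_neqAle t1 andbT; apply/eqP => E.
  by move: M0; rewrite -tsM -E pressure_fun1 ltxx.
- move=> t; rewrite le_eqVlt => /predU1P[->|/pressure_fun_decr]; first by rewrite tsM.
  by rewrite tsM => /ltW.
- by move=> t /pressure_fun_decr; rewrite tsM.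
Qed.

End normalized_potential.

(** * Gibbs property of the equilibrium state *)

Section pinsker.
Context (R : realType).

(* Pinsker's inequality with a worse constant, through the Hellinger distance. *)
Lemma total_variation_le (T : finType) (p q : T -> R) (s : R) : 0 < s ->
  (forall t, 0 <= p t) -> (forall t, 0 <= q t) -> (forall t, 0 < p t -> 0 < q t) ->
  \sum_t p t = 1 -> \sum_t q t = 1 ->
  \sum_t p t * (ln (p t) - ln (q t)) <= s ^+ 2 ->
  \sum_t `|p t - q t| <= 3 * s.
Proof.
move=> s0 p0 q0 pq p1 q1 H.
pose a t := Num.sqrt (p t); pose b t := Num.sqrt (q t).
have aE t : a t ^+ 2 = p t by rewrite sqr_sqrtr.
have bE t : b t ^+ 2 = q t by rewrite sqr_sqrtr.
have a0 t : 0 <= a t by exact: sqrtr_ge0.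
have b0 t : 0 <= b t by exact: sqrtr_ge0.
(* Relative entropy dominates the squared Hellinger distance, by ln r <= r - 1 at r = b / a. *)
have D : \sum_t (a t - b t) ^+ 2 <= s ^+ 2.
  apply: le_trans H.
  have -> : \sum_t (a t - b t) ^+ 2 = \sum_t (2 * p t - 2 * (a t * b t)).
    transitivity (\sum_t ((2 * p t - 2 * (a t * b t)) + (q t - p t))).
      by apply: eq_bigr => t _; rewrite -aE -bE; ring.
    by rewrite big_split/= [X in _ + X]sumrB p1 q1 subrr addr0.
  apply: ler_sum => t _.
  have [pt|] := ltP 0 (p t); last first.
    move=> ple; have pt0 : p t = 0 by [apply/eqP; rewrite eq_le ple p0].
    by rewrite /a pt0 sqrtr0 mul0r !mulr0 mul0r subr0.
  have qt := pq _ pt.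
  have at0 : 0 < a t by rewrite sqrtr_gt0.
  have bt0 : 0 < b t by rewrite sqrtr_gt0.
  have -> : ln (p t) - ln (q t) = - 2 * ln (b t / a t).
    by rewrite -aE -bE ln_div ?posrE// !lnXn// !mulr2n; ring.
  have L : ln (b t / a t) <= b t / a t - 1.
    have := @le_ln1Dx R (b t / a t - 1).
    rewrite [1 + _]addrC subrK; apply.
    by rewrite ltrBrDl subrr divr_gt0.
  rewrite -subr_ge0.
  have -> : p t * (- 2 * ln (b t / a t)) - (2 * p t - 2 * (a t * b t)) =
    2 * p t * ((b t / a t - 1) - ln (b t / a t)).
    by rewrite -aE; field; rewrite gt_eqF.
  by rewrite mulr_ge0 ?subr_ge0// mulr_ge0.
(* Here |p - q| = |a - b| (a + b), and the product is split by the arithmetic-geometric inequality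
   with weight s. The two sums are at most s / 2 and 2 s. *)
apply: le_trans (_ : \sum_t ((2 * s)^-1 * (a t - b t) ^+ 2 + s * (p t + q t)) <= _).
  apply: ler_sum => t _.
  have -> : p t - q t = (a t - b t) * (a t + b t) by rewrite -aE -bE; ring.
  rewrite normrM [`|a t + b t|]ger0_norm ?addr_ge0//.
  have h1 : (a t + b t) ^+ 2 <= 2 * (p t + q t).
    by rewrite -aE -bE -subr_ge0; have := sqr_ge0 (a t - b t); rewrite !sqrrB !sqrrD; lra.
  have h2 : `|a t - b t| * (a t + b t) <= (2 * s)^-1 * (a t - b t) ^+ 2 + s / 2 * (a t + b t) ^+ 2.
    rewrite -[(a t - b t) ^+ 2]real_normK ?num_real//.
    set x := `|_|; set y := a t + b t.
    rewrite -subr_ge0.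
    have -> : (2 * s)^-1 * x ^+ 2 + s / 2 * y ^+ 2 - x * y = (2 * s)^-1 * (x - s * y) ^+ 2.
      by field; rewrite gt_eqF.
    by rewrite mulr_ge0 ?sqr_ge0// invr_ge0 mulr_ge0// ltW.
  apply: le_trans h2 _; rewrite lerD2l; have := ler_wpM2l (ltW s0) h1; lra.
rewrite big_split/= -!big_distrr/= big_split/= p1 q1.
have s2 : 0 < 2 * s by rewrite mulr_gt0.
apply: le_trans (_ : (2 * s)^-1 * s ^+ 2 + s * (1 + 1) <= _).
  by rewrite lerD2r ler_pM2l ?invr_gt0.
have -> : (2 * s)^-1 * s ^+ 2 = s / 2 by field; rewrite gt_eqF.
lra.
Qed.

End pinsker.

(** * Measures of cylinders *)

Section cylinders.
Context (R : realType) (A : finType) (hA : (1 < #|A|)%N).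
Local Notation X := (full_shift hA).
Local Notation th := (@left_shift A hA).
Implicit Types (x y : X) (n m k : nat) (w u : seq A).
Context (mu : probability X R) (mu_inv : invariant_measures hA mu).

Lemma val_word n x : word n x = mkseq x n :> seq A.
Proof.
apply: (@eq_from_nth _ (x 0%N)); rewrite ?size_tuple ?size_mkseq// => i ilt.
by rewrite nth_mkseq// -[i]/(val (Ordinal ilt)) -tnth_nth tnth_word.
Qed.

Lemma mkseqD m n x : mkseq x (m + n) = mkseq x m ++ mkseq (iter m th x) n.
Proof.
rewrite /mkseq iotaD map_cat add0n; congr (_ ++ _).
rewrite -[m in iota m n]addn0 iotaDl -map_comp; apply: eq_map => i /=.
by rewrite iter_shiftE.
Qed.

Definition cyl w : set X := [set x | mkseq x (size w) = w].

Lemma cyl_tuple n (w : n.-tuple A) : cyl w = word n @^-1` [set w].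
Proof.
apply/seteqP; split => x /=; rewrite /cyl /= size_tuple.
  by move=> xw; apply/val_inj; rewrite /= val_word.
by move=> <-; rewrite val_word.
Qed.

Lemma finitary_cyl w : finitary (size w) (cyl w).
Proof.
move=> x y xy; rewrite /cyl /= => xw; rewrite -[RHS]xw; apply/eq_in_map => i; rewrite mem_iota add0n => /andP[_ ilt].
by rewrite (xy i ilt).
Qed.

Lemma measurable_cyl w : measurable (cyl w).
Proof. exact: finitary_measurable (@finitary_cyl w). Qed.

Lemma cyl_cat w u : cyl (w ++ u) = cyl w `&` iter (size w) th @^-1` cyl u.
Proof.
apply/seteqP; split => x /=; rewrite /cyl /= size_cat mkseqD.
  move=> /eqP; rewrite eqseq_cat ?size_mkseq// => /andP[/eqP -> /eqP ->]//.
by move=> [-> ->].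
Qed.

Definition cyl_pr w : R := pr mu (cyl w).

Lemma cyl_pr_ge0 w : 0 <= cyl_pr w.
Proof. exact: pr_ge0. Qed.

Lemma cyl_pr_nil : cyl_pr [::] = 1.
Proof. by rewrite /cyl_pr -(pr_setT mu); congr (pr mu _); apply/seteqP. Qed.

Lemma cyl_pr_tuple n (w : n.-tuple A) : cyl_pr w = law mu (word n) w.
Proof. by rewrite /cyl_pr cyl_tuple. Qed.

Lemma cyl_pr_cat n w : cyl_pr w = \sum_(u : n.-tuple A) cyl_pr (w ++ u).
Proof.
have rw : rv (word n \o iter (size w) th) by apply: rv_shift; exact: rv_word.
rewrite /cyl_pr (pr_partition mu rw (@measurable_cyl w)); apply: eq_bigr => u _.
by rewrite cyl_cat cyl_tuple.
Qed.

Lemma sum_cyl_pr n : \sum_(u : n.-tuple A) cyl_pr u = 1.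
Proof. by rewrite -cyl_pr_nil [RHS](cyl_pr_cat n). Qed.

Lemma cyl_pr_cat_le w u : cyl_pr (w ++ u) <= cyl_pr u.
Proof.
rewrite /cyl_pr cyl_cat -(pr_shift (size w) mu_inv (@measurable_cyl u)).
apply: pr_mono => [||x []//].
  by apply: measurableI; [exact: measurable_cyl|exact: (measurable_shift_preimage _ (@measurable_cyl u))].
exact: (measurable_shift_preimage _ (@measurable_cyl u)).
Qed.

Lemma cyl_cat_word w u x : cyl u x -> cyl (w ++ u) (cat_word w x).
Proof.
move=> ux; rewrite cyl_cat; split; last by rewrite /= shift_cat_word.
rewrite /cyl /=; apply: (@eq_from_nth _ (x 0%N)); rewrite size_mkseq// => i ilt.
by rewrite nth_mkseq// cat_wordE ilt; apply: set_nth_default.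
Qed.

Lemma agree_cyl w x y : cyl w x -> cyl w y -> agree (size w) x y.
Proof.
rewrite /cyl /= => xw yw i ilt.
by rewrite -(nth_mkseq (x 0%N) x ilt) xw -yw nth_mkseq.
Qed.

Lemma cyl_ext w : cyl w (ext hA w).
Proof.
rewrite /cyl /=; apply: (@eq_from_nth _ (enum_val (Ordinal (ltnW hA)))).
  by rewrite size_mkseq.
by move=> i; rewrite size_mkseq => ilt; rewrite nth_mkseq.
Qed.

End cylinders.

Section gibbs_property.
Context (R : realType) (A : finType) (hA : (1 < #|A|)%N).
Local Notation X := (full_shift hA).
Local Notation th := (@left_shift A hA).
Implicit Types (x y : X) (n m k : nat) (w u : seq A).
Context (phi : X -> R) (v : nat -> R) (V : R).
Hypotheses (osc_phi : forall n, osc_le n phi (v n))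
  (v_ge0 : forall n, 0 <= v n) (v_sum : forall n, \sum_(i < n) v i <= V)
  (phi_norm : normalized phi).
Context (mu : probability X R) (mu_eq : equilibrium_state phi mu).
Local Notation m := (cyl_pr mu).

Let mu_inv : invariant_measures hA mu := mu_eq.1.
Let uphi : unif_cont phi := unif_cont_phi osc_phi v_ge0 v_sum.

(** The pressure of [phi] is 0 and every increment dominates the entropy. This is the form in which
    the maximality of [mu] is used. *)
Lemma equilibrium_inc n : 0 <= block_entropy_inc mu n + mean mu phi.
Proof.
rewrite -lee_fin EFinD -integral_mean//.
apply: le_trans (leeD2r _ (entropy_le_inc n mu_inv)).
rewrite mu_eq.2.
have -> : phi = (fun x => 1 * phi x) by apply/funext => x; rewrite mul1r.
rewrite (pressure_funE osc_phi v_ge0 v_sum) (pressure_fun1 osc_phi v_ge0 v_sum)//.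
Qed.

(* The word t of length n + 1 gets the weight that the Gibbs property would give
   it from its tail; normalization of phi makes these weights a probability. *)
Definition step_weight n (t : n.+1.-tuple A) : R :=
  expR (phi (prepend (thead t) (ext hA (behead t)))) * m (behead t).

Lemma sum_tupleS n (F : n.+1.-tuple A -> R) :
  \sum_t F t = \sum_(u : n.-tuple A) \sum_a F [tuple of a :: u].
Proof.
rewrite (reindex (fun aw : A * n.-tuple A => [tuple of aw.1 :: aw.2]))/=; last first.
  exists (fun t : n.+1.-tuple A => (thead t, [tuple of behead t])).
    by move=> [a w] _; congr (_, _); apply/val_inj.
  by move=> t _; rewrite [RHS]tuple_eta; apply/val_inj.
rewrite -(pair_bigA _ (fun a (w : n.-tuple A) => F [tuple of a :: w]))/=.
by rewrite exchange_big.
Qed.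

Lemma sum_step_weight n : \sum_t @step_weight n t = 1.
Proof.
rewrite sum_tupleS -(sum_cyl_pr mu n); apply: eq_bigr => u _.
transitivity (\sum_a expR (phi (prepend a (ext hA u))) * m u); first exact: eq_bigr.
by rewrite -big_distrl/= phi_norm mul1r.
Qed.

(** The relative entropy of the law of (n+1)-words with respect to [step_weight] is minus the
    increment minus the mean of [phi] read on words. By [equilibrium_inc] it is at most the error of
    that reading, [v n.+1]. *)
Lemma step_weight_tv n (s : R) : 0 < s -> v n.+1 <= s ^+ 2 ->
  \sum_(t : n.+1.-tuple A) `|m t - step_weight t| <= 3 * s.
Proof.
move=> s0 vs.
have q0 t : 0 <= @step_weight n t by rewrite mulr_ge0 ?expR_ge0 ?cyl_pr_ge0.
have mb (t : n.+1.-tuple A) : m t <= m (behead t).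
  by rewrite {1}[tval t](_ : _ = [:: thead t] ++ behead t) ?cyl_pr_cat_le// {1}[t]tuple_eta.
apply: total_variation_le => //.
- by move=> t; exact: cyl_pr_ge0.
- by move=> t mt; rewrite mulr_gt0 ?expR_gt0// (lt_le_trans mt).
- exact: sum_cyl_pr.
- exact: sum_step_weight.
apply: le_trans vs; have Hinc := equilibrium_inc n.
rewrite /block_entropy_inc in Hinc.
have fE x : phi (prepend (thead (word n.+1 x)) (ext hA (behead (word n.+1 x)))) =
    phi (cat_word (word n.+1 x) (ext hA [::])).
  congr phi; apply/funext => i; rewrite cat_wordE {3 4}[word n.+1 x]tuple_eta.
  by case: i => [|i] //=; rewrite ltnS; case: ltnP => // h; rewrite /ext nth_nil nth_default.
pose c (t : n.+1.-tuple A) := phi (prepend (thead t) (ext hA (behead t))).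
have fc x : `|phi x - c (word n.+1 x)| <= v n.+1.
  rewrite /c fE; apply: osc_phi; apply: agree_trans (@agree_ext _ _ n.+1 x) _.
  exact: agree_sym (agree_cat_word _ _).
have := mean_approx mu uphi (@fin_rv_word _ _ n.+1) fc.
rewrite ler_norml => /andP[_ Hmean].
have E1 : block_entropy mu n.+1 = - \sum_(t : n.+1.-tuple A) m t * ln (m t).
  by rewrite /block_entropy /shannon; congr (- _); apply: eq_bigr => t _; rewrite cyl_pr_tuple.
have E2 : block_entropy mu n = - \sum_(t : n.+1.-tuple A) m t * ln (m (behead t)).
  rewrite -[LHS](shannon_shift 1 mu_inv (@rv_word _ _ n)) /shannon; congr (- _).
  transitivity (\sum_t law mu ((fun t : n.+1.-tuple A => [tuple of behead t]) \o word n.+1) t * ln (m t)).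
    apply: eq_bigr => t _; rewrite cyl_pr_tuple law_shift//; last exact: rv_word.
    congr (_ * _); rewrite -(law_shift 1 t mu_inv (@rv_word _ _ n)); congr (law mu _ t).
    apply/funext => x; apply: eq_from_tnth => j; rewrite /= tnth_behead !tnth_word.
    by rewrite /left_shift inordK// ltnS ltn_ord.
  rewrite (sum_law_comp mu (fun t : n.+1.-tuple A => [tuple of behead t]) (fun t => ln (m t)) (@rv_word _ _ n.+1)).
  by apply: eq_bigr => t _; rewrite -cyl_pr_tuple.
have -> : \sum_(t : n.+1.-tuple A) m t * (ln (m t) - ln (step_weight t)) =
    \sum_(t : n.+1.-tuple A) m t * ln (m t) - \sum_(t : n.+1.-tuple A) m t * ln (m (behead t))
    - \sum_t law mu (word n.+1) t * c t.
  rewrite -!sumrB; apply: eq_bigr => t _; rewrite -cyl_pr_tuple.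
  have [m0|m0] := eqVneq (m t) 0; first by rewrite m0 !mul0r !subr0.
  have mt : 0 < m t by rewrite lt_neqAle eq_sym m0 cyl_pr_ge0.
  by rewrite /step_weight lnM ?posrE ?expR_gt0 ?(lt_le_trans mt)// expRK -/(c t); ring.
lra.
Qed.

(* The total variation bound at length n restricts to the extensions of a :: w;
   letting n grow turns it into a statement on w itself. *)
Lemma one_step_gibbs (a : A) (w : seq A) x : cyl w x ->
  expR (phi (prepend a x) - v (size w).+1) * m w <= m (a :: w) <=
  expR (phi (prepend a x) + v (size w).+1) * m w.
Proof.
move=> wx; set l := size w.
have key (s : R) : 0 < s -> exists k, \sum_(u : k.-tuple A)
   `|m (a :: w ++ u) - expR (phi (prepend a (ext hA (w ++ u)))) * m (w ++ u)| <= 3 * s.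
  move=> s0; have s2 : 0 < s ^+ 2 by rewrite exprn_gt0.
  have [n ln vn] := variation_small v_ge0 v_sum l.+1 s2.
  exists (n - l.+1)%N; set k := (n - l.+1)%N.
  have szu (u : k.-tuple A) : size (a :: w ++ u) == n by rewrite /= size_cat size_tuple -addSn subnKC.
  case: n ln vn k szu => // n ln vn k szu.
  have := step_weight_tv s0 (ltW vn); apply: le_trans.
  (* The words a :: w ++ u are distinct and of the same length, so the sum over [u] is a part of the
     total variation. *)
  pose h (u : k.-tuple A) : n.+1.-tuple A := Tuple (szu u).
  have hinj : injective h.
    by move=> u1 u2 /(congr1 val) /= [] /eqP; rewrite eqseq_cat// => /andP[_ /eqP /val_inj].
  apply: le_trans (_ : \sum_(t in [set h u | u in [set: k.-tuple A]]%SET) `|m t - step_weight t| <= _).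
    rewrite big_imset/=; last by move=> ? ? _ _; exact: hinj.
    rewrite le_eqVlt; apply/orP; left; apply/eqP.
    apply: eq_big => [u|u _]; first by rewrite inE.
    have -> : step_weight (h u) = expR (phi (prepend a (ext hA (w ++ u)))) * m (w ++ u).
      by rewrite /step_weight {1}/thead (tnth_nth a).
    by [].
  by rewrite big_mkcond/=; apply: ler_sum => t _; case: ifP.
have osc k (u : k.-tuple A) : `|phi (prepend a (ext hA (w ++ u))) - phi (prepend a x)| <= v l.+1.
  apply: osc_phi => -[|i] //=; rewrite ltnS => il.
  apply: (agree_cyl _ wx il); have := @cyl_ext _ hA (w ++ u).
  by rewrite cyl_cat => -[].
apply/andP; split; apply/ler_addgt0Pr => e e0;
  have s0 : 0 < e / 3 by [rewrite divr_gt0]; have [k kP] := key _ s0;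
  rewrite mulrCA mulfV ?mulr1// in kP;
  rewrite (cyl_pr_cat mu k w) -[a :: w]/([:: a] ++ w) (cyl_pr_cat mu k ([:: a] ++ w));
  rewrite big_distrr/= -lerBlDl -sumrB; apply: le_trans kP; apply: ler_sum => u _;
  have := osc k u; rewrite ler_norml => /andP[h1 h2].
- rewrite distrC; apply: le_trans (ler_norm _); rewrite lerD2r.
  by rewrite ler_wpM2r ?cyl_pr_ge0// ler_expR; lra.
- apply: le_trans (ler_norm _); rewrite lerD2l lerN2.
  by rewrite ler_wpM2r ?cyl_pr_ge0// ler_expR; lra.
Qed.

(** Adding the letters of [w] one at a time by [one_step_gibbs] costs variations of successive
    orders above the length of [u], with sum [W (size w)] at most V. The suffix [u] is kept for the
    sake of the quasi-Bernoulli property. *)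
Lemma gibbs_cat w u x : cyl u x ->
  expR (birkhoff phi (size w) (cat_word w x) - V) * m u <= m (w ++ u) <=
  expR (birkhoff phi (size w) (cat_word w x) + V) * m u.
Proof.
move=> ux.
pose W k := \sum_(i < k) v ((size u).+1 + i)%N.
have WV k : W k <= V.
  apply: le_trans (v_sum ((size u).+1 + k)); rewrite big_split_ord/= lerDr.
  exact: sumr_ge0.
suff /andP[h1 h2] : expR (birkhoff phi (size w) (cat_word w x) - W (size w)) * m u <= m (w ++ u) <=
    expR (birkhoff phi (size w) (cat_word w x) + W (size w)) * m u.
  apply/andP; split; [apply: le_trans h1|apply: le_trans h2 _].
    by rewrite ler_wpM2r ?cyl_pr_ge0// ler_expR lerD2l lerN2.
  by rewrite ler_wpM2r ?cyl_pr_ge0// ler_expR lerD2l.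
elim: w => [|a w /andP[IH1 IH2]].
  by rewrite /W /birkhoff !big_ord0 subr0 addr0 expR0 mul1r lexx.
have /= /andP[S1 S2] := one_step_gibbs a (cyl_cat_word w ux).
have WS : W (size w).+1 = W (size w) + v (size w + size u).+1.
  by rewrite /W big_ord_recr/= addSn [(size u + _)%N]addnC.
rewrite /= birkhoffS WS; apply/andP; split.
  apply: le_trans S1; rewrite size_cat.
  apply: le_trans (ler_wpM2l (expR_ge0 _) IH1); rewrite mulrA -expRD.
  rewrite ler_wpM2r ?cyl_pr_ge0// ler_expR.
  rewrite (_ : birkhoff phi (size w) (th _) = birkhoff phi (size w) (cat_word w x))//.
  lra.
apply: le_trans S2 _; rewrite size_cat.
apply: le_trans (ler_wpM2l (expR_ge0 _) IH2) _; rewrite mulrA -expRD.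
rewrite ler_wpM2r ?cyl_pr_ge0// ler_expR.
rewrite (_ : birkhoff phi (size w) (th _) = birkhoff phi (size w) (cat_word w x))//.
lra.
Qed.

Lemma cat_word_cylE w x : cyl w x -> cat_word w (iter (size w) th x) = x.
Proof.
move=> wx; apply/funext => i; rewrite cat_wordE; case: ltnP => ilt.
  by rewrite -{1}wx nth_mkseq.
by rewrite iter_shiftE subnKC.
Qed.

Lemma gibbs_cyl w x : cyl w x ->
  expR (birkhoff phi (size w) x - V) <= m w <= expR (birkhoff phi (size w) x + V).
Proof.
move=> wx; have := @gibbs_cat w [::] (iter (size w) th x) erefl.
by rewrite cats0 cyl_pr_nil !mulr1 cat_word_cylE.
Qed.

Lemma cyl_pr_gt0 w : 0 < m w.
Proof.
by have /andP[h _] := gibbs_cyl (@cyl_ext _ hA w); apply: lt_le_trans h; exact: expR_gt0.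
Qed.

(** [gibbs_cat] with suffix [u] and with empty suffix are applied at the same point of [w ++ u]; the
    Birkhoff sums cancel and an error V remains from each. *)
Lemma quasi_bernoulli_le w u : m (w ++ u) <= expR (2 * V) * m w * m u.
Proof.
have ux := @cyl_ext _ hA u; have /andP[_ h1] := gibbs_cat w ux.
apply: le_trans h1 _; rewrite ler_wpM2r ?cyl_pr_ge0//.
have := @cyl_cat_word _ hA w [::] (ext hA u) erefl; rewrite cats0 => /gibbs_cyl/andP[h2 _].
apply: le_trans (ler_wpM2l (expR_ge0 _) h2); rewrite -expRD ler_expR; lra.
Qed.

Lemma quasi_bernoulli_ge w u : m w * m u <= expR (2 * V) * m (w ++ u).
Proof.
have ux := @cyl_ext _ hA u; have /andP[h1 _] := gibbs_cat w ux.
apply: le_trans (ler_wpM2l (expR_ge0 _) h1); rewrite mulrA ler_wpM2r ?cyl_pr_ge0//.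
have := @cyl_cat_word _ hA w [::] (ext hA u) erefl; rewrite cats0 => /gibbs_cyl/andP[_ h2].
apply: le_trans h2 _; rewrite -expRD ler_expR; lra.
Qed.

End gibbs_property.

(** * Comparing integrals with sums and series of weighted indicators *)

Section simple_bounds.
Context (R : realType) (d : measure_display) (X : measurableType d).
Context (mu : probability X R).

Lemma integral_weighted_indic (I : Type) (r : seq I) (c : I -> R) (E : I -> set X) :
  (forall i, 0 <= c i) -> (forall i, measurable (E i)) ->
  (\int[mu]_x (\sum_(i <- r) c i * \1_(E i) x)%:E)%E = (\sum_(i <- r) c i * pr mu (E i))%:E.
Proof.
move=> c0 mE.
under eq_integral do rewrite -sumEFin.
rewrite ge0_integral_sum//; first last.
- by move=> i x _; rewrite lee_fin mulr_ge0// indicE.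
- by move=> i; apply: measurableT_comp => //; apply: measurable_funM => //; exact: measurable_indic.
rewrite -sumEFin; apply: eq_bigr => i _.
under eq_integral do rewrite EFinM.
rewrite ge0_integralZl_EFin//; last first.
  by apply: measurableT_comp => //; exact: measurable_indic.
by rewrite integral_indic// setIT EFinM -prE.
Qed.

Lemma measurable_weighted_indic (I : Type) (r : seq I) (c : I -> R) (E : I -> set X) :
  (forall i, measurable (E i)) ->
  measurable_fun setT (fun x => (\sum_(i <- r) c i * \1_(E i) x)%:E).
Proof.
move=> mE; apply: measurableT_comp => //; apply: measurable_sum => i.
by apply: measurable_funM => //; exact: measurable_indic.
Qed.

Lemma weighted_indic_ge0 (I : Type) (r : seq I) (c : I -> R) (E : I -> set X) x :
  (forall i, 0 <= c i) -> (0 <= (\sum_(i <- r) c i * \1_(E i) x)%:E)%E.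
Proof.
by move=> c0; rewrite lee_fin sumr_ge0// => i _; rewrite mulr_ge0// indicE.
Qed.

Lemma integral_ge_weighted (I : Type) (r : seq I) (c : I -> R) (E : I -> set X)
    (F : X -> \bar R) : (forall i, 0 <= c i) -> (forall i, measurable (E i)) ->
  measurable_fun setT F -> (forall x, 0 <= F x)%E ->
  (forall x, (\sum_(i <- r) c i * \1_(E i) x)%:E <= F x)%E ->
  ((\sum_(i <- r) c i * pr mu (E i))%:E <= \int[mu]_x F x)%E.
Proof.
move=> c0 mE mF F0 H; rewrite -integral_weighted_indic//.
apply: ge0_le_integral => //.
- by move=> x _; exact: weighted_indic_ge0.
- exact: measurable_weighted_indic.
Qed.

Lemma integral_le_weighted (I : Type) (r : seq I) (c : I -> R) (E : I -> set X)
    (F : X -> \bar R) : (forall i, 0 <= c i) -> (forall i, measurable (E i)) ->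
  measurable_fun setT F -> (forall x, 0 <= F x)%E ->
  (forall x, F x <= (\sum_(i <- r) c i * \1_(E i) x)%:E)%E ->
  (\int[mu]_x F x <= (\sum_(i <- r) c i * pr mu (E i))%:E)%E.
Proof.
move=> c0 mE mF F0 H; rewrite -integral_weighted_indic//.
apply: ge0_le_integral => //; exact: measurable_weighted_indic.
Qed.

Lemma integral_le_series (I : Type) (r : seq I) (c : nat -> I -> R)
    (E : nat -> I -> set X) (F : X -> \bar R) (b : R) :
  (forall j i, 0 <= c j i) -> (forall j i, measurable (E j i)) ->
  measurable_fun setT F -> (forall x, 0 <= F x)%E ->
  (forall x, F x <= \sum_(j <oo) (\sum_(i <- r) c j i * \1_(E j i) x)%:E)%E ->
  (forall n, \sum_(j < n) \sum_(i <- r) c j i * pr mu (E j i) <= b) ->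
  (\int[mu]_x F x <= b%:E)%E.
Proof.
move=> c0 mE mF F0 H Hb.
have mG j := @measurable_weighted_indic I r (c j) (E j) (mE j).
have G0 j x := @weighted_indic_ge0 I r (c j) (E j) x (c0 j).
apply: (@le_trans _ _ (\int[mu]_x (\sum_(j <oo) (\sum_(i <- r) c j i * \1_(E j i) x)%:E)%E)%E).
  apply: ge0_le_integral => //; exact: ge0_emeasurable_sum.
rewrite integral_nneseries//; apply: lime_le.
  by apply: is_cvg_nneseries => n _ _; apply: integral_ge0.
apply: nearW => n; under eq_bigr do rewrite integral_weighted_indic//.
by rewrite sumEFin lee_fin big_mkord.
Qed.

Lemma measurable_nat_factor (N : X -> nat) (G : nat -> \bar R) :
  (forall k, measurable (N @^-1` [set k])) -> measurable_fun setT (G \o N).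
Proof.
move=> mN _ B mB; rewrite setTI.
rewrite (_ : _ @^-1` B = \bigcup_(k in [set k | B (G k)]) (N @^-1` [set k])).
  exact: bigcup_measurable.
apply/seteqP; split => x /=; first by move=> BG; exists (N x).
by move=> [k /= BG] ->.
Qed.

End simple_bounds.

(** * Return times *)

Section return_sets.
Context (R : realType) (A : finType) (hA : (1 < #|A|)%N).
Local Notation X := (full_shift hA).
Implicit Types (x y : X) (n k : nat).

Definition returns n k : set X := [set x | forall i, (i < n)%N -> x (k + i)%N = x i].

Definition no_return n K : set X :=
  [set x | forall k, (0 < k <= K)%N -> ~ returns n k x].

Lemma finitary_returns n k : finitary (k + n) (returns n k).
Proof.
move=> x y xy H i ilt; rewrite -!xy ?H//; first by rewrite (leq_trans ilt)// leq_addl.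
by rewrite ltn_add2l.
Qed.

Lemma finitary_no_return n K : finitary (K + n) (no_return n K).
Proof.
move=> x y xy H k /andP[k0 kK] ry; apply: (H k); first by rewrite k0.
apply: (@finitary_returns n k y x) ry; apply: agree_sym; apply: agree_le xy.
by rewrite leq_add2r.
Qed.

(** The value 0 encodes an infinite return time. *)
Definition first_return n x : nat :=
  if pselect (exists k, (0 < k)%N && `[< returns n k x >]) is left e
  then ex_minn e else 0%N.

Lemma first_returnP n x k : (0 < k)%N ->
  first_return n x = k <-> returns n k x /\ no_return n k.-1 x.
Proof.
move=> k0; rewrite /first_return; case: pselect => [e|ne].
  case: ex_minnP => j /andP[j0 /asboolP rj] jmin; split.
    move=> <-; split => // i /andP[i0 ij] ri.
    have := jmin i; rewrite i0 /= asboolT// => /(_ isT).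
    by rewrite leqNgt -(ltn_predK j0) ltnS ij.
  move=> [rk nk]; apply/eqP; rewrite eqn_leq jmin ?k0 ?asboolT//=.
  rewrite leqNgt; apply/negP => jk; apply: (nk j) => //.
  by rewrite j0 -ltnS (ltn_predK k0).
split=> [E|[rk _]]; first by rewrite -E in k0.
by case: ne; exists k; rewrite k0 asboolT.
Qed.

Lemma first_return0P n x : first_return n x = 0%N <-> forall k, (0 < k)%N -> ~ returns n k x.
Proof.
rewrite /first_return; case: pselect => [e|ne].
  case: ex_minnP => j /andP[j0 /asboolP rj] _; split=> [E|H]; first by rewrite E in j0.
  by case: (H j).
split=> // _ k k0 rk; apply: ne; exists k; by rewrite k0 asboolT.
Qed.

Lemma measurable_first_return n k : measurable (@first_return n @^-1` [set k]).
Proof.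
case: k => [|k].
  rewrite (_ : _ @^-1` _ = \bigcap_(k in [set k | (0 < k)%N]) ~` (returns n k)).
    apply: bigcap_measurableType => k _; apply: measurableC.
    exact: finitary_measurable (@finitary_returns n k).
  by apply/seteqP; split => x /= /first_return0P.
rewrite (_ : _ @^-1` _ = returns n k.+1 `&` no_return n k).
  apply: measurableI; first exact: finitary_measurable (@finitary_returns n k.+1).
  exact: finitary_measurable (@finitary_no_return n k).
by apply/seteqP; split => x /=; [move/(first_returnP _ _ (ltn0Sn k))|move=> H; apply/(first_returnP _ _ (ltn0Sn k))].
Qed.

Lemma return_timeE n x : return_time R n x =
  if first_return n x is k.+1 then (k.+1%:R)%:E else +oo%E.
Proof.
case E : (first_return n x) => [|k].
  apply/eqP; rewrite eq_le leey/=; apply: le_ereal_inf_tmp => _ [k [k0 rk] <-].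
  by move/first_return0P : E => /(_ k k0) [].
have [rk nk] := (first_returnP _ _ (ltn0Sn k)).1 E.
apply/eqP; rewrite eq_le; apply/andP; split.
  by apply: ereal_inf_lbound; exists k.+1.
apply: le_ereal_inf_tmp => _ [j [j0 rj] <-]; rewrite lee_fin ler_nat leqNgt; apply/negP => jk.
by apply: (nk j) => //; rewrite j0.
Qed.

Definition return_power (q : R) n x : \bar R := expeR (q%:E * lne (return_time R n x))%E.

Lemma return_power_ge0 q n x : (0 <= return_power q n x)%E.
Proof. exact: expeR_ge0. Qed.

Lemma measurable_return_power q n : measurable_fun setT (return_power q n).
Proof.
pose G k : \bar R := expeR (q%:E * lne (if k is k'.+1 then (k'.+1%:R)%:E else +oo%E))%E.
have -> : return_power q n = G \o @first_return n.
  by apply/funext => x; rewrite /return_power return_timeE.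
by apply: measurable_nat_factor => k; exact: (@measurable_first_return n k).
Qed.

Lemma return_power_finE q n x k : first_return n x = k.+1 ->
  return_power q n x = (expR (q * ln k.+1%:R))%:E.
Proof. by move=> E; rewrite /return_power return_timeE E lne_EFin// ltr0n. Qed.

Lemma return_power_inftyE q n x : first_return n x = 0%N ->
  return_power q n x = if q == 0 then 1%E else if 0 < q then +oo%E else 0%E.
Proof.
move=> E; rewrite /return_power return_timeE E /=.
case: (ltgtP 0 q) => [q0|q0|<-] /=.
- by rewrite gt0_muley ?lte_fin.
- by rewrite lt0_muley ?lte_fin.
- by rewrite mul0e expeR0.
Qed.

Lemma return_power_le_of_returns q n x k : q <= 0 -> (0 < k)%N -> returns n k x ->
  ((expR (q * ln k%:R))%:E <= return_power q n x)%E.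
Proof.
move=> q0 k0 rk; case E : (first_return n x) => [|j].
  by move/first_return0P : E => /(_ k k0).
rewrite (return_power_finE _ E) lee_fin ler_expR ler_wnM2l// ler_ln ?posrE ?ltr0n//.
have [_ nj] := (first_returnP _ _ (ltn0Sn j)).1 E.
rewrite ler_nat leqNgt; apply/negP => kj; apply: (nj k) => //; by rewrite k0.
Qed.

Lemma return_power_ge_of_no_return q n x K : 0 <= q -> no_return n K x ->
  ((expR (q * ln K.+1%:R))%:E <= return_power q n x)%E.
Proof.
move=> q0 nK; case E : (first_return n x) => [|j].
  rewrite (return_power_inftyE _ E); case: eqVneq => [->|qn]; first by rewrite mul0r expR0.
  by rewrite lt_neqAle eq_sym qn q0 leey.
rewrite (return_power_finE _ E) lee_fin ler_expR ler_wpM2l// ler_ln ?posrE ?ltr0n//.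
have [rj _] := (first_returnP _ _ (ltn0Sn j)).1 E.
by rewrite ler_nat leqNgt; apply/negP => jK; apply: (nK j.+1) => //=.
Qed.

Lemma return_power_mono q q' n x : q <= q' -> q' <= 0 ->
  (return_power q n x <= return_power q' n x)%E.
Proof.
move=> qq q0; case E : (first_return n x) => [|j].
  rewrite !(return_power_inftyE _ E) !ltNge q0 (le_trans qq q0)/=.
  case: (eqVneq q 0) => [qe|_]; last by case: ifP.
  by rewrite -qe eq_le qq {1}qe q0.
rewrite !(return_power_finE _ E) lee_fin ler_expR ler_wpM2r// ln_ge0// ler1n//.
Qed.

End return_sets.

(** * Return probabilities under a quasi-Bernoulli measure *)

Section return_estimates.
Context (R : realType) (A : finType) (hA : (1 < #|A|)%N).
Local Notation X := (full_shift hA).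
Local Notation th := (@left_shift A hA).
Implicit Types (x y : X) (n k j : nat) (w u : seq A).
Context (mu : probability X R) (mu_inv : invariant_measures hA mu).
Local Notation m := (cyl_pr mu).
Context (C D rho : R).
Hypotheses (C_ge1 : 1 <= C)
  (qb_le : forall w u, m (w ++ u) <= C * m w * m u)
  (qb_ge : forall w u, m w * m u <= C * m (w ++ u))
  (m_gt0 : forall w, 0 < m w)
  (rho_gt0 : 0 < rho) (rho_lt1 : rho < 1)
  (m_decay : forall w, m w <= D * rho ^+ size w).

Let C_gt0 : 0 < C := lt_le_trans ltr01 C_ge1.

Let D_ge0 : 0 <= D.
Proof. by have := le_trans (ltW (m_gt0 [::])) (m_decay [::]); rewrite expr0 mulr1. Qed.

Lemma pr_finitary_cat N (B : set X) u : finitary N B ->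
  pr mu (B `&` iter N th @^-1` cyl u) =
  \sum_(w : N.-tuple A | `[< B (ext hA w) >]) m (w ++ u).
Proof.
move=> fB; have mB := finitary_measurable fB.
have mu' := measurable_shift_preimage N (@measurable_cyl A hA u).
rewrite (pr_partition mu (@rv_word _ hA N)); last exact: measurableI.
rewrite [RHS]big_mkcond/=; apply: eq_bigr => w _.
have wB x : word N x = w -> (B x <-> B (ext hA w)).
  move=> <-; have xe := @agree_ext _ hA N x.
  by split; apply: fB => //; exact: agree_sym.
case: asboolP => Bw.
  rewrite /cyl_pr cyl_cat cyl_tuple size_tuple; congr (pr mu _).
  by apply/seteqP; split => x /=; [case=> [[]]|case=> xw; split => //; split => //; apply/(wB _ xw)].
rewrite (_ : _ `&` _ = set0) ?pr_set0//; apply/seteqP; split => x //= [[Bx _] xw].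
by apply: Bw; apply/(wB _ xw).
Qed.

Lemma pr_finitary N (B : set X) : finitary N B ->
  pr mu B = \sum_(w : N.-tuple A | `[< B (ext hA w) >]) m w.
Proof.
move=> fB; have := pr_finitary_cat [::] fB.
rewrite (_ : cyl [::] = setT) ?preimage_setT ?setIT; last exact/seteqP.
by move=> ->; apply: eq_bigr => w _; rewrite cats0.
Qed.

Lemma qb_set_le N (B : set X) u : finitary N B ->
  pr mu (B `&` iter N th @^-1` cyl u) <= C * pr mu B * m u.
Proof.
move=> fB; rewrite pr_finitary_cat// (pr_finitary fB) big_distrr big_distrl/=.
by apply: ler_sum => w _; exact: qb_le.
Qed.

Lemma qb_set_ge N (B : set X) u : finitary N B ->
  pr mu B * m u <= C * pr mu (B `&` iter N th @^-1` cyl u).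
Proof.
move=> fB; rewrite pr_finitary_cat// (pr_finitary fB) big_distrl big_distrr/=.
by apply: ler_sum => w _; exact: qb_ge.
Qed.

Lemma cyl_returns w k x : cyl w x -> returns (size w) k x <-> cyl w (iter k th x).
Proof.
rewrite /cyl /= => xw; split=> [H|yw i ilt].
  rewrite -[RHS]xw; apply/eq_in_map => i; rewrite mem_iota add0n => /andP[_ ilt].
  by rewrite iter_shiftE H.
have := @agree_cyl _ _ w x (iter k th x) xw yw i ilt.
by rewrite iter_shiftE.
Qed.

Lemma m_le1 w : m w <= 1.
Proof. exact: pr_le1 (@measurable_cyl _ _ w). Qed.

Lemma measurable_no_return_cyl w n K : measurable (cyl w `&` no_return n K : set X).
Proof.
apply: measurableI; first exact: measurable_cyl.
exact: finitary_measurable (@finitary_no_return _ _ n K).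
Qed.

Lemma measurable_returns_cyl w n k : measurable (cyl w `&` returns n k : set X).
Proof.
apply: measurableI; first exact: measurable_cyl.
exact: finitary_measurable (@finitary_returns _ _ n k).
Qed.

(** Only the multiples of the length n of [w] are looked at: given the past, each new window of
    length n carries [w] with conditional probability at least m w / C. *)
Lemma no_return_tail w k : (0 < size w)%N ->
  pr mu (cyl w `&` no_return (size w) (k * size w)) <= m w * (1 - m w / C) ^+ k.
Proof.
set n := size w => n0.
pose E l := cyl w `&` [set x | forall j, (0 < j <= l)%N -> ~ cyl w (iter (j * n) th x)].
have fE l : finitary (l.+1 * n) (E l).
  move=> x y xy [wx H]; split.
    by apply: finitary_cyl wx; apply: agree_le xy; rewrite mulSn leq_addr.
  move=> j jl wy; apply: (H j jl); apply: finitary_cyl wy; apply: agree_sym.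
  apply: agree_shift; apply: agree_le xy; rewrite -/n addnC -mulSn leq_mul2r.
  by case/andP: jl => _ jl; rewrite ltnS jl orbT.
have mE l := finitary_measurable (fE l).
apply: le_trans (_ : pr mu (E k) <= _).
  apply: pr_mono => //; first exact: measurable_no_return_cyl.
  move=> x [wx H]; split => // j /andP[j0 jk] wy; apply: (H (j * n)%N).
    by rewrite muln_gt0 j0 n0 leq_mul2r jk orbT.
  exact/cyl_returns.
have s0 : 0 <= 1 - m w / C.
  by rewrite subr_ge0 ler_pdivrMr// mul1r; apply: le_trans C_ge1; exact: m_le1.
elim: k => [|k IH].
  rewrite expr0 mulr1; apply: pr_mono => //; first exact: measurable_cyl.
  by move=> x [].
have mS := measurable_shift_preimage (k.+1 * n) (@measurable_cyl A hA w).
have : pr mu (E k) = pr mu (E k.+1) + pr mu (E k `&` iter (k.+1 * n) th @^-1` cyl w).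
  rewrite -prU//; last 2 first.
  - exact: measurableI.
  - apply/seteqP; split => x // [[wx H] [_ Hx]]; apply: (H k.+1) => //.
    by rewrite /= leqnn.
  congr (pr mu _); apply/seteqP; split => x.
    move=> [wx H]; have [Hx|Hx] := pselect (cyl w (iter (k.+1 * n) th x)); [right|left] => //.
    split => // j /andP[j0]; rewrite leq_eqVlt => /predU1P[->//|]; rewrite ltnS => jk.
    by apply: H; rewrite j0.
  case=> [[wx H]|[]//]; split => // j /andP[j0 jk]; apply: H; by rewrite j0 ltnW.
have := qb_set_ge w (fE k); rewrite -/(E k) => Q1 Q2.
rewrite exprS mulrCA; apply: le_trans (ler_wpM2l s0 IH).
rewrite mulrBl mul1r -mulrA [_^-1 * _]mulrC mulrA [m w * _]mulrC.
have : pr mu (E k) * m w / C <= pr mu (E k `&` iter (k.+1 * n) th @^-1` cyl w).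
  by rewrite ler_pdivrMr// mulrC [leRHS]mulrC [m w * _]mulrC.
by move: Q2; lra.
Qed.

(** A return at time j <= n forces the j letters after [w] to repeat the last j letters of [w]. *)
Lemma pr_returns_short w j : (j <= size w)%N ->
  pr mu (cyl w `&` returns (size w) j) <= C * m w * (D * rho ^+ j).
Proof.
set n := size w => jn.
have sz : size (drop (n - j) w) = j by rewrite size_drop subKn.
apply: le_trans (_ : m (w ++ drop (n - j) w) <= _).
  apply: pr_mono; [exact: measurable_returns_cyl|exact: measurable_cyl|].
  move=> x [wx rx]; rewrite cyl_cat; split => //=; rewrite /cyl /= sz.
  apply: (@eq_from_nth _ (x 0%N)); rewrite size_mkseq ?sz// => i ij.
  have nji : (n - j + i < n)%N by rewrite -ltn_subRL subKn.
  rewrite nth_mkseq// iter_shiftE nth_drop -{2}wx nth_mkseq//.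
  by rewrite -(rx _ nji) addnA subnKC.
apply: le_trans (qb_le _ _) _; rewrite ler_wpM2l ?mulr_ge0 ?(ltW C_gt0) ?(ltW (m_gt0 w))//.
by have := m_decay (drop (n - j) w); rewrite sz.
Qed.

Lemma pr_returns_long w j : (size w <= j)%N ->
  pr mu (cyl w `&` returns (size w) j) <= C * m w * m w.
Proof.
move=> nj; have fw : finitary j (cyl w : set X) := finitary_le nj (@finitary_cyl _ _ w).
apply: le_trans (qb_set_le w fw); rewrite le_eqVlt; apply/orP; left; apply/eqP.
congr (pr mu _); apply/seteqP; split => x /= [wx H]; split => //.
  exact/cyl_returns.
by apply/cyl_returns.
Qed.

Lemma pr_returns_le w j :
  pr mu (cyl w `&` returns (size w) j) <= C * m w * (D * rho ^+ j + m w).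
Proof.
have D0 : 0 <= D * rho ^+ j.
  by rewrite mulr_ge0// exprn_ge0// ltW.
have Cw : 0 <= C * m w by rewrite mulr_ge0// ltW.
have [jn|nj] := leqP j (size w).
  apply: le_trans (pr_returns_short jn) _; rewrite ler_wpM2l// lerDl ltW//.
apply: le_trans (pr_returns_long (ltnW nj)) _; rewrite ler_wpM2l// lerDr//.
Qed.

Lemma geometric_tail_le J K : \sum_(J <= j < K) rho ^+ j <= rho ^+ J / (1 - rho).
Proof.
have r1 : 0 < 1 - rho by rewrite subr_gt0.
rewrite ler_pdivlMr//; elim: K => [|K IH].
  by rewrite big_geq// mul0r exprn_ge0// ltW.
have [JK|KJ] := leqP J K; last by rewrite big_geq// mul0r exprn_ge0// ltW.
suff : (\sum_(J <= j < K.+1) rho ^+ j) * (1 - rho) = rho ^+ J - rho ^+ K.+1.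
  by move=> ->; rewrite gerBl exprn_ge0// ltW.
elim: K JK {IH} => [|K IH] JK.
  by move: JK; rewrite leqn0 => /eqP ->; rewrite big_nat1 expr0 expr1 mul1r.
move: JK; rewrite leq_eqVlt => /predU1P[->|JK].
  by rewrite big_nat1 !exprS; ring.
by rewrite (big_nat_recr _ _ _ (ltnW JK))/= mulrDl IH// !exprS; ring.
Qed.

(* If the word has a small period p, forbidding the letter that would prolong
   this period excludes every return time j <= n - p at once, since a period j
   of the prolonged word would force that same letter. *)
Lemma avoid_short_returns w J (e : R) : (J + J <= size w)%N ->
  0 < e -> e <= 1 -> (forall a, e <= m [:: a]) ->
  exists E : set X, [/\ measurable E, E `<=` cyl w, e / C * m w <= pr mu E &
    forall j x, (0 < j < J)%N -> E x -> ~ returns (size w) j x].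
Proof.
set n := size w => Jn e0 e1 em.
have eC : e / C <= 1.
  by rewrite ler_pdivrMr// mul1r (le_trans e1).
have [[p [/andP[p0 pJ] [x0 [wx0 rx0]]]]|noper] :=
  pselect (exists p, (0 < p < J)%N /\ exists x, cyl w x /\ returns n p x); last first.
  exists (cyl w); split => //; first exact: measurable_cyl.
    by rewrite -[leRHS]mul1r ler_wpM2r// ltW.
  by move=> j x jJ wx rx; apply: noper; exists j; split => //; exists x.
have pn : (p < n)%N by apply: leq_trans pJ _; apply: leq_trans Jn; exact: leq_addr.
have [s sp] : exists s : A, s <> x0 (n - p)%N.
  have /card_gt1P[a [b [_ _ ab]]] := hA.
  have [E|/eqP] := eqVneq a (x0 (n - p)%N); last by exists a.
  by exists b => F; move: ab; rewrite E F eqxx.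
exists (cyl (w ++ [:: s])); split.
- exact: measurable_cyl.
- by move=> x; rewrite cyl_cat => -[].
- apply: le_trans (_ : m w * m [:: s] / C <= _); last first.
    by rewrite ler_pdivrMr// mulrC [leRHS]mulrC [m [:: s] * _]mulrC.
  rewrite mulrAC ler_wpM2r ?invr_ge0 ?(ltW C_gt0)//.
  by rewrite mulrC ler_wpM2l ?(ltW (m_gt0 _)).
move=> j x /andP[j0 jJ]; rewrite cyl_cat => -[wx /= sx] rx.
have xn : x n = s.
  have : iter (size w) th x 0%N = s by case: sx.
  by rewrite iter_shiftE addn0.
have jpn : (j + p <= n)%N by apply: leq_trans Jn; apply: leq_add; exact: ltnW.
have jn : (j <= n)%N by apply: leq_trans jpn; exact: leq_addr.
have ag := agree_cyl wx wx0.
apply: sp; rewrite -xn.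
have h1 : x n = x (n - j)%N.
  by rewrite -{1}(subnKC jn) rx// ltn_subrL j0 (leq_trans j0 jn).
have h2 : x0 (n - j)%N = x0 (n - j - p)%N.
  rewrite -(rx0 (n - j - p)%N); last first.
    by rewrite (leq_ltn_trans (leq_subr _ _))// ltn_subrL j0 (leq_trans j0 jn).
  by rewrite subnKC// leq_subRL.
have h3 : x (n - p)%N = x (n - p - j)%N.
  rewrite -(rx (n - p - j)%N); last first.
    by rewrite (leq_ltn_trans (leq_subr _ _))// ltn_subrL p0 (ltn_trans p0 pn).
  by rewrite subnKC// leq_subRL ?(ltnW pn)// addnC.
rewrite h1 ag; last by rewrite ltn_subrL j0 (leq_trans j0 jn).
rewrite h2 -ag; last first.
  by rewrite (leq_ltn_trans (leq_subr _ _))// ltn_subrL j0 (leq_trans j0 jn).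
rewrite subnAC -h3 ag// ltn_subrL p0 (ltn_trans p0 pn)//.
Qed.

(** The set of [avoid_short_returns] has no return before J; those from J to K are removed by a
    union bound. The last two hypotheses bound by a quarter of e / C the geometric part and the part
    from independent hits, which leaves one half. *)
Lemma no_return_lower w J K (e : R) : (J + J <= size w)%N -> (0 < J)%N ->
  0 < e -> e <= 1 -> (forall a, e <= m [:: a]) ->
  C * D * (rho ^+ J / (1 - rho)) <= e / C / 4 ->
  K%:R * (C * m w) <= e / C / 4 ->
  e / C / 2 * m w <= pr mu (cyl w `&` no_return (size w) K).
Proof.
move=> Jn J0 e0 e1 em HJ HK; have [E [mE Ew prE Eno]] := avoid_short_returns Jn e0 e1 em.
set n := size w in Jn Eno *.
pose F : set X := \big[setU/set0]_(j <- index_iota J K.+1) (cyl w `&` returns n j).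
have mF : measurable F.
  by apply: bigsetU_measurable => j _; exact: measurable_returns_cyl.
have sub : E `<=` (cyl w `&` no_return n K) `|` F.
  move=> x Ex; have [Fx|nF] := pselect (F x); [by right|left]; split; first exact: Ew.
  move=> j /andP[j0 jK] rj; have [jJ|Jj] := ltnP j J.
    by apply: (Eno j x) => //; rewrite j0.
  apply: nF; rewrite /F -bigcup_seq; exists j => /=; last by split => //; exact: Ew.
  by rewrite mem_index_iota Jj ltnS.
have mN := measurable_no_return_cyl w n K.
have h1 : pr mu E <= pr mu (cyl w `&` no_return n K) + pr mu F.
  apply: le_trans (prU_le _ mN mF); apply: pr_mono => //; exact: measurableU.
have h2 : pr mu F <= \sum_(J <= j < K.+1) C * m w * (D * rho ^+ j + m w).
  apply: le_trans (pr_bigU_le mu _ (fun j => measurable_returns_cyl w n j)) _.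
  by apply: ler_sum => j _; exact: pr_returns_le.
have Cw : 0 <= C * m w by rewrite mulr_ge0// ltW.
have D0 := D_ge0.
have h3 : \sum_(J <= j < K.+1) C * m w * (D * rho ^+ j + m w) <=
    m w * (e / C / 4) + m w * (e / C / 4).
  rewrite -big_distrr/= big_split/= -big_distrr/= sumr_const_nat mulrDr.
  apply: lerD.
    have := ler_wpM2l (ltW (m_gt0 w)) HJ; apply: le_trans.
    rewrite [C * m w]mulrC -!mulrA ler_wpM2l ?(ltW (m_gt0 _))// ler_wpM2l ?(ltW C_gt0)//.
    by rewrite ler_wpM2l// geometric_tail_le.
  have := ler_wpM2l (ltW (m_gt0 w)) HK; apply: le_trans.
  rewrite -[m w *+ _]mulr_natl mulrCA [leRHS]mulrCA [m w * (C * _)]mulrC.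
  rewrite ler_wpM2r ?mulr_ge0 ?(ltW C_gt0) ?(ltW (m_gt0 _))//.
  by rewrite ler_nat leq_subLR addnC -addn1 leq_add2l.
rewrite (_ : e / C / 2 * m w = e / C * m w - (m w * (e / C / 4) + m w * (e / C / 4))); last by field; rewrite gt_eqF.
lra.
Qed.

End return_estimates.

(** * Elementary sums and exponential bounds *)

Section elementary_sums.
Context (R : realType).

Lemma halving_sum_le N : \sum_(j < N) expR (- (j%:R * ln 2)) <= 2 :> R.
Proof.
have two : expR (ln 2) = 2 :> R by rewrite lnK// posrE.
suff -> : \sum_(j < N) expR (- (j%:R * ln 2)) = 2 - 2 * expR (- (N%:R * ln 2)) :> R.
  by rewrite gerBl mulr_ge0// expR_ge0.
elim: N => [|N IH]; first by rewrite big_ord0 mul0r oppr0 expR0 mulr1 subrr.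
have -> : N.+1%:R * ln 2 = N%:R * ln 2 + ln 2 :> R by rewrite -natr1; ring.
rewrite big_ord_recr/= IH opprD expRD [expR (- ln 2)]expRN two.
by field.
Qed.

Lemma harmonic_sum_le K : (0 < K)%N ->
  \sum_(1 <= j < K.+1) expR (- ln j%:R) <= 1 + ln K%:R :> R.
Proof.
case: K => // K _; elim: K => [|K IH].
  by rewrite big_nat1 ln1 oppr0 expR0 addr0.
rewrite (big_nat_recr K.+2)//=; apply: le_trans (lerD IH (lexx _)) _.
rewrite -addrA lerD2l expRN lnK ?posrE//.
have k1 : (0 : R) < K.+1%:R by rewrite ltr0n.
have k2 : (0 : R) < K.+2%:R by rewrite ltr0n.
have := @le_ln1Dx R (- K.+2%:R^-1).
have -> : 1 + - K.+2%:R^-1 = K.+1%:R / K.+2%:R :> R.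
  rewrite -[K.+2%:R]natr1; move: k1; set a := K.+1%:R => a0.
  by field; rewrite gt_eqF// addr_gt0.
rewrite ln_div ?posrE// => H; have {}H := H _.
have : ln K.+1%:R - ln K.+2%:R <= - K.+2%:R^-1 :> R.
  by apply: H; rewrite ltrN2 invf_lt1// ltr1n.
move: (ln _) (ln _) (_^-1) => y z t; lra.
Qed.

Lemma expr_le_expR (s : R) k : 0 <= s <= 1 -> (1 - s) ^+ k <= expR (- (k%:R * s)).
Proof.
move=> /andP[s0 s1]; rewrite -mulrN mulrC expRM_natr; apply: lerXn2r.
- by rewrite nnegrE subr_ge0.
- by rewrite nnegrE expR_ge0.
- by have := @expR_ge1Dx R (- s).
Qed.

Lemma ceil_nat_bounds (y : R) : 0 <= y -> let L := (Num.trunc y).+1 in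
  y <= L%:R /\ L%:R <= y + 1.
Proof.
move=> y0 /=; split; first exact: ltW (truncnS_gt _).
by rewrite -natr1 lerD2r; have /andP[] := truncn_itv y0.
Qed.

End elementary_sums.

(** * Moments of the return time *)

Section moment_bounds.
Context (R : realType) (A : finType) (hA : (1 < #|A|)%N).
Local Notation X := (full_shift hA).
Implicit Types (x y : X) (n k j : nat).
Context (mu : probability X R) (mu_inv : invariant_measures hA mu).
Local Notation m := (cyl_pr mu).
Context (C D rho : R).
Hypotheses (C_ge1 : 1 <= C)
  (qb_le : forall w u, m (w ++ u) <= C * m w * m u)
  (qb_ge : forall w u, m w * m u <= C * m (w ++ u))
  (m_gt0 : forall w, 0 < m w)
  (rho_gt0 : 0 < rho) (rho_lt1 : rho < 1)
  (m_decay : forall w, m w <= D * rho ^+ size w).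

Let C_gt0 : 0 < C := lt_le_trans ltr01 C_ge1.

Definition power_sum (t : R) n : R := \sum_(w : n.-tuple A) expR (t * ln (m w)).

Definition moment q n : \bar R := (\int[mu]_x return_power q n x)%E.

Lemma cyl_word n x (w : n.-tuple A) : cyl w x <-> w = word n x.
Proof. by rewrite cyl_tuple /=; split=> ->. Qed.

Lemma sum_cyl_indic n (c : n.-tuple A -> R) (G : n.-tuple A -> set X) x :
  \sum_(w : n.-tuple A) c w * \1_(cyl w `&` G w) x =
  c (word n x) * \1_(G (word n x)) x.
Proof.
rewrite (bigD1 (word n x))//= big1 ?addr0 => [|w wx].
  rewrite !indicE; have -> // : (x \in cyl (word n x) `&` G (word n x)) = (x \in G (word n x)).
  apply/idP/idP; rewrite !inE; first by case.
  by move=> Gx; split => //; exact/cyl_word.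
by rewrite indicE memNset ?mulr0// => -[/cyl_word E _]; rewrite E eqxx in wx.
Qed.

Lemma expR_lnM_cyl (q : R) n (w : n.-tuple A) :
  expR (- (q * ln (m w))) * m w = expR ((1 - q) * ln (m w)).
Proof. by rewrite -{2}[m w]lnK ?posrE// -expRD; congr expR; ring. Qed.

(** At least half of [w] has returned by time L n with L of order 1 / mu[w], and for q <= 0 an
    earlier return only increases the power. The windows of length n are responsible for the factor
    n^q. *)
Lemma moment_lower_neg q : q <= 0 -> exists2 K : R, 0 < K &
  forall n, (0 < n)%N ->
    ((K * expR (q * ln n%:R) * power_sum (1 - q) n)%:E <= moment q n)%E.
Proof.
move=> q0; exists (expR (q * ln (2 * C)) / 2) => [|n n0].
  by rewrite divr_gt0// expR_gt0.
(* With L >= C / mu[w] windows the tail is at most exp (-1), hence at most 1 / 2. *)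
pose L (w : n.-tuple A) := (Num.trunc (C / m w)).+1.
have LP (w : n.-tuple A) : C / m w <= (L w)%:R /\ (L w)%:R <= 2 * C / m w.
  have y0 : 0 <= C / m w by rewrite divr_ge0// ltW.
  have [h1 h2] := ceil_nat_bounds y0; split => //; apply: le_trans h2 _.
  rewrite -mulrA mulr_natl mulr2n lerD2l ler_pdivlMr// mul1r.
  exact: le_trans (m_le1 mu w) C_ge1.
pose G (w : n.-tuple A) : set X := ~` no_return n (L w * n).
pose c (w : n.-tuple A) := expR (q * ln (L w * n)%:R).
have mG (w : n.-tuple A) : measurable (cyl w `&` G w : set X).
  apply: measurableI; first exact: measurable_cyl.
  by apply: measurableC; exact: finitary_measurable (@finitary_no_return _ _ _ _).
have prG (w : n.-tuple A) : m w / 2 <= pr mu (cyl w `&` G w).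
  have T := no_return_tail C_ge1 qb_ge (w := w) (L w); rewrite size_tuple in T.
  have {}T := T n0.
  have s01 : 0 <= m w / C <= 1.
    rewrite divr_ge0 ?(ltW (m_gt0 _)) ?(ltW C_gt0)//= ler_pdivrMr// mul1r.
    exact: le_trans (m_le1 mu w) C_ge1.
  have Ls : 1 <= (L w)%:R * (m w / C).
    have [h _] := LP w; rewrite mulrA ler_pdivlMr// mul1r -ler_pdivrMr//.
  have half : expR (- ((L w)%:R * (m w / C))) <= 2^-1.
    apply: le_trans (_ : expR (- 1) <= _); first by rewrite ler_expR lerN2.
    rewrite expRN lef_pV2 ?posrE ?expR_gt0//.
    by have := @expR_ge1Dx R 1.
  have : pr mu (cyl w `&` no_return n (L w * n)) <= m w / 2.
    apply: le_trans T _; rewrite ler_wpM2l ?(ltW (m_gt0 _))//.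
    exact: le_trans (expr_le_expR _ s01) half.
  have : m w = pr mu (cyl w `&` no_return n (L w * n)) + pr mu (cyl w `&` G w).
    rewrite -prU//.
    - by rewrite -setIUr /G setUv setIT.
    - exact: measurable_no_return_cyl.
    - by rewrite /G setIACA setICr setI0.
  lra.
apply: le_trans (_ : ((\sum_(w : n.-tuple A) c w * pr mu (cyl w `&` G w))%:E <= _)%E); last first.
  apply: integral_ge_weighted => //.
  - by move=> w; exact: expR_ge0.
  - exact: measurable_return_power.
  - by move=> x; exact: return_power_ge0.
  - move=> x; rewrite sum_cyl_indic indicE; case: (boolP (x \in _)) => [|_]; last first.
      by rewrite mulr0; exact: return_power_ge0.
    rewrite inE => /existsNP[k /not_implyP[/andP[k0 kL] /contrapT rk]].
    rewrite mulr1; apply: le_trans (return_power_le_of_returns q0 k0 rk).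
    rewrite lee_fin ler_expR ler_wnM2l// ler_ln ?posrE ?ltr0n ?muln_gt0 ?n0//.
    by rewrite ler_nat.
rewrite lee_fin /power_sum big_distrr/=; apply: ler_sum => w _.
apply: le_trans (ler_wpM2l (expR_ge0 _) (prG w)).
rewrite -expR_lnM_cyl mulrA [m w / 2]mulrC mulrA ler_wpM2r ?(ltW (m_gt0 _))//.
rewrite [leLHS](_ : _ = expR (q * ln (2 * C)) * expR (q * ln n%:R) *
  expR (- (q * ln (m w))) / 2); last by ring.
rewrite ler_wpM2r// -!expRD ler_expR.
have [h1 h2] := LP w.
have L0 : (0 : R) < (L w)%:R by rewrite ltr0n.
have : ln (L w)%:R <= ln (2 * C / m w).
  by rewrite ler_ln ?posrE// divr_gt0// mulr_gt0.
rewrite ln_div ?posrE ?mulr_gt0// => Hl.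
have n0R : (0 : R) < n%:R by rewrite ltr0n.
have -> : ln (L w * n)%:R = ln (L w)%:R + ln n%:R :> R by rewrite natrM lnM ?posrE.
have := ler_wnM2l q0 Hl; lra.
Qed.

Lemma letter_lower_bound : exists e : R, [/\ 0 < e, e <= 1 & forall a, e <= m [:: a]].
Proof.
have mi a : 0 <= m [:: a] <= 1 by rewrite (ltW (m_gt0 _)) (m_le1 mu).
exists (\prod_a m [:: a]); split.
- by apply: prodr_gt0.
- by apply: numdomain.Num.Theory.prodr_ile1.
- move=> a; rewrite (bigD1 a)//= -[leRHS]mulr1 ler_wpM2l ?(ltW (m_gt0 _))//.
  exact: numdomain.Num.Theory.prodr_ile1.
Qed.

(** For q >= 0 late returns are favourable: a fixed fraction of [w] does not return before a time of
    order 1 / mu[w]. *)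
Lemma moment_lower_pos q : 0 <= q -> exists2 K : R, 0 < K & exists N,
  forall n, (N <= n)%N -> ((K * power_sum (1 - q) n)%:E <= moment q n)%E.
Proof.
move=> q0; have [e [e0 e1 em]] := letter_lower_bound.
have eC : 0 < e / C / 4 by rewrite !divr_gt0.
have [J J0 HJ] : exists2 J, (0 < J)%N & C * D * (rho ^+ J / (1 - rho)) <= e / C / 4.
  have r1 : 0 < 1 - rho by rewrite subr_gt0.
  have cr : `|rho| < 1 by rewrite gtr0_norm.
  have Dp : 0 < `|C * D| / (1 - rho) + 1 by rewrite ltr_wpDl// divr_ge0// ltW.
  have := cvg_expr cr => /cvgrPdist_lt /(_ _ (divr_gt0 eC Dp)) [N _ NP].
  exists N.+1 => //; have := NP N.+1 (leqnSn N); rewrite sub0r normrN ger0_norm ?exprn_ge0 ?(ltW rho_gt0)//.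
  rewrite ltr_pdivlMr// => H; apply: le_trans (ltW H).
  rewrite mulrCA ler_wpM2l ?exprn_ge0 ?(ltW rho_gt0)//.
  apply: le_trans (_ : `|C * D| / (1 - rho) <= _); last by rewrite lerDl.
  by rewrite ler_wpM2r ?invr_ge0 ?(ltW r1)// ler_norm.
(* The largest constant for which K <= kap / m w gives the last hypothesis of [no_return_lower]. *)
pose kap := e / C / 4 / C.
have kap0 : 0 < kap by rewrite divr_gt0.
exists (e / C / 2 * expR (q * ln kap)) => [|]; first by rewrite mulr_gt0 ?expR_gt0 ?divr_gt0.
exists (J + J)%N => n Jn.
pose K (w : n.-tuple A) := Num.trunc (kap / m w).
have y0 (w : n.-tuple A) : 0 <= kap / m w by rewrite divr_ge0// ltW.
pose G (w : n.-tuple A) : set X := no_return n (K w).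
pose c (w : n.-tuple A) := expR (q * ln (K w).+1%:R).
have prG (w : n.-tuple A) : e / C / 2 * m w <= pr mu (cyl w `&` G w).
  have := no_return_lower C_ge1 qb_le qb_ge m_gt0 rho_gt0 rho_lt1 m_decay (w := w) (J := J) (K := K w) (e := e).
  rewrite size_tuple; apply => //.
  have /andP[h _] := truncn_itv (y0 w); rewrite -/(K w) in h.
  by move: h; rewrite /kap ler_pdivlMr// ler_pdivlMr// mulrCA mulrC.
apply: le_trans (_ : ((\sum_(w : n.-tuple A) c w * pr mu (cyl w `&` G w))%:E <= _)%E); last first.
  apply: integral_ge_weighted => //.
  - by move=> w; exact: expR_ge0.
  - by move=> w; exact: measurable_no_return_cyl.
  - exact: measurable_return_power.
  - by move=> x; exact: return_power_ge0.
  - move=> x; rewrite sum_cyl_indic indicE; case: (boolP (x \in _)) => [|_]; last first.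
      by rewrite mulr0; exact: return_power_ge0.
    rewrite inE => Gx; rewrite mulr1; exact: return_power_ge_of_no_return.
rewrite lee_fin /power_sum big_distrr/=; apply: ler_sum => w _.
apply: le_trans (ler_wpM2l (expR_ge0 _) (prG w)).
rewrite -expR_lnM_cyl mulrA [leRHS]mulrA ler_wpM2r ?(ltW (m_gt0 _))//.
rewrite -mulrA -expRD mulrC ler_wpM2r//; first by rewrite ltW// !divr_gt0.
rewrite ler_expR -mulrN -mulrDr ler_wpM2l// -ln_div ?posrE// ler_ln ?posrE ?divr_gt0 ?ltr0n//.
exact: ltW (truncnS_gt _).
Qed.

Lemma no_return_le n K K' x : (K <= K')%N -> @no_return A hA n K' x -> no_return n K x.
Proof. by move=> KK H k /andP[k0 kK]; apply: H; rewrite k0 (leq_trans kK). Qed.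

Lemma moment_upper_pos q : 0 <= q -> exists2 K : R, 0 < K &
  forall n, (0 < n)%N ->
    (moment q n <= (K * expR (q * ln n%:R) * power_sum (1 - q) n)%:E)%E.
Proof.
(* From one scale to the next the power grows by 2^q; the probability bound exp (- j B) then leaves
   2^(-j), which is summable. *)
move=> q0; pose B := (q + 1) * ln 2.
have l2 : 0 < ln 2 :> R by rewrite ln_gt0// ltr1n.
have B0 : 0 < B by rewrite mulr_gt0// ltr_wpDl.
have BC0 : 0 < (B + 1) * C by rewrite mulr_gt0// addr_gt0.
exists (2 * expR B * expR (q * ln ((B + 1) * C))) => [|n n0].
  by rewrite !mulr_gt0 ?expR_gt0.
have n0R : (0 : R) < n%:R by rewrite ltr0n.
pose L (w : n.-tuple A) := (Num.trunc (B / (m w / C))).+1.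
have s01 (w : n.-tuple A) : 0 < m w / C <= 1.
  rewrite divr_gt0//= ler_pdivrMr// mul1r; exact: le_trans (m_le1 mu w) C_ge1.
have LP (w : n.-tuple A) : B <= (L w)%:R * (m w / C) /\ (L w)%:R <= (B + 1) * C / m w.
  have /andP[s0 s1] := s01 w.
  have y0 : 0 <= B / (m w / C) by rewrite divr_ge0// ltW.
  have [h1 h2] := ceil_nat_bounds y0; split; first by rewrite -ler_pdivrMr.
  apply: le_trans h2 _; rewrite -mulrA -[C / m w]invf_div mulrDl mul1r lerD2l.
  by rewrite invf_ge1.
(* On the event first return > 2^(j-1) L n, which has probability of order
   exp (- 2^(j-1) B), the power of the return time is charged at the next scale
   2^j L n; B is large enough for the resulting series to converge. *)
pose t (w : n.-tuple A) j : nat := if j is j'.+1 then (2 ^ j' * L w * n)%N else 0%N.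
pose E j (w : n.-tuple A) : set X := cyl w `&` no_return n (t w j).
pose c j (w : n.-tuple A) := expR (q * ln (2 ^ j * L w * n)%:R).
have prE j w : pr mu (E j w) <= m w * (expR B * expR (- (j%:R * B))).
  case: j => [|j].
    rewrite mul0r oppr0 expR0 mulr1; apply: le_trans (_ : m w <= _).
      by apply: pr_mono; [exact: measurable_no_return_cyl|exact: measurable_cyl|move=> x []].
    by rewrite -[leLHS]mulr1 ler_wpM2l ?(ltW (m_gt0 _))// -expR0 ler_expR ltW.
  have T := no_return_tail C_ge1 qb_ge (w := w) (2 ^ j * L w); rewrite size_tuple in T.
  apply: le_trans (T n0) _; rewrite ler_wpM2l ?(ltW (m_gt0 _))//.
  have /andP[s0 s1] := s01 w.
  apply: le_trans (expr_le_expR _ _) _; first by rewrite (ltW s0).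
  rewrite -expRD ler_expR -natr1 mulrDl mul1r opprD addrCA subrr addr0 lerN2.
  rewrite natrM -mulrA; have [h1 _] := LP w.
  have : B * j%:R <= B * (2 ^ j)%:R.
    by rewrite ler_wpM2l ?(ltW B0)// ler_nat ltnW// ltn_expl.
  have : (2 ^ j)%:R * B <= (2 ^ j)%:R * ((L w)%:R * (m w / C)) by rewrite ler_wpM2l.
  lra.
have c0 j w : 0 <= c j w by exact: expR_ge0.
have cG j x : \sum_(w : n.-tuple A) c j w * \1_(E j w) x =
    c j (word n x) * \1_(no_return n (t (word n x) j) : set X) x.
  exact: sum_cyl_indic.
have pos j w : (0 < 2 ^ j * L w * n)%N by rewrite !muln_gt0 expn_gt0 n0.
apply: (@integral_le_series _ _ _ mu _ (index_enum _) c E) => //.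
- by move=> j w; exact: measurable_no_return_cyl.
- exact: measurable_return_power.
- by move=> x; exact: return_power_ge0.
- move=> x; set w := word n x.
  have G0 j : (0%R <= (\sum_(w : n.-tuple A) c j w * \1_(E j w) x)%:E)%E.
    by rewrite lee_fin sumr_ge0// => i _; rewrite mulr_ge0// indicE.
  case Ef : (first_return n x) => [|k].
    (* A point that never returns lies in all the events, and each of its charges is at least 1, so
       the series diverges there. *)
    rewrite [leRHS](_ : _ = +oo%E) ?leey//; apply/eqyP => a _.
    pose N := (Num.trunc `|a|).+1.
    apply: le_trans (nneseries_lim_ge N (fun k _ _ => G0 k)).
    rewrite sumEFin lee_fin; apply: le_trans (_ : \sum_(0 <= j < N) 1 <= _).
      rewrite sumr_const_nat subn0; apply: le_trans (ler_norm a) _.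
      exact: ltW (truncnS_gt _).
    apply: ler_sum => j _; rewrite cG -/w indicE mem_set ?mulr1; last first.
      by move=> i /andP[i0 _]; move/first_return0P : Ef; apply.
    by rewrite -expR0 ler_expR mulr_ge0// ln_ge0// ler1n.
  (* The first scale that reaches the return time; by minimality there is no return up to the
     previous scale, so the point lies in [E j]. *)
  have ex : exists j, (k.+1 <= 2 ^ j * L w * n)%N.
    exists k.+1; apply: leq_trans (ltnW (ltn_expl k.+1 (ltnSn 1))) _.
    by rewrite -mulnA leq_pmulr// muln_gt0 n0.
  case: (ex_minnP ex) => j kj jmin.
  rewrite (return_power_finE _ Ef).
  apply: (@le_trans _ _ (\sum_(w : n.-tuple A) c j w * \1_(E j w) x)%:E); last first.
    apply: le_trans (nneseries_lim_ge j.+1 (fun k _ _ => G0 k)).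
    rewrite big_nat_recr//= leeDr// sume_ge0//.
  rewrite cG -/w indicE mem_set ?mulr1; last first.
    have [_] := (first_returnP _ _ (ltn0Sn k)).1 Ef; apply: no_return_le => /=.
    case: j kj jmin => [|j] // _ jmin; rewrite /t leqNgt; apply/negP => kj.
    by have := jmin j kj; rewrite ltnn.
  by rewrite lee_fin ler_expR ler_wpM2l// ler_ln ?posrE ?ltr0n// ler_nat.
move=> N.
apply: le_trans (_ : \sum_(j < N) \sum_(w : n.-tuple A) expR (- (j%:R * ln 2)) *
   (expR B * (expR (q * ln ((B + 1) * C)) * expR (q * ln n%:R) * expR ((1 - q) * ln (m w)))) <= _).
  apply: ler_sum => j _; apply: ler_sum => w _.
  apply: le_trans (ler_wpM2l (c0 _ _) (prE j w)) _.
  have [_ h2] := LP w.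
  have L0 : (0 : R) < (L w)%:R by rewrite ltr0n.
  have Hl : ln (L w)%:R <= ln ((B + 1) * C) - ln (m w).
    by rewrite -ln_div ?posrE// ler_ln ?posrE// divr_gt0.
  have cE : ln (2 ^ j * L w * n)%:R = j%:R * ln 2 + ln (L w)%:R + ln n%:R :> R.
    rewrite !natrM !lnM ?posrE ?mulr_gt0 ?ltr0n ?expn_gt0//.
    by rewrite natrX lnXn// mulr_natl.
  rewrite -expR_lnM_cyl /c cE.
  rewrite [m w * _]mulrC !mulrA ler_wpM2r ?(ltW (m_gt0 _))// -!expRD ler_expR.
  have := ler_wpM2l q0 Hl; lra.
rewrite (eq_bigr (fun j : 'I_N => expR (- (j%:R * ln 2)) * (expR B * (expR (q * ln ((B + 1) * C)) * expR (q * ln n%:R) * power_sum (1 - q) n)))); last first.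
  by move=> j _; rewrite /power_sum !big_distrr/=; apply: eq_bigr => w _.
rewrite -big_distrl/=.
apply: le_trans (ler_wpM2r _ (halving_sum_le R N)) _.
  by rewrite !mulr_ge0 ?expR_ge0// /power_sum sumr_ge0// => w _; exact: expR_ge0.
by rewrite !mulrA.
Qed.

(** A return at j <= n is charged 1 and paid by [Q]. For n < j <= L, with L of order 1 / mu[w], the
    probability is at most C mu[w]^2, and j^q <= L^(1+q) / j because q >= -1; the harmonic sum costs
    a logarithm of L, linear in n. Later returns are charged L^q. *)
Lemma moment_upper_neg q (Q : nat -> R) (b b' : R) : -1 <= q -> q <= 0 -> 0 <= b ->
  (forall n j, (0 < j)%N -> pr mu (returns n j) <= Q n) ->
  (forall w, - ln (m w) <= b * (size w)%:R + b') ->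
  exists2 K : R, 0 < K & forall n, (0 < n)%N ->
    (moment q n <= (n%:R * Q n + K * n%:R * power_sum (1 - q) n)%:E)%E.
Proof.
move=> q1 q0 b0 HQ Hb.
pose K0 := 1 + 2 * C * (1 + ln 2 + b + `|b'|).
have l2 : 0 < ln 2 :> R by rewrite ln_gt0// ltr1n.
have K00 : 0 < K0 by rewrite ltr_wpDr// mulr_ge0 ?mulr_ge0 ?(ltW C_gt0)// !addr_ge0 ?(ltW l2).
exists K0 => // n n0; have n0R : (0 : R) < n%:R by rewrite ltr0n.
pose L (w : n.-tuple A) := (Num.trunc (m w)^-1).+1.
have LP (w : n.-tuple A) : (m w)^-1 <= (L w)%:R /\ (L w)%:R <= 2 / m w.
  have y0 : 0 <= (m w)^-1 by rewrite invr_ge0 ltW.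
  have [h1 h2] := ceil_nat_bounds y0; split => //; apply: le_trans h2 _.
  by rewrite mulr_natl mulr2n lerD2l invf_ge1// (m_le1 mu).
(* The index (w, 0) charges L^q on all of [w], which takes care of returns after L and of points
   that never return; (w, j) charges j^q on a return at time j. *)
pose I := (n.-tuple A * nat)%type.
pose r : seq I := [seq (w, j) | w <- index_enum {: n.-tuple A}, j <- iota 0 (L w).+1].
pose c (wj : I) := expR (q * ln (if wj.2 == 0%N then L wj.1 else wj.2)%:R).
pose E (wj : I) : set X := if wj.2 == 0%N then cyl wj.1 else cyl wj.1 `&` returns n wj.2.
have c0 i : 0 <= c i by exact: expR_ge0.
have mE i : measurable (E i).
  by rewrite /E; case: ifP => _; [exact: measurable_cyl|exact: measurable_returns_cyl].
have big_r (F : I -> R) : \sum_(i <- r) F i =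
    \sum_(w : n.-tuple A) (F (w, 0%N) + \sum_(1 <= j < (L w).+1) F (w, j)).
  rewrite big_allpairs_dep; apply: eq_bigr => w _.
  by rewrite -[iota 0 _]/(index_iota 0 (L w).+1) big_nat_recl// big_add1.
apply: le_trans (_ : (_ <= (\sum_(i <- r) c i * pr mu (E i))%:E)%E) _.
  apply: integral_le_weighted => //.
  - exact: measurable_return_power.
  - by move=> x; exact: return_power_ge0.
  - move=> x; set w := word n x.
    have wx : cyl w x by exact/cyl_word.
    have term j : (j <= L w)%N -> E (w, j) x ->
        c (w, j) <= \sum_(i <- r) c i * \1_(E i) x.
      move=> jL Ex; have inr : (w, j) \in r.
        by apply/allpairsPdep; exists w, j; split => //; [exact: mem_index_enum|rewrite mem_iota add0n ltnS].
      rewrite (big_rem _ inr)/= indicE mem_set// mulr1 lerDl.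
      by apply: sumr_ge0 => i _; rewrite mulr_ge0// indicE.
    have t0 := term 0%N (leq0n _) wx.
    case Ef : (first_return n x) => [|k].
      rewrite (return_power_inftyE _ Ef); case: eqVneq => [qe|qn].
        rewrite lee_fin; apply: le_trans t0; by rewrite /c qe mul0r expR0.
      by rewrite ltNge q0/= lee_fin; apply: le_trans t0.
    rewrite (return_power_finE _ Ef) lee_fin.
    have [rk _] := (first_returnP _ _ (ltn0Sn k)).1 Ef.
    have [kL|Lk] := leqP k.+1 (L w); first exact: (term k.+1 kL (conj wx rk)).
    apply: le_trans t0; rewrite /c /= ler_expR ler_wnM2l// ler_ln ?posrE ?ltr0n//.
    by rewrite ler_nat ltnW.
rewrite lee_fin big_r.
have bnd (w : n.-tuple A) : c (w, 0%N) * pr mu (E (w, 0%N)) + \sum_(1 <= j < (L w).+1) c (w, j) * pr mu (E (w, j)) <=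
    \sum_(1 <= j < n.+1) pr mu (cyl w `&` returns n j) + K0 * n%:R * expR ((1 - q) * ln (m w)).
  have [h1 h2] := LP w.
  have L0 : (0 : R) < (L w)%:R by rewrite ltr0n.
  have mw := m_gt0 w.
  have lnL1 : - ln (m w) <= ln (L w)%:R.
    by rewrite -lnV ?posrE// ler_ln ?posrE ?invr_gt0.
  have lnL2 : ln (L w)%:R <= ln 2 - ln (m w).
    by rewrite -ln_div ?posrE// ler_ln ?posrE ?divr_gt0.
  have n1 : 1 <= n%:R :> R by rewrite ler1n.
  have b'n : b' <= `|b'| * n%:R.
    by apply: le_trans (ler_norm _) _; rewrite ler_peMr.
  have lnL : 1 + ln (L w)%:R <= (1 + ln 2 + b + `|b'|) * n%:R.
    have := Hb w; rewrite size_tuple.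
    have : (1 + ln 2 : R) <= (1 + ln 2) * n%:R by rewrite ler_peMr// addr_ge0// ltW.
    lra.
  have hA0 : c (w, 0%N) * pr mu (E (w, 0%N)) <= expR ((1 - q) * ln (m w)).
    rewrite /c /E /= -/(m w) -expR_lnM_cyl ler_wpM2r ?(ltW mw)// ler_expR -mulrN.
    by rewrite ler_wnM2l.
  have hB j : (0 < j)%N -> (j <= L w)%N -> c (w, j) * pr mu (E (w, j)) <=
      (if (j <= n)%N then pr mu (cyl w `&` returns n j) else 0) +
      expR ((1 + q) * ln (L w)%:R) * expR (- ln j%:R) * (C * m w * m w).
    move=> j0 jL; rewrite /c /E /= gtn_eqF//.
    have j0R : (0 : R) < j%:R by rewrite ltr0n.
    have lnj : 0 <= ln j%:R :> R by rewrite ln_ge0// ler1n.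
    case: leqP => jn.
      apply: le_trans (_ : pr mu (cyl w `&` returns n j) <= _).
        rewrite -[leRHS]mul1r ler_wpM2r ?pr_ge0// -[leRHS]expR0 ler_expR.
        by rewrite mulr_le0_ge0.
      by rewrite lerDl !mulr_ge0 ?expR_ge0 ?(ltW C_gt0) ?(ltW mw).
    rewrite add0r; have T := pr_returns_long qb_le (w := w) (j := j).
    rewrite size_tuple in T; apply: le_trans (ler_wpM2l (expR_ge0 _) (T (ltnW jn))) _.
    rewrite ler_wpM2r ?mulr_ge0 ?(ltW C_gt0) ?(ltW mw)// -expRD ler_expR.
    have : (1 + q) * ln j%:R <= (1 + q) * ln (L w)%:R.
      by rewrite ler_wpM2l ?ler_ln ?posrE ?ler_nat//; lra.
    lra.
  have hS : \sum_(1 <= j < (L w).+1) c (w, j) * pr mu (E (w, j)) <=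
     \sum_(1 <= j < n.+1) pr mu (cyl w `&` returns n j) +
     expR ((1 + q) * ln (L w)%:R) * (1 + ln (L w)%:R) * (C * m w * m w).
    apply: le_trans (_ : \sum_(1 <= j < (L w).+1) ((if (j <= n)%N then pr mu (cyl w `&` returns n j) else 0) +
      expR ((1 + q) * ln (L w)%:R) * expR (- ln j%:R) * (C * m w * m w)) <= _).
      by rewrite [leLHS]big_nat_cond [leRHS]big_nat_cond; apply: ler_sum => j /andP[/andP[j0 jL] _]; exact: hB.
    rewrite big_split/=; apply: lerD.
      rewrite -big_mkcondr/=.
      apply: le_trans (_ : \sum_(1 <= j < (maxn (L w) n).+1 | (j <= n)%N) pr mu (cyl w `&` returns n j) <= _).
        rewrite [leRHS](big_cat_nat (n := (L w).+1))//=; last by rewrite ltnS leq_maxl.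
        by rewrite lerDl; apply: sumr_ge0 => j _; exact: pr_ge0.
      rewrite le_eqVlt; apply/orP; left; apply/eqP.
      rewrite (big_cat_nat (n := n.+1))//=; last by rewrite ltnS leq_maxr.
      rewrite [X in _ + X]big_nat_cond [X in _ + X]big1 ?addr0; last first.
        by move=> j /andP[/andP[nj _] jn]; move: (leq_trans nj jn); rewrite ltnn.
      by rewrite [LHS]big_nat_cond [RHS]big_nat; apply: eq_bigl => j; rewrite ltnS; case: (j <= n)%N; rewrite ?andbT ?andbF.
    rewrite -big_distrl -big_distrr/=.
    rewrite ler_wpM2r ?mulr_ge0 ?(ltW C_gt0) ?(ltW mw)// ler_wpM2l ?expR_ge0//.
    exact: harmonic_sum_le.
  have hT : expR ((1 + q) * ln (L w)%:R) * (1 + ln (L w)%:R) * (C * m w * m w) <=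
     2 * C * (1 + ln 2 + b + `|b'|) * n%:R * expR ((1 - q) * ln (m w)).
    (* From L <= 2 / mu[w], 1 + q >= 0 and 2^(1+q) <= 2. *)
    have e1 : expR ((1 + q) * ln (L w)%:R) * (m w * m w) <= 2 * expR ((1 - q) * ln (m w)).
      have {1 2}-> : m w = expR (ln (m w)) by rewrite lnK.
      have -> : (2 : R) = expR (ln 2) by rewrite lnK// posrE.
      rewrite -!expRD ler_expR.
      have : (1 + q) * ln (L w)%:R <= (1 + q) * (ln 2 - ln (m w)) by rewrite ler_wpM2l//; lra.
      have : (- q) * ln 2 >= 0 by rewrite mulr_ge0 ?oppr_ge0// ltW.
      lra.
    have -> : expR ((1 + q) * ln (L w)%:R) * (1 + ln (L w)%:R) * (C * m w * m w) =
      expR ((1 + q) * ln (L w)%:R) * (m w * m w) * ((1 + ln (L w)%:R) * C) by ring.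
    have -> : 2 * C * (1 + ln 2 + b + `|b'|) * n%:R * expR ((1 - q) * ln (m w)) =
      2 * expR ((1 - q) * ln (m w)) * ((1 + ln 2 + b + `|b'|) * n%:R * C) by ring.
    apply: ler_pM => //.
    - by rewrite !mulr_ge0 ?expR_ge0 ?(ltW mw).
    - by rewrite mulr_ge0 ?(ltW C_gt0)// addr_ge0// ln_ge0// ler1n.
    - by rewrite ler_wpM2r ?(ltW C_gt0).
  have e0 : 0 <= expR ((1 - q) * ln (m w)) by exact: expR_ge0.
  have e1 : expR ((1 - q) * ln (m w)) <= n%:R * expR ((1 - q) * ln (m w)) by rewrite ler_peMl.
  have -> : K0 * n%:R * expR ((1 - q) * ln (m w)) = n%:R * expR ((1 - q) * ln (m w)) +
    2 * C * (1 + ln 2 + b + `|b'|) * n%:R * expR ((1 - q) * ln (m w)) by rewrite /K0; ring.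
  lra.
apply: le_trans (ler_sum _ (fun w _ => bnd w)) _.
rewrite big_split/= -big_distrr/= -/(power_sum _ _) lerD2r exchange_big/=.
apply: le_trans (_ : \sum_(1 <= j < n.+1) Q n <= _).
  rewrite [leLHS]big_nat_cond [leRHS]big_nat_cond; apply: ler_sum => j /andP[/andP[j0 _] _].
  apply: le_trans (HQ n j j0).
  have mr := finitary_measurable (@finitary_returns A hA n j).
  rewrite (pr_partition mu (@rv_word _ hA n) mr) le_eqVlt; apply/orP; left; apply/eqP.
  by apply: eq_bigr => w _; rewrite setIC cyl_tuple.
by rewrite sumr_const_nat subSS subn0 mulr_natl.
Qed.

End moment_bounds.

(** * Exponential growth rates *)

Section exponential_growth.
Context (R : realType).
Implicit Types (u : nat -> \bar R) (L : R).

(** The slack e absorbs the powers of n in the moment bounds, and K their constant factors. *)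
Definition growth_ge u L := forall e : R, 0 < e -> exists K N, forall n, (N <= n)%N ->
  ((expR (n%:R * (L - e) - K))%:E <= u n)%E.

Definition growth_le u L := forall e : R, 0 < e -> exists K N, forall n, (N <= n)%N ->
  (u n <= (expR (n%:R * (L + e) + K))%:E)%E.

Lemma growth_cvg u L : growth_ge u L -> growth_le u L ->
  (fun n => ((n%:R^-1)%:E * lne (u n))%E) @ \oo --> L%:E.
Proof.
move=> lo hi.
have H (e : R) : 0 < e -> \forall n \near \oo, exists2 y : R,
    ((n%:R^-1)%:E * lne (u n))%E = y%:E & `|L - y| <= e.
  move=> e0; have e2 : 0 < e / 2 by rewrite divr_gt0.
  have [K1 [N1 {}lo]] := lo _ e2; have [K2 [N2 {}hi]] := hi _ e2.
  pose N3 := (Num.trunc ((`|K1| + `|K2|) / (e / 2))).+1.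
  exists (maxn N1 (maxn N2 N3)) => // n /=; rewrite !geq_max => /and3P[n1 n2 n3].
  have := lo n n1; have := hi n n2.
  have nR : (`|K1| + `|K2|) / (e / 2) <= n%:R.
    by apply: le_trans (ltW (truncnS_gt _)) _; rewrite ler_nat.
  have n0 : (0 : R) < n%:R by rewrite ltr0n (leq_trans _ n3).
  move: nR; rewrite ler_pdivrMr// => nR.
  case: (u n) => [r| |]; rewrite ?leye_eq ?leeNy_eq// !lee_fin => r2 r1.
  have r0 : 0 < r := lt_le_trans (expR_gt0 _) r1.
  exists (n%:R^-1 * ln r); first by rewrite lne_EFin// EFinM.
  move: r1 r2; rewrite -[r]lnK ?posrE// !ler_expR expRK => r1 r2.
  have -> : L - n%:R^-1 * ln r = (n%:R * L - ln r) / n%:R by field; rewrite gt_eqF.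
  rewrite normrM [`|n%:R^-1|]gtr0_norm ?invr_gt0// ler_pdivrMr//.
  have := ler_norm K1; have := ler_norm K2; have := normr_ge0 K1; have := normr_ge0 K2.
  by rewrite ler_norml => *; apply/andP; split; lra.
apply/fine_cvgP; split.
  by have := H 1 ltr01; apply: filterS => n [y -> _].
apply/cvgrPdist_le => e e0; have := H e e0; apply: filterS => n [y /= -> //].
Qed.

Lemma growth_le_trans u u' L : (forall n, (u n <= u' n)%E) -> growth_le u' L -> growth_le u L.
Proof.
by move=> uu H e e0; have [K [N {}H]] := H e e0; exists K, N => n /H; apply: le_trans.
Qed.

Lemma ln_le_linear (a e : R) : 0 <= a -> 0 < e -> exists K, forall n, (0 < n)%N ->
  a * ln n%:R <= n%:R * e + K.
Proof.
move=> a0 e0; pose d := e / (a + 1).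
have a1 : 0 < a + 1 by rewrite ltr_wpDl.
have d0 : 0 < d by rewrite divr_gt0.
exists ((a + 1) * (- 1 - ln d)) => n n0; have nR : (0 : R) < n%:R by rewrite ltr0n.
have l0 : 0 <= ln n%:R :> R by rewrite ln_ge0// ler1n.
have h : ln n%:R <= d * n%:R - 1 - ln d.
  have : ln (d * n%:R) <= d * n%:R - 1.
    have -> : ln (d * n%:R) = ln (1 + (d * n%:R - 1)) by rewrite addrC subrK.
    by apply: le_ln1Dx; rewrite ltrBrDr addNr mulr_gt0.
  by rewrite lnM ?posrE//; lra.
have := ler_wpM2l (ltW a1) h.
have -> : (a + 1) * (d * n%:R - 1 - ln d) = n%:R * e + (a + 1) * (- 1 - ln d).
  by rewrite /d; field; rewrite gt_eqF.
by move: l0; lra.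
Qed.

End exponential_growth.

(** * Growth rates of the moments under the equilibrium state *)

Section moment_growth.
Context (R : realType) (A : finType) (hA : (1 < #|A|)%N).
Local Notation X := (full_shift hA).
Context (phi : X -> R) (v : nat -> R) (V : R).
Hypotheses (osc_phi : forall n, osc_le n phi (v n))
  (v_ge0 : forall n, 0 <= v n) (v_sum : forall n, \sum_(i < n) v i <= V)
  (phi_norm : normalized phi).
Context (mu : probability X R) (mu_eq : equilibrium_state phi mu).
Local Notation m := (cyl_pr mu).
Local Notation S := (birkhoff phi).
Local Notation P := (pressure_fun phi).
Local Notation M := (max_mean phi).

Let m_gt0 w : 0 < m w := cyl_pr_gt0 osc_phi v_ge0 v_sum phi_norm mu_eq w.
Let V_ge0 : 0 <= V.
Proof. by have := v_sum 0; rewrite big_ord0. Qed.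
Let C_ge1 : 1 <= expR (2 * V).
Proof. by rewrite -expR0 ler_expR mulr_ge0. Qed.
Let qb_le := quasi_bernoulli_le osc_phi v_ge0 v_sum phi_norm mu_eq.
Let qb_ge := quasi_bernoulli_ge osc_phi v_ge0 v_sum phi_norm mu_eq.

Lemma ln_cyl_pr w x : cyl w x -> `|ln (m w) - S (size w) x| <= V.
Proof.
move=> wx; have := gibbs_cyl osc_phi v_ge0 v_sum phi_norm mu_eq wx.
by rewrite -[m w]lnK ?posrE// !ler_expR expRK ler_norml => /andP[? ?]; apply/andP; split; lra.
Qed.

(** One error |t| V comes from the Gibbs property, the other from [pressure_asymptotics]. *)
Lemma power_sum_bounds t n : (0 < n)%N ->
  expR (n%:R * P t - 2 * (`|t| * V)) <= power_sum mu t n <=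
  expR (n%:R * P t + 2 * (`|t| * V)).
Proof.
move=> n0; have Z0 := partition_function_gt0 phi t n.
have := pressure_asymptotics osc_phi v_ge0 v_sum t n0; rewrite ler_norml => /andP[Z1 Z2].
have H (w : n.-tuple A) : t * S n (ext hA w) - `|t| * V <= t * ln (m w) <=
    t * S n (ext hA w) + `|t| * V.
  have := ln_cyl_pr (cyl_ext hA w); rewrite size_tuple => h.
  have : `|t * (ln (m w) - S n (ext hA w))| <= `|t| * V by rewrite normrM ler_wpM2l.
  by rewrite ler_norml => /andP[? ?]; apply/andP; split; lra.
have ZE : expR (ln (partition_function phi t n)) = partition_function phi t n.
  by rewrite lnK ?posrE.
apply/andP; split.
  apply: (@le_trans _ _ (partition_function phi t n * expR (- (`|t| * V)))).
    by rewrite -ZE -expRD ler_expR; lra.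
  rewrite /partition_function big_distrl/=; apply: ler_sum => w _.
  by rewrite -expRD ler_expR; have /andP[] := H w; lra.
apply: (@le_trans _ _ (partition_function phi t n * expR (`|t| * V))); last first.
  by rewrite -ZE -expRD ler_expR; lra.
rewrite /partition_function big_distrl/=; apply: ler_sum => w _.
by rewrite -expRD ler_expR; have /andP[] := H w; lra.
Qed.

Lemma cyl_pr_decay : exists2 rho : R, 0 < rho < 1 &
  forall w, m w <= expR V * rho ^+ size w.
Proof.
have [c c0 phic] := phi_upper_bound osc_phi v_ge0 phi_norm.
exists (expR (- c)) => [|w]; first by rewrite expR_gt0 expR_lt1 oppr_lt0.
have := ln_cyl_pr (cyl_ext hA w); have := birkhoff_le_const (size w) (ext hA w) phic.
rewrite ler_norml => h /andP[_ h'].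
rewrite -expRM_natl -expRD -[m w]lnK ?posrE// ler_expR; lra.
Qed.

Lemma growth_ge_pressure q : growth_ge (moment mu q) (P (1 - q)).
Proof.
have [rho /andP[rho0 rho1] decay] := cyl_pr_decay.
move=> e e0; set c := 2 * (`|1 - q| * V).
have [q0|/ltW q0] := leP 0 q.
  have [K K0 [N H]] := moment_lower_pos C_ge1 qb_le qb_ge m_gt0 rho0 rho1 decay q0.
  exists (c - ln K), (maxn N 1) => n; rewrite geq_max => /andP[nN n0].
  apply: le_trans (H n nN); rewrite lee_fin.
  have /andP[h _] := power_sum_bounds (1 - q) n0.
  apply: le_trans (ler_wpM2l (ltW K0) h).
  have KE : expR (ln K) = K by rewrite lnK ?posrE.
  rewrite -KE -expRD ler_expR expRK -/c.
  have : 0 <= n%:R * e by rewrite mulr_ge0// ltW.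
  lra.
have [K K0 H] := moment_lower_neg C_ge1 qb_ge m_gt0 q0.
have nq0 : 0 <= - q by rewrite oppr_ge0.
have [K1 HK1] := ln_le_linear nq0 e0.
exists (c - ln K + K1), 1%N => n n0.
apply: le_trans (H n n0); rewrite lee_fin.
have /andP[h _] := power_sum_bounds (1 - q) n0.
have Ke : 0 <= K * expR (q * ln n%:R) by rewrite mulr_ge0 ?expR_ge0// ltW.
apply: le_trans (ler_wpM2l Ke h).
have KE : expR (ln K) = K by rewrite lnK ?posrE.
rewrite -KE -!expRD ler_expR expRK -/c.
have := HK1 n n0; lra.
Qed.

Lemma growth_le_pos q : 0 <= q -> growth_le (moment mu q) (P (1 - q)).
Proof.
move=> q0 e e0; set c := 2 * (`|1 - q| * V).
have [K K0 H] := moment_upper_pos C_ge1 qb_ge m_gt0 q0.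
have [K1 HK1] := ln_le_linear q0 e0.
exists (ln K + c + K1), 1%N => n n0.
apply: le_trans (H n n0) _; rewrite lee_fin.
have /andP[_ h] := power_sum_bounds (1 - q) n0.
have Ke : 0 <= K * expR (q * ln n%:R) by rewrite mulr_ge0 ?expR_ge0// ltW.
apply: le_trans (ler_wpM2l Ke h) _.
have KE : expR (ln K) = K by rewrite lnK ?posrE.
rewrite -KE -!expRD ler_expR expRK -/c.
have := HK1 n n0; lra.
Qed.

(** By strong induction on the index: beyond the first j letters both points copy the letter j
    places before. *)
Lemma returns_periodic n j x : (0 < j)%N -> returns n j x ->
  agree (j + n) (periodic_point hA (word j x)) x.
Proof.
move=> j0 H i; elim/ltn_ind: i => i IH ijn.
have [ij|ji] := ltnP i j.
  rewrite /periodic_point size_tuple modn_small//.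
  by rewrite -[i]/(val (Ordinal ij)) -tnth_nth tnth_word.
have iE : i = (j + (i - j))%N by rewrite subnKC.
have ij : (i - j < n)%N by rewrite -(ltn_add2l j) -iE.
rewrite [in RHS]iE H// -IH; last 2 first.
- by rewrite -[ltnRHS]subn0 ltn_sub2l// (leq_trans j0).
- by rewrite (leq_ltn_trans _ ijn)// leq_subr.
by rewrite /periodic_point size_tuple [in LHS]iE modnDl.
Qed.

Lemma periodic_returns n s : returns n (size s) (periodic_point hA s).
Proof. by move=> i _; rewrite /periodic_point modnDl. Qed.

Lemma cyl_mkseq (x : X) n : cyl (mkseq x n) x.
Proof. by rewrite /cyl/= size_mkseq. Qed.

Lemma cyl_mkseqP (x y : X) n : cyl (mkseq x n) y <-> agree n x y.
Proof.
rewrite /cyl/= size_mkseq; split => [H i ilt|H].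
  by rewrite -(nth_mkseq (x 0%N) x ilt) -H nth_mkseq.
by apply/eq_in_map => i; rewrite mem_iota => /andP[_ /H].
Qed.

Lemma birkhoff_periodicD s n :
  S (size s + n) (periodic_point hA s) =
  S (size s) (periodic_point hA s) + S n (periodic_point hA s).
Proof. by rewrite birkhoffD -[in iter _ _ _](mul1n (size s)) shift_periodic_point. Qed.

(** The event is covered by the cylinders of length j + n around the points of period j. The one
    given by the word [u] has measure at most mu[u] exp (n M + 3 V): two errors V from the Gibbs
    property, one from [birkhoff_le_max]. Since the mu[u] sum to 1, the bound is uniform in j. *)
Lemma pr_returns_le_max n j : (0 < j)%N ->
  pr mu (returns n j) <= expR (3 * V + n%:R * M).
Proof.
move=> j0; pose p (u : j.-tuple A) := periodic_point hA u.
pose F (u : j.-tuple A) : set X := cyl (mkseq (p u) (j + n)).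
have mF u : measurable (F u) by exact: measurable_cyl.
have mB : measurable (\big[setU/set0]_(u : j.-tuple A) F u).
  by apply: bigsetU_measurable => u _.
apply: (@le_trans _ _ (pr mu (\big[setU/set0]_(u : j.-tuple A) F u))).
  apply: pr_mono => //; first exact: finitary_measurable (@finitary_returns _ _ _ _).
  move=> x rx; rewrite -bigcup_seq; exists (word j x); first exact: mem_index_enum.
  exact/cyl_mkseqP/returns_periodic.
apply: le_trans (pr_bigU_le mu _ mF) _.
apply: (@le_trans _ _ (\sum_(u : j.-tuple A) m u * expR (3 * V + n%:R * M))); last first.
  by rewrite -big_distrl/= sum_cyl_pr mul1r.
apply: ler_sum => u _.
have up : cyl u (p u).
  rewrite -[cyl u](_ : cyl (mkseq (p u) j) = _); first exact: cyl_mkseq.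
  congr cyl; rewrite -val_word; congr val; apply: eq_from_tnth => i.
  rewrite tnth_word /p /periodic_point size_tuple modn_small//.
  by rewrite -tnth_nth.
have := ln_cyl_pr up; have := ln_cyl_pr (cyl_mkseq (p u) (j + n)).
rewrite size_mkseq size_tuple -/(cyl_pr mu _).
have := birkhoff_periodicD u n; rewrite size_tuple => ->.
have := birkhoff_le_max osc_phi v_ge0 v_sum phi_norm n (p u).
rewrite !ler_norml => h /andP[_ h1] /andP[h2 _].
rewrite -[m (mkseq _ _)]lnK ?posrE// -[m u]lnK ?posrE// -expRD ler_expR.
by move: h1; rewrite -/(p u); lra.
Qed.

(** [L] dominates the rate M of the returns up to time n and the rate P(1 - q) of the typical ones;
    which of the two it equals depends on the side of q*. *)
Lemma growth_le_neg q L : -1 <= q -> q <= 0 -> M <= L -> P (1 - q) <= L ->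
  growth_le (moment mu q) L.
Proof.
move=> q1 q0 ML PL e e0; set c := 2 * (`|1 - q| * V).
have [B B0 phiB] := phi_lower_bound osc_phi v_ge0.
have Hb w : - ln (m w) <= B * (size w)%:R + V.
  have := ln_cyl_pr (cyl_ext hA w); have := birkhoff_ge_const (size w) (ext hA w) phiB.
  rewrite ler_norml => h /andP[h' _]; lra.
have [K K0 H] := moment_upper_neg C_ge1 qb_le m_gt0 q1 q0 (ltW B0) pr_returns_le_max Hb.
have [K1 HK1] := ln_le_linear (@ler01 R) e0.
have c0 : 0 <= c by rewrite mulr_ge0// mulr_ge0.
pose K2 := K1 + 3 * V + `|ln K| + c.
exists (K2 + ln 2), 1%N => n n0; apply: le_trans (H n n0) _; rewrite lee_fin.
have nR : (0 : R) < n%:R by rewrite ltr0n.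
have ln_n := HK1 n n0; rewrite mul1r in ln_n.
have nML : n%:R * M <= n%:R * L by rewrite ler_wpM2l.
have nPL : n%:R * P (1 - q) <= n%:R * L by rewrite ler_wpM2l.
have /andP[_ h] := power_sum_bounds (1 - q) n0.
have a1 : n%:R * expR (3 * V + n%:R * M) <= expR (n%:R * (L + e) + K2).
  have -> : n%:R * expR (3 * V + n%:R * M) = expR (ln n%:R + (3 * V + n%:R * M)).
    by rewrite [RHS]expRD lnK ?posrE.
  rewrite ler_expR /K2.
  have := normr_ge0 (ln K); lra.
have a2 : K * n%:R * power_sum mu (1 - q) n <= expR (n%:R * (L + e) + K2).
  have Kn : 0 <= K * n%:R by rewrite mulr_ge0// ltW.
  apply: le_trans (ler_wpM2l Kn h) _.
  have -> : K * n%:R * expR (n%:R * P (1 - q) + 2 * (`|1 - q| * V)) =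
      expR (ln K + ln n%:R + (n%:R * P (1 - q) + c)).
    by rewrite [RHS]expRD [in RHS]expRD !lnK ?posrE.
  rewrite ler_expR /K2.
  have := ler_norm (ln K); have := V_ge0; lra.
apply: le_trans (lerD a1 a2) _.
have two : expR (ln 2) = 2 :> R by rewrite lnK ?posrE.
have -> : n%:R * (L + e) + (K2 + ln 2) = n%:R * (L + e) + K2 + ln 2 by rewrite addrA.
by rewrite [leRHS]expRD two mulr_natr mulr2n.
Qed.

(** Whole periods are peeled off one at a time; the incomplete last one is paid by the constant. *)
Lemma birkhoff_periodic_ge s (a B : R) : (0 < size s)%N -> 0 <= B ->
  (forall x, - B <= phi x) -> (size s)%:R * a <= S (size s) (periodic_point hA s) ->
  forall n, n%:R * a - (size s)%:R * (B + `|a|) <= S n (periodic_point hA s).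
Proof.
move=> s0 B0 phiB sa; elim/ltn_ind => n IH.
have sR : (0 : R) < (size s)%:R by rewrite ltr0n.
have [ns|sn] := ltnP n (size s).
  have := birkhoff_ge_const n (periodic_point hA s) phiB.
  have nsR : (n%:R : R) <= (size s)%:R by rewrite ler_nat ltnW.
  have := ler_wpM2r B0 nsR; have := ler_wpM2r (normr_ge0 a) nsR.
  have := ler_wpM2l (ler0n R n) (ler_norm a); lra.
have nE : n = (size s + (n - size s))%N by rewrite subnKC.
rewrite nE birkhoff_periodicD natrD.
have := IH (n - size s)%N; rewrite -[ltnRHS]subn0 ltn_sub2l ?(leq_trans s0)// => /(_ isT).
lra.
Qed.

(** All points in the cylinder of length k + n around a nearly maximizing point of period k return
    by time k. As k does not depend on n, the power k^q is only a constant. *)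
Lemma growth_ge_max q : q <= 0 -> growth_ge (moment mu q) M.
Proof.
move=> q0 e e0; have [B B0 phiB] := phi_lower_bound osc_phi v_ge0.
have [s s0 sM] := periodic_near_max osc_phi v_ge0 v_sum phi_norm e0.
set k := size s in s0 sM; pose p := periodic_point hA s.
pose K1 := k%:R * (B + `|M - e|).
exists (K1 + V - q * ln k%:R - k%:R * (M - e)), 0%N => n _.
pose E (_ : unit) : set X := cyl (mkseq p (k + n)).
have mE i : measurable (E i) by exact: measurable_cyl.
apply: (@le_trans _ _ (\sum_(i <- [:: tt]) expR (q * ln k%:R) * pr mu (E i))%:E).
  rewrite big_seq1 lee_fin.
  have := ln_cyl_pr (cyl_mkseq p (k + n)); rewrite size_mkseq.
  have := birkhoff_periodic_ge s0 (ltW B0) phiB sM (k + n).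
  rewrite ler_norml natrD -/K1 => h /andP[h' _].
  rewrite -[pr mu _]lnK ?posrE; last exact: m_gt0.
  by rewrite -expRD ler_expR; move: h'; rewrite /cyl_pr -/(E tt); lra.
apply: (@integral_ge_weighted _ _ _ mu _ [:: tt] (fun=> expR (q * ln k%:R)) E) => //.
- exact: measurable_return_power.
- by move=> x; exact: return_power_ge0.
- move=> x; rewrite big_seq1 indicE; case: (boolP (x \in _)) => [|_]; last first.
    by rewrite mulr0; exact: return_power_ge0.
  rewrite inE => /cyl_mkseqP px; rewrite mulr1.
  apply: return_power_le_of_returns => // i ilt.
  rewrite -!px ?ltn_add2l// ?(ltn_addl _ ilt)//.
  exact: (@periodic_returns n s).
Qed.

Lemma moment_mono q q' n : q <= q' -> q' <= 0 -> (moment mu q n <= moment mu q' n)%E.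
Proof.
move=> qq q0; apply: ge0_le_integral => //.
- by move=> x _; exact: return_power_ge0.
- exact: measurable_return_power.
- exact: measurable_return_power.
- by move=> x _; exact: return_power_mono.
Qed.

Lemma return_time_rate_cvg ts q : ts <= 2 -> 1 < ts -> P ts = M ->
  (forall t, t <= ts -> M <= P t) -> (forall t, ts < t -> P t < M) ->
  return_time_rate mu q @ \oo --> (if 1 - ts <= q then P (1 - q) else M)%:E.
Proof.
move=> ts2 ts1 PM le_ts gt_ts; apply: growth_cvg; case: (leP (1 - ts) q) => qs.
- exact: growth_ge_pressure.
- by apply: growth_ge_max; lra.
- have [q0|/ltW q0] := leP 0 q; first exact: growth_le_pos.
  by apply: growth_le_neg => //; [lra|apply: le_ts; lra].
- have PqM (r : R) : r <= 1 - ts -> P (1 - r) <= M.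
    rewrite le_eqVlt => /predU1P[->|h]; first by rewrite opprB addrC subrK PM.
    by apply: ltW; apply: gt_ts; lra.
  have [q1|/ltW q1] := leP (-1) q.
    by apply: growth_le_neg => //; [lra|apply: PqM; exact: ltW].
  (* Below -1 the moment is at most the one at -1, whose rate is at most M already, because ts <=
     2. *)
  apply: (@growth_le_trans _ _ (moment mu (-1))) => [n|]; first by apply: moment_mono => //; lra.
  by apply: growth_le_neg => //; apply: PqM; lra.
Qed.

End moment_growth.

Theorem theorem3p1 (R : realType) (A : finType) (hA : (1 < #|A|)%N)
    (phi : full_shift hA -> R) (mu : probability (full_shift hA) R)
    (phi_sv : summable_variation phi)
    (phi_norm : normalized phi)
    (mu_eq : equilibrium_state phi mu)
    (phi_nontrivial : ~ exists u : full_shift hA -> R,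
       continuous u /\
       forall x, phi x = u x - u (left_shift x) - ln (#|A|%:R)) :
  exists qs : R,
    [/\ -1 <= qs < 0,
        forall q : R,
          pressure (fun x => (1 - q) * phi x) = max_integral phi <-> q = qs
      & forall q : R,
        [/\ cvgn (return_time_rate mu q),
            return_time_spectrum mu q \is a fin_num
          & return_time_spectrum mu q =
              if qs <= q then pressure (fun x => (1 - q) * phi x)
              else max_integral phi]].
Proof.
have var_ge0 n : (0 <= var_n phi n)%E.
  by apply: ereal_sup_ubound; exists point, point; split; rewrite // subrr normr0.
have series_ge0 : (0 <= \sum_(0 <= n <oo) var_n phi n)%E by apply: nneseries_ge0.
pose V := fine (\sum_(0 <= n <oo) var_n phi n)%E.
have VE : (\sum_(0 <= n <oo) var_n phi n)%E = V%:E by rewrite fineK// ge0_fin_numE.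
have partial n : (\sum_(0 <= i < n) var_n phi i <= V%:E)%E.
  by rewrite -VE; apply: nneseries_lim_ge => k _ _.
(* Each variation is a term of a convergent series of nonnegative terms, hence finite, which yields
   the real sequence [v] with partial sums below [V]. *)
have var_fin n : var_n phi n = (fine (var_n phi n))%:E.
  rewrite fineK// ge0_fin_numE//; apply: le_lt_trans (ltry V).
  apply: le_trans (partial n.+1); rewrite big_nat_recr//= leeDr// sume_ge0//.
pose v n := fine (var_n phi n).
have v_ge0 n : 0 <= v n by rewrite fine_ge0.
have v_sum n : \sum_(i < n) v i <= V.
  rewrite -lee_fin; apply: le_trans (partial n).
  by rewrite big_mkord -sumEFin; apply: lee_sum => i _; rewrite -var_fin.
have osc_phi n : osc_le n phi (v n).
  by move=> x y xy; rewrite -lee_fin -var_fin; apply: ereal_sup_ubound; exists x, y.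
have [ts [/andP[ts1 ts2] PM le_ts gt_ts]] := critical_exponent osc_phi v_ge0 v_sum phi_norm.
exists (1 - ts); split.
- by apply/andP; split; lra.
- move=> q; rewrite (pressure_funE osc_phi v_ge0 v_sum) (max_meanE osc_phi v_ge0 v_sum phi_norm).
  split=> [[]|->]; last by rewrite opprB addrC subrK PM.
  rewrite -PM => PE; have [h|h|h] := ltgtP (1 - q) ts.
  + by have := pressure_fun_decr osc_phi v_ge0 v_sum phi_norm h; rewrite PE ltxx.
  + by have := pressure_fun_decr osc_phi v_ge0 v_sum phi_norm h; rewrite PE ltxx.
  + by rewrite -h opprB addrC subrK.
move=> q.
have cv := return_time_rate_cvg osc_phi v_ge0 v_sum phi_norm mu_eq (q := q) ts2 ts1 PM le_ts gt_ts.
have limE : return_time_spectrum mu q = _ := cvg_lim (@ereal_hausdorff R) cv.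
split; first by apply/cvg_ex; eexists; exact: cv.
  by rewrite limE.
rewrite limE (pressure_funE osc_phi v_ge0 v_sum) (max_meanE osc_phi v_ge0 v_sum phi_norm).
by case: ifP.
Qed.
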